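(* Let $G$ be a connected real Lie group, $R\ge0$ and $R'\ge1$, and let $\hbar\in\mathbb C$. The standard-ordered star product $$\star_{\mathrm{std}}\colon\mathrm{Pol}_{R,R'}(T^*G)\times\mathrm{Pol}_{R,R'}(T^*G)\longrightarrow\mathrm{Pol}_{R,R'}(T^*G)$$ is well-defined and continuous, and it extends to a continuous product $$\star_{\mathrm{std}}\colon\widehat{\mathrm{Pol}}_{R,R'}(T^*G)\times\widehat{\mathrm{Pol}}_{R,R'}(T^*G)\longrightarrow\widehat{\mathrm{Pol}}_{R,R'}(T^*G).$$ More precisely, for all $c,c'\ge1$ there is a $d\ge1$, depending continuously on $\hbar$, such that $$(q_{R,c}\otimes p_{R',c'})(P\star_{\mathrm{std}}Q)\le2\cdot(q_{R,d}\otimes p_{R',d})(P)\cdot(q_{R,d}\otimes p_{R',d})(Q)$$ for all $P,Q\in\widehat{\mathrm{Pol}}_{R,R'}(T^*G)$.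
   Context: All functions are complex-valued. $G$ is a connected real Lie group of dimension $n$ with Lie algebra $\mathfrak g$, unit $\mathrm e$ and fixed basis $(e_1,\dots,e_n)$ of $\mathfrak g$; for $\xi\in\mathfrak g$, $X_\xi$ is the left-invariant vector field with $X_\xi(\mathrm e)=\xi$, and $X_i=X_{e_i}$. For $\alpha\in\{1,\dots,n\}^k$ put $\mathcal L_{X_\alpha}=\mathcal L_{X_{\alpha_1}}\cdots\mathcal L_{X_{\alpha_k}}$. Set $$q_{R,c}(\phi)=\sum_{k\ge0}k!^{R-1}c^k\sum_{\alpha\in\{1,\dots,n\}^k}|(\mathcal L_{X_\alpha}\phi)(\mathrm e)|,$$ and $\mathscr E_R(G)=\{\phi\in C^\omega(G):q_{R,c}(\phi)<\infty\ \forall c\ge0\}$ ($C^\omega$ = real-analytic), topologized by all $q_{R,c}$. $\mathrm{Sym}_{R'}(\mathfrak g)$ is the (complexified) symmetric algebra, with product $\vee$, topologized by $p_{R',c}(v)=\sum_{k}k!^{R'}c^k\,p^k(v_k)$, $c\ge0$, where $v=\sum_k v_k$ with $v_k\in\mathrm{Sym}^k(\mathfrak g)$, $p$ is the $\ell^1$-norm on $\mathfrak g$ for the chosen basis and $p^k$ its $k$-fold projective tensor power on $\mathrm{Sym}^k(\mathfrak g)\subseteq\mathfrak g^{\otimes k}$. $\mathrm{Pol}_{R,R'}(T^*G)=\mathscr E_R(G)\otimes\mathrm{Sym}_{R'}(\mathfrak g)$ carries the projective tensor product topology, defined by the projective tensor seminorms $q_{R,c}\otimes p_{R',c'}$ (extended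 continuously to the completion), and $\widehat{\mathrm{Pol}}_{R,R'}(T^*G)$ is its completion. Star products, for $\hbar\in\mathbb C$ and $z=\hbar/\mathrm i$: the Gutt star product $\star_{\mathfrak g}$ on $\mathrm{Sym}^\bullet(\mathfrak g)$ is, for $z\neq0$, $\xi\star_{\mathfrak g}\eta=\mathfrak q_z^{-1}(\mathfrak q_z(\xi)\mathfrak q_z(\eta))$, where $\mathfrak q_z\colon\mathrm{Sym}^\bullet(\mathfrak g)\to\mathrm U_{\mathbb C}(\mathfrak g)$ is the linear isomorphism onto the complexified universal enveloping algebra with $\mathfrak q_z(\xi_1\vee\dots\vee\xi_k)=\frac{z^k}{k!}\sum_{\sigma\in S_k}\xi_{\sigma(1)}\cdots\xi_{\sigma(k)}$; the result is polynomial in $z$ and equals $\xi\vee\eta$ at $z=0$. The standard-ordered star product $\star_{\mathrm{std}}$ on $C^\infty(G)\otimes\mathrm{Sym}^\bullet(\mathfrak g)$ is the bilinear product with $$(\phi\otimes\xi_1\vee\dots\vee\xi_k)\star_{\mathrm{std}}(\psi\otimes\eta)=\sum_{p=0}^k\Bigl(\frac{\hbar}{\mathrm i}\Bigr)^p\frac1{p!\,(k-p)!}\sum_{\sigma\in S_k}\bigl(\phi\cdot\mathcal L_{X_{\xi_{\sigma(1)}}}\cdots\mathcal L_{X_{\xi_{\sigma(p)}}}\psi\bigr)\otimes\bigl((\xi_{\sigma(p+1)}\vee\dots\vee\xi_{\sigma(k)})\star_{\mathfrak g}\eta\bigr)$$ for $\phi,\psi\in C^\infty(G)$, $\xi_i\in\mathfrak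 g$, $\eta\in\mathrm{Sym}^\bullet(\mathfrak g)$. *)

(* Defs.v *)
From HB Require Import structures.
From mathcomp Require Import all_boot all_order all_algebra.
From mathcomp Require Import all_classical all_reals all_analysis.
From mathcomp Require Import perm finmap complex.
(* The notations of monalg clash with those of the analysis library. *)
From mathcomp Require Import -(notations) monalg.

Set Implicit Arguments.
Unset Strict Implicit.
Unset Printing Implicit Defensive.

Import Order.TTheory GRing.Theory Num.Theory.
Import numFieldNormedType.Exports.

Local Open Scope classical_set_scope.
Local Open Scope ring_scope.

(* R[i] as a numClosedFieldType: the topology induced by the modulus is found
   on the sort of such a structure, but not on the bare type R[i]. *)
Definition cplx (R : realType) : numClosedFieldType := R[i]%C.

Section Cplx.
Context {R : realType}.

Definition creal (x : R) : cplx R := x%:C%C.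
Definition cre (z : cplx R) : R := complex.Re z.
Definition cim (z : cplx R) : R := complex.Im z.
Definition cmk (x y : R) : cplx R := (x +i* y)%C.
Definition cabs (z : cplx R) : R := cre `|z|.

(* z = hbar / i, the parameter of both star products *)
Definition zpar (hbar : cplx R) : cplx R := hbar / cmk 0 1.

End Cplx.

Section Analytic.
Context {R : realType}.

(* Power series in m variables are indexed by words instead of multi-indices:
   the coefficient of h^alpha is the sum of a k w over the words w of length
   k = |alpha| and content alpha. *)
Definition analytic_at m (f : 'rV[R]_m -> R) (x : 'rV[R]_m) : Prop :=
  exists (a : forall k, k.-tuple 'I_m -> R) (rho : R),
  [/\ 0 < rho,
      (\sum_(0 <= k <oo)
         (rho ^+ k * \sum_(w : k.-tuple 'I_m) `|a k w|)%:E < +oo)%E &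
      forall h : 'rV[R]_m, `|h| < rho ->
        (fun N : nat => \sum_(0 <= k < N) \sum_(w : k.-tuple 'I_m)
           a k w * \prod_(j < k) h 0 (tnth w j)) @ \oo --> f (x + h)].

Definition analytic_map_at m p (f : 'rV[R]_m -> 'rV[R]_p) (x : 'rV[R]_m) :=
  forall j, analytic_at (fun y => f y 0 j) x.

(* chart_fun and chart_inv are total; they are only meaningful on chart_dom
   and on its image. *)
Record chart (n : nat) (T : topologicalType) := Chart {
  chart_dom : set T ;
  chart_fun : T -> 'rV[R]_n ;
  chart_inv : 'rV[R]_n -> T ;
  chart_dom_open : open chart_dom ;
  chart_img_open : open (chart_fun @` chart_dom) ;
  chart_funK : {in chart_dom, cancel chart_fun chart_inv} ;
  chart_fun_continuous : {in chart_dom, continuous chart_fun} ;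
  chart_inv_continuous : {in chart_fun @` chart_dom, continuous chart_inv} }.

End Analytic.

Arguments chart R n T : clear implicits.

#[short(type="preTopologicalGroupType")]
HB.structure Definition PreTopologicalGroup := {G of Group G & Topological G}.

(* Every Lie group carries exactly one real-analytic structure for which the
   group operations are analytic; it is the one which C^omega(G) refers to. *)
Record lieGroup (R : realType) (n : nat) := LieGroup {
  lg_sort :> preTopologicalGroupType ;
  lg_atlas : set (chart R n lg_sort) ;
  lg_hausdorff : hausdorff_space lg_sort ;
  lg_second_countable : @second_countable lg_sort ;
  lg_mul_continuous :
    continuous (fun gh : lg_sort * lg_sort => (gh.1 * gh.2)%g) ;
  lg_inv_continuous : continuous (fun g : lg_sort => (g^-1)%g) ;
  lg_cover : forall g : lg_sort,
    exists2 c, lg_atlas c & chart_dom c g ;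
  lg_compatible : forall c1 c2, lg_atlas c1 -> lg_atlas c2 ->
    forall g, chart_dom c1 g -> chart_dom c2 g ->
    analytic_map_at (chart_fun c2 \o chart_inv c1) (chart_fun c1 g) ;
  lg_mul_analytic : forall c1 c2 c3,
    lg_atlas c1 -> lg_atlas c2 -> lg_atlas c3 ->
    forall g h, chart_dom c1 g -> chart_dom c2 h -> chart_dom c3 (g * h)%g ->
    analytic_map_at (fun xy : 'rV[R]_(n + n) => chart_fun c3
        (chart_inv c1 (lsubmx xy) * chart_inv c2 (rsubmx xy))%g)
      (row_mx (chart_fun c1 g) (chart_fun c2 h)) ;
  lg_inv_analytic : forall c1 c2, lg_atlas c1 -> lg_atlas c2 ->
    forall g, chart_dom c1 g -> chart_dom c2 (g^-1)%g ->
    analytic_map_at (fun x => chart_fun c2 (chart_inv c1 x)^-1%g)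
      (chart_fun c1 g) }.

(* A basis (e_1, ..., e_n) of the Lie algebra T_e G: the tangent space is
   identified with R^n by a chart around the unit, and the i-th row of
   fr_basis is e_i. *)
Record frame (R : realType) (n : nat) (G : lieGroup R n) := Frame {
  fr_chart : chart R n G ;
  fr_basis : 'M[R]_n ;
  fr_chart_atlas : lg_atlas fr_chart ;
  fr_chart_unit : chart_dom fr_chart 1%g ;
  fr_basis_unit : fr_basis \in unitmx }.

Section LieAlgebra.
Context {R : realType} {n : nat} {G : lieGroup R n} (F : frame G).

(* Elements xi of the Lie algebra are represented by their coordinates in the
   basis e. As X_xi(g) is the image of xi under the differential at the unit
   of the left translation by g, the derivative of f along X_xi at g is the
   derivative at the unit, in direction xi, of the function f(g _). *)
Definition lieR (xi : 'rV[R]_n) (f : G -> R) : G -> R := fun g =>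
  'D_(xi *m fr_basis F)
    (fun x : 'rV[R]_n => (f (g * chart_inv (fr_chart F) x)%g : R^o))
    (chart_fun (fr_chart F) 1%g).

Definition lie (xi : 'rV[R]_n) (phi : G -> cplx R) : G -> cplx R := fun g =>
  cmk (lieR xi (cre \o phi) g) (lieR xi (cim \o phi) g).

(* lies [:: xi_1; ...; xi_k] phi = L_{X_xi_1} ... L_{X_xi_k} phi *)
Definition lies (s : seq 'rV[R]_n) (phi : G -> cplx R) : G -> cplx R :=
  foldr lie phi s.

(* The components of [X_xi, X_eta](e) in the chart are its values on the
   coordinate functions of the chart. *)
Definition bracket (xi eta : 'rV[R]_n) : 'rV[R]_n :=
  (\row_l (let x_l := fun g : G => chart_fun (fr_chart F) g 0 l in
           lieR xi (lieR eta x_l) 1%g - lieR eta (lieR xi x_l) 1%g))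
  *m invmx (fr_basis F).

Definition basis_vec (i : 'I_n) : 'rV[R]_n := delta_mx 0 i.

End LieAlgebra.

Section Algebras.
Context (R : realType) (n : nat).
Let C := cplx R.

(* Sym(g) (x) C is the polynomial algebra in e_1, ..., e_n, with \vee as the
   multiplication. *)
Definition symAlg := malg (cmonom 'I_n) C.

(* T(g) (x) C is the free associative algebra on e_1, ..., e_n; the tensor
   power of degree k is spanned by the words of length k. *)
Definition tensAlg := malg (fmonom 'I_n) C.

HB.instance Definition _ := GRing.ComNzRing.on symAlg.
HB.instance Definition _ := GRing.Lmodule.on symAlg.
HB.instance Definition _ := GRing.NzRing.on tensAlg.
HB.instance Definition _ := GRing.Lmodule.on tensAlg.

Definition symVec (x : 'rV[C]_n) : symAlg :=
  \sum_i mkmalgU (ucm i) (x 0 i).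
Definition tensVec (x : 'rV[C]_n) : tensAlg :=
  \sum_i mkmalgU (fmu i) (x 0 i).
Definition cvec (x : 'rV[R]_n) : 'rV[C]_n := map_mx creal x.

(* A word whose product in Sym(g) is the monomial m *)
Definition cmonom_word (m : cmonom 'I_n) : seq 'I_n :=
  flatten [seq nseq (m i) i | i <- enum 'I_n].

(* 1/k! sum_s x_{s(1)} (x) ... (x) x_{s(k)} for the factors x_j of a word; this
   is the image of the product x_1 \vee ... \vee x_k in T^k(g) under the
   inclusion of Sym^k(g) as the symmetric tensors. *)
Definition symmetrize_word (w : seq 'I_n) : tensAlg :=
  (((size w)`!)%:R^-1 : C) *: \sum_(s : 'S_(size w))
    \prod_(j < size w) tensVec (cvec (basis_vec (tnth (in_tuple w) (s j)))).

(* A representative in T(g) of q_z(v) in U(g) *)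
Definition quantize (z : C) (v : symAlg) : tensAlg :=
  \sum_(m <- finmap.enum_fset (msupp v))
    (mcoeff m v * z ^+ mdeg m) *: symmetrize_word (cmonom_word m).

Definition sym_part (k : nat) (v : symAlg) : symAlg :=
  \sum_(m <- finmap.enum_fset (msupp v) | mdeg m == k)
    mkmalgU m (mcoeff m v).

Definition l1norm (x : 'rV[C]_n) : R := \sum_i cabs (x 0 i).

(* The projective tensor power of the l^1-norm, on T^k(g). The scalars a are
   redundant for k > 0, but not for k = 0. *)
Definition proj_power (k : nat) (t : tensAlg) : R :=
  inf [set y | exists (N : nat) (a : 'I_N -> C) (x : 'I_N -> 'I_k -> 'rV[C]_n),
    t = \sum_(i < N) a i *: \prod_(j < k) tensVec (x i j) /\
    y = \sum_(i < N) cabs (a i) * \prod_(j < k) l1norm (x i j)].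

(* p_{R',c}, for R' = r; mmeasure mdeg v bounds the degrees of the nonzero
   homogeneous components of v. *)
Definition sym_norm (r c : R) (v : symAlg) : R :=
  \sum_(k < mmeasure (@mdeg 'I_n) v)
    (k`!%:R `^ r) * c ^+ k * proj_power k (quantize 1 (sym_part k v)).

End Algebras.

Section Gutt.
Context {R : realType} {n : nat} {G : lieGroup R n} (F : frame G).
Let C := cplx R.

Definition two_sided_ideal (J : set (tensAlg R n)) : Prop :=
  [/\ J 0, forall s t, J s -> J t -> J (s + t)
    & forall s t u, J t -> J (s * t * u)].

(* The enveloping algebra U(g) is the quotient of T(g) by this ideal. *)
Definition env_ideal : set (tensAlg R n) :=
  [set t | forall J, two_sided_ideal J ->
     (forall xi eta : 'rV[R]_n,
        let iota x := tensVec (cvec x) in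
        J (iota xi * iota eta - iota eta * iota xi - iota (bracket F xi eta)))
     -> J t].

(* For z != 0, the element v such that q_z(v) = q_z(a) q_z(b) in U(g) *)
Definition gutt (z : C) (a b : symAlg R n) : symAlg R n :=
  if z == 0 then a * b else
  xget 0 [set v | env_ideal (quantize z v - quantize z a * quantize z b)].

End Gutt.

Section Functions.
Context {R : realType} {n : nat} {G : lieGroup R n} (F : frame G).
Let C := cplx R.

Definition analytic_fun (phi : G -> C) : Prop :=
  forall c, lg_atlas c -> forall g, chart_dom c g ->
    analytic_at (cre \o phi \o chart_inv c) (chart_fun c g) /\
    analytic_at (cim \o phi \o chart_inv c) (chart_fun c g).

(* q_{R,c}, for R = r, with values in [0, +oo] *)
Definition fun_norm (r c : R) (phi : G -> C) : \bar R :=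
  (\sum_(0 <= k <oo) ((k`!%:R `^ (r - 1)) * c ^+ k *
     \sum_(alpha : k.-tuple 'I_n)
       cabs (lies F (map (@basis_vec R n) alpha) phi 1%g))%:E)%E.

Definition entire (r : R) (phi : G -> C) : Prop :=
  analytic_fun phi /\ forall c, 0 <= c -> (fun_norm r c phi < +oo)%E.

End Functions.

Section Pol.
Context {R : realType} {n : nat} {G : lieGroup R n} (F : frame G).
Let C := cplx R.

(* A (x) Sym(g), for a space A of functions on G, is the space of polynomials in
   e_1, ..., e_n with coefficients in A. *)
Definition polFun := malg (cmonom 'I_n) (G -> C).
HB.instance Definition _ := GRing.Zmodule.on polFun.

Definition tens (phi : G -> C) (v : symAlg R n) : polFun :=
  \sum_(m <- finmap.enum_fset (msupp v)) mkmalgU m (mcoeff m v *: phi).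

(* The projective tensor seminorm of q_{R,c} and p_{R',c'}, on the subspace
   E_R(G) (x) Sym(g), for R = r and R' = r' *)
Definition tensor_norm (r r' c c' : R) (P : polFun) : R :=
  inf [set y | exists (N : nat) (phi : 'I_N -> G -> C) (v : 'I_N -> symAlg R n),
    [/\ forall i, entire F r (phi i),
        P = \sum_(i < N) tens (phi i) (v i) &
        y = \sum_(i < N) fine (fun_norm F r c (phi i)) * sym_norm r' c' (v i)]].

(* The parameter r' only enters the topology. *)
Definition Pol (r r' : R) : Type :=
  {P : polFun | `[< forall m, entire F r (mcoeff m P) >]}.

HB.instance Definition _ r r' := Choice.on (Pol r r').

Definition Pol_subbase r r' : set (set (Pol r r')) :=
  [set B | exists (P0 : Pol r r') (c c' e : R),
    [/\ 0 <= c, 0 <= c', 0 < e &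
        B = [set P | tensor_norm r r' c c' (val P - val P0) < e]]].

HB.instance Definition _ r r' :=
  isSubBaseTopological.Build (Pol r r') (@Pol_subbase r r') id.

(* S = a P + Q *)
Definition lincomb r r' (a : C) (P Q S : Pol r r') : Prop :=
  forall m, mcoeff m (val S) = a *: mcoeff m (val P) + mcoeff m (val Q).

(* (phi (x) xi_1 \vee ... \vee xi_k) *_std (psi (x) eta) *)
Definition std_formula (hbar : C) (phi psi : G -> C) (k : nat)
    (xi : 'I_k -> 'rV[R]_n) (eta : symAlg R n) : polFun :=
  \sum_(p < k.+1) \sum_(s : 'S_k)
    let xis := [seq xi (s j) | j <- enum 'I_k] in
    tens
      (fun g => zpar hbar ^+ p / (p`!%:R * (k - p)`!%:R) *
                (phi g * lies F (take p xis) psi g))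
      (gutt F (zpar hbar) (\prod_(x <- drop p xis) symVec (cvec x)) eta).

(* star is the bilinear product given by the formula above on factorizing
   tensors. *)
Definition is_star_std (hbar : C) r r'
    (star : Pol r r' -> Pol r r' -> Pol r r') : Prop :=
  [/\ forall a P P' S Q, lincomb a P P' S ->
        lincomb a (star P Q) (star P' Q) (star S Q),
      forall a P Q Q' S, lincomb a Q Q' S ->
        lincomb a (star P Q) (star P Q') (star P S) &
      forall phi psi k (xi : 'I_k -> 'rV[R]_n) eta P Q,
        entire F r phi -> entire F r psi ->
        val P = tens phi (\prod_(j < k) symVec (cvec (xi j))) ->
        val Q = tens psi eta ->
        val (star P Q) = std_formula hbar phi psi xi eta].

End Pol.

Section Completion.
Context {R : realType}.
Let C := cplx R.

Definition tvs_cauchy (H : topologicalLmodType C) (A : set_system H) : Prop :=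
  forall U : set H, nbhs 0 U ->
    exists2 B, A B & forall x y, B x -> B y -> U (x - y).

Definition tvs_complete (H : topologicalLmodType C) : Prop :=
  forall A : set_system H, ProperFilter A -> tvs_cauchy A ->
    exists x : H, A --> x.

Context {n : nat} {G : lieGroup R n} (F : frame G) (r r' : R).

(* iota is the canonical map into a Hausdorff completion: H is a complete
   Hausdorff topological vector space, and iota is linear with dense range and
   induces the topology of Pol. *)
Definition is_completion (H : topologicalLmodType C) (iota : Pol F r r' -> H) :
    Prop :=
  [/\ hausdorff_space H, tvs_complete H,
      forall a P Q S, lincomb a P Q S -> iota S = a *: iota P + iota Q,
      dense (range iota) &
      forall P (A : set (Pol F r r')),
        nbhs P A <-> exists2 U, nbhs (iota P) U & iota @^-1` U `<=` A].

Definition continuous_extension (H : topologicalType) (iota : Pol F r r' -> H)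
    (f : Pol F r r' -> R) (fhat : H -> R) : Prop :=
  continuous fhat /\ forall P, fhat (iota P) = f P.

Definition is_bilinear (H : lmodType C) (f : H -> H -> H) : Prop :=
  (forall a x y z, f (a *: x + y) z = a *: f x z + f y z) /\
  (forall a x y z, f z (a *: x + y) = a *: f z x + f z y).

End Completion.

(* Main.v *)
(* Write z = hbar / i. Reordering a word of U(g) costs one commutator z [x, y] per
   transposition, so the symmetrized representative of a product with a word of
   length k is bounded, for every weight W on degrees with
   2 |z| K k W(k) <= W(k+1) (K a bound on the structure constants), by
   2^k times the norm with weight W(_ + k). The weights k!^r' lambda^k with
   r' >= 1 and lambda >= 2 |z| K are of this kind, which bounds the Gutt star
   product. That the representative is unique (the injectivity part of
   Poincare-Birkhoff-Witt) is seen by letting T(g) act on analytic germs by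
   left-invariant differential operators: the action kills the ideal, and
   symmetrized words are separated by monomials in coordinates at the unit.
   For functions, the Leibniz rule gives
   q_c(phi psi) <= q_(2^r c)(phi) q_(2^r c)(psi), and p derivatives cost
   p! mu^-p and a dilation of c by 2 mu; with mu = 2 |z| + 1 the sum over p of
   (|z| / mu)^p is at most 2, the constant of the theorem. The bound on
   factorizing tensors passes to the projective seminorms, and the product
   extends to the completion as the limit of P * Q for P -> x and Q -> y. *)

From HB Require Import structures.
Require Import Defs.
From mathcomp Require Import all_boot all_order all_algebra.
From mathcomp Require Import all_classical all_reals all_analysis.
From mathcomp Require Import perm finmap complex.
From mathcomp Require Import -(notations) monalg.
From mathcomp Require Import ring lra zify.

Set Implicit Arguments.
Unset Strict Implicit.
Unset Printing Implicit Defensive.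

Import Order.TTheory GRing.Theory Num.Theory.
Import numFieldNormedType.Exports.
Local Open Scope classical_set_scope.
Local Open Scope ring_scope.

(** * Power series *)

(** The projective seminorms are infima over decompositions, but on symmetric tensors the projective
    power of the l^1-norm is the l^1-norm of the monomial coefficients: the phases of the
    coefficients give a norm-one functional attaining it. So p_{R',c} is a weighted l^1-norm on
    monomials, and the projective seminorm of P dominates the corresponding sum over the monomials
    of P. The star product can therefore be defined and estimated on monomials without loss in the
    constant. In the Gutt estimate, a symmetrized word is the mean over all positions of one
    inserted letter, and any fixed position differs from this mean by commutator terms with fewer
    letters; hence the induction. In the sum over permutations, the p! paid for p derivatives
    cancels the 1/p! of the formula, and the remaining k!/(k-p)! is absorbed by r' >= 1. Analyticity
    is carried by explicit norm bounds on power series. Derivatives are obtained as Hadamard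
    quotients, which keep the radius of convergence, so that no series is differentiated term by
    term. *)

Section RealSeries.
Context {R : realType}.
Implicit Types u : nat -> nat -> R.

Lemma cvgn_norm_le (u : nat -> R) (l c e : R) (N : nat) :
  u @ \oo --> l -> (forall n, (N <= n)%N -> `|u n - c| <= e) -> `|l - c| <= e.
Proof.
move=> ul H.
have ul' : (fun n => `|u n - c|) @ \oo --> `|l - c|.
  by apply: cvg_norm; apply: cvgB => //; exact: cvg_cst.
rewrite -(cvg_lim (@Rhausdorff R) ul'); apply: limr_le.
  by apply/cvg_ex; exists (`|l - c|).
by exists N.
Qed.

(** The difference of two nested rectangular sums is a sum over the L-shaped region between them,
    where the triangle inequality applies termwise. *)
Lemma sum_rect_le u I0 I K0 K : (I0 <= I)%N -> (K0 <= K)%N ->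
  `|\sum_(0 <= i < I) \sum_(0 <= k < K) u i k -
    \sum_(0 <= i < I0) \sum_(0 <= k < K0) u i k| <=
  \sum_(0 <= i < I) \sum_(0 <= k < K) `|u i k| -
  \sum_(0 <= i < I0) \sum_(0 <= k < K0) `|u i k|.
Proof.
move=> hI hK.
have split v : \sum_(0 <= i < I) \sum_(0 <= k < K) v i k -
    \sum_(0 <= i < I0) \sum_(0 <= k < K0) v i k =
   \sum_(0 <= i < I0) \sum_(K0 <= k < K) v i k +
    \sum_(I0 <= i < I) \sum_(0 <= k < K) v i k :> R.
  rewrite (@big_cat_nat _ _ _ I0 0%N I) //=.
  rewrite addrAC; congr (_ + _); rewrite -sumrB; apply: eq_bigr => i _.
  by rewrite (@big_cat_nat _ _ _ K0 0%N K) //= addrAC subrr add0r.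
rewrite !split (le_trans (ler_normD _ _)) // lerD // (le_trans (ler_norm_sum _ _ _)) //;
  by apply: ler_sum => i _; exact: ler_norm_sum.
Qed.

Lemma cvgn_ext (u v : nat -> R) (l : R) : u =1 v -> u @ \oo --> l -> v @ \oo --> l.
Proof. by move=> /funext ->. Qed.

Lemma cvg_fsum (I T : Type) (F : set_system I) {FF : Filter F} (s : seq T) (v : T -> I -> R)
    (l : T -> R) :
  (forall j, v j @ F --> l j) ->
  (fun n => \sum_(j <- s) v j n) @ F --> \sum_(j <- s) l j.
Proof.
move=> hv; elim: s => [|j s IH].
  under eq_fun do rewrite big_nil.
  by rewrite big_nil; exact: cvg_cst.
under eq_fun do rewrite big_cons.
by rewrite big_cons; apply: cvgD.
Qed.

(** Some rectangle exhausts the supremum of the absolute sums up to e/2. Every larger rectangular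
    sum then stays within e/2 of the sum over that rectangle, and this passes to the limit in either
    order of summation. *)
Lemma double_series u (M : R) (s t : nat -> R) (S : R) :
  (forall I K, \sum_(0 <= i < I) \sum_(0 <= k < K) `|u i k| <= M) ->
  (forall i, (fun K => \sum_(0 <= k < K) u i k) @ \oo --> s i) ->
  (fun I => \sum_(0 <= i < I) s i) @ \oo --> S ->
  (forall k, (fun I => \sum_(0 <= i < I) u i k) @ \oo --> t k) ->
  (fun K => \sum_(0 <= k < K) t k) @ \oo --> S.
Proof.
move=> bnd hs hS ht.
pose A I K := \sum_(0 <= i < I) \sum_(0 <= k < K) `|u i k|.
pose E := [set A p.1 p.2 | p in [set: nat * nat]].
have supE : has_sup E.
  split; first by exists (A 0 0)%N; exists (0, 0)%N.
  by exists M => _ [p _ <-]; exact: bnd.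
apply/cvgrPdist_le => e e0.
have e20 : 0 < e / 2 by rewrite divr_gt0.
have [_ [[I0 K0] _ <-] /= hA] := sup_adherent e20 supE.
have near_rect I K : (I0 <= I)%N -> (K0 <= K)%N ->
    `|\sum_(0 <= i < I) \sum_(0 <= k < K) u i k -
      \sum_(0 <= i < I0) \sum_(0 <= k < K0) u i k| <= e / 2.
  move=> hI hK; apply: le_trans (sum_rect_le u hI hK) _.
  have : A I K <= sup E by apply: ub_le_sup; [case: supE|exists (I, K)].
  rewrite /A in hA *; lra.
set c := \sum_(0 <= i < I0) \sum_(0 <= k < K0) u i k in near_rect.
have hSc : `|S - c| <= e / 2.
  apply: (cvgn_norm_le (N := I0) hS) => I hI.
  have hsI : (fun K => \sum_(0 <= i < I) \sum_(0 <= k < K) u i k) @ \oo -->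
      \sum_(0 <= i < I) s i by apply: cvg_fsum; exact: hs.
  apply: (cvgn_norm_le (N := K0) hsI).
  by move=> K hK; exact: near_rect.
near=> K; have hK : (K0 <= K)%N by near: K; exists K0.
have : `|\sum_(0 <= k < K) t k - c| <= e / 2.
  have htK : (fun I => \sum_(0 <= k < K) \sum_(0 <= i < I) u i k) @ \oo -->
      \sum_(0 <= k < K) t k by apply: cvg_fsum; exact: ht.
  apply: (cvgn_norm_le (N := I0) htK).
  by move=> I hI; rewrite exchange_big; exact: near_rect.
move: hSc; rewrite !ler_norml; lra.
Unshelve. all: by end_near. Qed.

Lemma abs_cvg_series (u : nat -> R) (M : R) :
  (forall N, \sum_(0 <= k < N) `|u k| <= M) -> cvgn (fun N => \sum_(0 <= k < N) u k).
Proof.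
move=> bnd; apply: (@normed_cvg R R^o).
apply: nondecreasing_is_cvgn.
  by apply/nondecreasing_seqP => n; rewrite [leRHS]seriesSr lerDl normr_ge0.
by exists M => _ [n _ <-]; exact: bnd.
Qed.

End RealSeries.

Section PowerSeries.
Context {R : realType} {m : nat}.
Implicit Types (a : seq 'I_m -> R) (h : 'rV[R]_m) (f : 'rV[R]_m -> R).

Definition wmon h (s : seq 'I_m) : R := \prod_(i <- s) h 0 i.

Definition hpart a h (k : nat) : R := \sum_(w : k.-tuple 'I_m) a w * wmon h w.

Definition hnorm a (k : nat) : R := \sum_(w : k.-tuple 'I_m) `|a w|.

(** A bound by [M] in the Banach algebra of power series that converge absolutely at radius [rho].
    Bounding partial sums by an explicit number keeps the later estimates finite. *)
Definition wseries f (rho M : R) : Prop := exists a,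
  (forall N, \sum_(0 <= k < N) rho ^+ k * hnorm a k <= M) /\
  forall h, `|h| < rho -> (fun N => \sum_(0 <= k < N) hpart a h k) @ \oo --> f h.

Lemma sum_tuple_cons (V : nmodType) k (F : k.+1.-tuple 'I_m -> V) :
  \sum_w F w = \sum_(i < m) \sum_(w : k.-tuple 'I_m) F [tuple of i :: w].
Proof.
rewrite pair_big /= (reindex (fun p : 'I_m * k.-tuple 'I_m => [tuple of p.1 :: p.2])).
  by apply: eq_bigr.
exists (fun w : k.+1.-tuple 'I_m => (thead w, [tuple of behead w])).
  by move=> [i w] _ /=; rewrite theadE; congr (_, _); apply: val_inj.
by move=> w _; rewrite /= [RHS]tuple_eta.
Qed.

Lemma sum_tuple0 (V : nmodType) (F : 0.-tuple 'I_m -> V) :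
  \sum_w F w = F [tuple].
Proof.
rewrite (bigD1 [tuple]) //= big1 ?addr0 // => w /negP[]; apply/eqP; exact: tuple0.
Qed.

Lemma mx_norm_coord h i : `|h 0 i| <= `|h|.
Proof.
rewrite [leRHS]/Num.Def.normr /= mx_normrE.
exact: (le_bigmax _ (fun ij : 'I_1 * 'I_m => `|h ij.1 ij.2|) (0, i)).
Qed.

Lemma mx_norm_lt h e : 0 < e -> (forall i, `|h 0 i| < e) -> `|h| < e.
Proof.
move=> e0 he; rewrite [ltLHS]/Num.Def.normr /= mx_normrE.
by apply: bigmax_lt => // -[i j] _ /=; rewrite ord1.
Qed.

Lemma wmon_norm rho h s : `|h| <= rho -> `|wmon h s| <= rho ^+ size s.
Proof.
move=> hr; rewrite /wmon normr_prod; elim: s => [|i s IH]; first by rewrite big_nil expr0.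
rewrite big_cons exprS ler_pM //; first exact: prodr_ge0.
exact: le_trans (mx_norm_coord _ _) hr.
Qed.

Lemma hnorm_ge0 a k : 0 <= hnorm a k.
Proof. exact: sumr_ge0. Qed.

Lemma hpart_norm a rho h k : `|h| <= rho -> `|hpart a h k| <= rho ^+ k * hnorm a k.
Proof.
move=> hr; rewrite /hpart /hnorm mulr_sumr (le_trans (ler_norm_sum _ _ _)) //.
apply: ler_sum => w _; rewrite normrM mulrC ler_wpM2r //.
by rewrite (le_trans (wmon_norm _ hr)) // size_tuple.
Qed.

Lemma wseries_ext f g rho M : (forall h, `|h| < rho -> f h = g h) ->
  wseries f rho M -> wseries g rho M.
Proof. by move=> fg [a [ha hf]]; exists a; split=> // h hh; rewrite -fg //; exact: hf. Qed.

Lemma wseries_le f rho rho' M M' : 0 <= rho' -> rho' <= rho -> M <= M' ->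
  wseries f rho M -> wseries f rho' M'.
Proof.
move=> r0 rr MM [a [ha hf]]; exists a; split; last first.
  by move=> h hh; apply: hf; apply: lt_le_trans hh rr.
move=> N; apply: le_trans MM; apply: le_trans (ha N); apply: ler_sum => k _.
by rewrite ler_wpM2r ?hnorm_ge0 // lerXn2r // nnegrE (le_trans r0).
Qed.

Lemma wseries_norm_le f rho M h : `|h| < rho -> wseries f rho M -> `|f h| <= M.
Proof.
move=> hh [a [ha hf]]; rewrite -(subr0 (f h)).
apply: (cvgn_norm_le (N := 0) (hf _ hh)) => N _; rewrite subr0.
apply: le_trans (ha N); apply: le_trans (ler_norm_sum _ _ _) _.
by apply: ler_sum => k _; apply: hpart_norm; exact: ltW.
Qed.

Lemma wseries_ge0 f rho M : wseries f rho M -> 0 <= M.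
Proof. by case=> a [/(_ 0%N)]; rewrite big_nil. Qed.

(* the term of degree k is divided by t^k, which is at most t when f 0 = 0 *)
Lemma wseries_shrink f rho M t : 0 <= t <= 1 -> 0 <= rho -> f 0 = 0 ->
  wseries f rho M -> wseries f (t * rho) (t * M).
Proof.
move=> /andP[t0 t1] r0 f0 [a [ha hf]].
case: (ltgtP rho 0) => [/(le_lt_trans r0)|rho0|rho0]; first by rewrite ltxx.
2: { exists (fun=> 0); split=> [N|h].
  rewrite big1 ?mulr_ge0 //; last by move=> k _; rewrite /hnorm big1 ?mulr0 // => *; rewrite normr0.
    by have := ha 0%N; rewrite big_nil.
  by rewrite rho0 mulr0 normr_lt0. }
have tr : t * rho <= rho by rewrite ler_piMl.
have nil0 : a [::] = 0.
  have := hf 0; rewrite normr0 f0 => /(_ rho0) c0.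
  have : (fun N => \sum_(0 <= k < N) hpart a 0 k) @ \oo --> a [::].
    apply: cvg_near_cst; exists 1%N => // -[//|N] _ /=.
    rewrite big_nat_recl // big1 ?addr0.
      by rewrite /hpart sum_tuple0 /wmon big_nil mulr1.
    by move=> k _; rewrite /hpart big1 // => w _; case: (tupleP w) => i w' /=;
      rewrite /wmon big_cons mxE mul0r mulr0.
  by move=> /(cvg_unique (@Rhausdorff R)) /(_ c0).
exists a; split; last by move=> h hh; apply: hf; apply: lt_le_trans hh tr.
move=> N; apply: le_trans (ler_wpM2l t0 (ha N)); rewrite mulr_sumr.
apply: ler_sum => -[|k] _.
  by rewrite /hnorm sum_tuple0 nil0 normr0 !mulr0.
rewrite mulrA ler_wpM2r ?hnorm_ge0 // exprMn ler_wpM2r ?exprn_ge0 //.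
by rewrite exprS ler_piMr // exprn_ile1.
Qed.

Lemma wseries_wmon s rho : 0 <= rho -> wseries (fun h => wmon h s) rho (rho ^+ size s).
Proof.
move=> r0; pose a (w : seq 'I_m) : R := (w == s)%:R.
have other k (F : R -> R -> R) h : (forall x, F 0 x = 0) -> k != size s ->
   \sum_(w : k.-tuple 'I_m) F (a w) (wmon h w) = 0.
  move=> F0 ks; rewrite big1 // => w _; rewrite /a; case: eqP => //= ws.
  by move: ks; rewrite -ws size_tuple eqxx.
have same (F : R -> R -> R) h : (forall x, F 0 x = 0) ->
   \sum_(w : (size s).-tuple 'I_m) F (a w) (wmon h w) = F 1 (wmon h s).
  move=> F0; rewrite (bigD1 (in_tuple s)) //= big1 ?addr0 /a ?eqxx // => w ws.
  by rewrite (_ : (val w == s) = false) //; apply: contraNF ws => ws; rewrite -val_eqE.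
have sumE (u : nat -> R) N : (forall k, k != size s -> u k = 0) ->
   \sum_(0 <= k < N) u k = if (size s < N)%N then u (size s) else 0.
  move=> u0; rewrite big_mkord; case: ltnP => hN.
    rewrite (bigD1 (Ordinal hN)) //= big1 ?addr0 // => i; rewrite -val_eqE => /u0 //.
  by rewrite big1 // => i _; apply: u0; rewrite neq_ltn (leq_trans (ltn_ord i) hN).
exists a; split=> [N|h hh].
  rewrite sumE; last first.
    by move=> k ks; rewrite /hnorm (other k (fun x _ => `|x|) 0) ?mulr0 ?normr0.
  by case: ifP => _; rewrite ?exprn_ge0 // /hnorm (same (fun x _ => `|x|) 0) ?normr0 // normr1 mulr1.
apply: cvg_near_cst; exists (size s).+1 => // N /= sN; rewrite sumE.
  by rewrite sN /hpart (same (fun x y => x * y)) ?mul1r // => x; rewrite mul0r.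
by move=> k ks; rewrite /hpart (other k (fun x y => x * y)) // => x; rewrite mul0r.
Qed.

Lemma wseries_scale c f rho M : wseries f rho M ->
  wseries (fun h => c * f h) rho (`|c| * M).
Proof.
move=> [a [ha hf]]; exists (fun w => c * a w); split=> [N|h hh].
  apply: le_trans (ler_wpM2l (normr_ge0 c) (ha N)); rewrite mulr_sumr.
  apply: ler_sum => k _; rewrite mulrCA le_eqVlt; apply/orP; left; apply/eqP.
  by congr (_ * _); rewrite /hnorm mulr_sumr; apply: eq_bigr => w _; rewrite normrM.
rewrite (_ : (fun N => _) = fun N => c * \sum_(0 <= k < N) hpart a h k).
  exact: (cvgM (cvg_cst c) (hf h hh)).
apply/funext => N; rewrite mulr_sumr; apply: eq_bigr => k _.
by rewrite /hpart mulr_sumr; apply: eq_bigr => w _; rewrite mulrA.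
Qed.



(** Completeness of this algebra: coefficients are added word by word, and [double_series]
    interchanges the sum over functions with the sum over degrees. Sums, products, compositions and
    Hadamard quotients all rest on it. *)
Lemma wseries_sum (f_ : nat -> 'rV[R]_m -> R) (N_ : nat -> R) f rho M : 0 < rho ->
  (forall i, wseries (f_ i) rho (N_ i)) ->
  (forall I, \sum_(0 <= i < I) N_ i <= M) ->
  (forall h, `|h| < rho -> (fun I => \sum_(0 <= i < I) f_ i h) @ \oo --> f h) ->
  wseries f rho M.
Proof.
move=> r0 /choice [a_ ha] hN hf.
have aN i k : rho ^+ k * hnorm (a_ i) k <= N_ i.
  apply: le_trans (proj1 (ha i) k.+1); rewrite big_nat_recr //= lerDr sumr_ge0 // => j _.
  by rewrite mulr_ge0 ?hnorm_ge0 // exprn_ge0 // ltW.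
(* The coefficient of [w] in the i-th series is at most rho^-|w| times [N_ i], which is summable. *)
have acvg w : cvgn (fun I => \sum_(0 <= i < I) a_ i w).
  apply: (@abs_cvg_series _ _ ((rho ^+ size w)^-1 * M)) => I.
  rewrite -ler_pdivrMl ?invr_gt0 ?exprn_gt0 // invrK; apply: le_trans (hN I).
  rewrite mulr_sumr; apply: ler_sum => i _; apply: le_trans (aN i (size w)).
  rewrite ler_wpM2l ?exprn_ge0 ?(ltW r0) // /hnorm (bigD1 (in_tuple w)) //= lerDl.
  exact: sumr_ge0.
pose a w := limn (fun I => \sum_(0 <= i < I) a_ i w).
have part_le I K : \sum_(0 <= i < I) \sum_(0 <= k < K) rho ^+ k * hnorm (a_ i) k <= M.
  by apply: le_trans (hN I); apply: ler_sum => i _; exact: (proj1 (ha i)).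
exists a; split.
  move=> K; have : (fun I => \sum_(k < K) rho ^+ k *
      \sum_(w : k.-tuple 'I_m) `|\sum_(0 <= i < I) a_ i w|) @ \oo -->
      \sum_(k < K) rho ^+ k * hnorm a k.
    apply: cvg_fsum => k; apply: cvgMl_tmp; apply: cvg_fsum => w.
    by apply: cvg_norm; exact: acvg.
  move=> c; rewrite big_mkord -(cvg_lim (@Rhausdorff R) c); apply: limr_le.
    by apply/cvg_ex; eexists; exact: c.
  exists 0%N => // I _; apply: le_trans (part_le I K); rewrite exchange_big big_mkord.
  apply: ler_sum => k _; rewrite -mulr_sumr ler_wpM2l ?exprn_ge0 ?(ltW r0) //.
  rewrite /hnorm exchange_big; apply: ler_sum => w _; exact: ler_norm_sum.
move=> h hh; apply: (@double_series _ (fun i k => hpart (a_ i) h k) M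
   (fun i => f_ i h)).
- move=> I K; apply: le_trans (part_le I K); apply: ler_sum => i _; apply: ler_sum => k _.
  exact/hpart_norm/ltW.
- by move=> i; exact: (proj2 (ha i)).
- exact: hf.
- move=> k.
  rewrite (_ : (fun I => _) = fun I =>
     \sum_(w : k.-tuple 'I_m) (\sum_(0 <= i < I) a_ i w) * wmon h w).
    by apply: cvg_fsum => w; apply: cvgMr_tmp; exact: acvg.
  apply/funext => I; rewrite exchange_big; apply: eq_bigr => w _.
  by rewrite mulr_suml.
Qed.

Lemma wseries0 rho : wseries (fun=> 0) rho 0.
Proof.
exists (fun=> 0); split=> [N|h _].
  by rewrite big1 // => k _; rewrite /hnorm big1 ?mulr0 // => *; rewrite normr0.
apply: cvg_near_cst; exists 0%N => // N _ /=.
by rewrite big1 // => k _; rewrite /hpart big1 // => *; rewrite mul0r.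
Qed.

Lemma wseriesD f g rho M N : 0 < rho -> wseries f rho M -> wseries g rho N ->
  wseries (fun h => f h + g h) rho (M + N).
Proof.
move=> r0 hf hg.
pose f_ i := if i is 0 then f else if i is 1 then g else fun=> 0.
pose N_ i := if i is 0 then M else if i is 1 then N else 0.
have big2 (u : nat -> R) I : (forall i, u i.+2 = 0) ->
    \sum_(0 <= i < I.+2) u i = u 0 + u 1.
  by move=> u0; rewrite !big_nat_recl // big1 ?addr0.
have M0 := wseries_ge0 hf; have N0 := wseries_ge0 hg.
apply: (@wseries_sum f_ N_) => //.
- by case=> [|[|i]] //; exact: wseries0.
- case=> [|[|I]]; rewrite ?big2 ?big_nat1 ?big_nil // /=; lra.
- move=> h hh; apply: cvg_near_cst; exists 2%N => // -[|[|I]] //= _.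
  by rewrite big2.
Qed.

Lemma wseries_fsum (T : Type) (s : seq T) (f_ : T -> 'rV[R]_m -> R) (N_ : T -> R) rho :
  0 < rho -> (forall i, wseries (f_ i) rho (N_ i)) ->
  wseries (fun h => \sum_(i <- s) f_ i h) rho (\sum_(i <- s) N_ i).
Proof.
move=> r0 hf; elim: s => [|i s IH].
  rewrite big_nil; apply: wseries_ext (wseries0 _) => h _; by rewrite big_nil.
rewrite big_cons; apply: wseries_ext (wseriesD r0 (hf i) IH) => h _.
by rewrite big_cons.
Qed.

Lemma wseries_cst c rho : 0 < rho -> wseries (fun=> c) rho `|c|.
Proof.
move=> r0; have := wseries_scale c (wseries_wmon [::] (ltW r0)).
rewrite expr0 mulr1; apply: wseries_ext => h _; by rewrite /wmon big_nil mulr1.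
Qed.

Lemma wseries_coord i rho : 0 < rho -> wseries (fun h => h 0 i) rho rho.
Proof.
move=> r0; have := wseries_wmon [:: i] (ltW r0); rewrite expr1.
by apply: wseries_ext => h _; rewrite /wmon big_seq1.
Qed.

Lemma wseries_mul_coord i f rho M : 0 < rho -> wseries f rho M ->
  wseries (fun h => h 0 i * f h) rho (rho * M).
Proof.
move=> r0 [a [ha hf]].
(* Multiplication by the coordinate [i] prepends the letter [i] to every word. *)
pose b (w : seq 'I_m) : R := if w is j :: w' then (j == i)%:R * a w' else 0.
have hb0 (h : 'rV[R]_m) : hpart b h 0 = 0 by rewrite /hpart sum_tuple0 /b mul0r.
have hbS h k : hpart b h k.+1 = h 0 i * hpart a h k.
  rewrite /hpart sum_tuple_cons (bigD1 i) //= [X in _ + X]big1 ?addr0.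
    rewrite mulr_sumr; apply: eq_bigr => w _.
    by rewrite /b /= eqxx mul1r /wmon big_cons mulrCA.
  by move=> j /negPf ji; rewrite big1 // => w _; rewrite /b /= ji !mul0r.
have nb0 : hnorm b 0 = 0 by rewrite /hnorm sum_tuple0 /b normr0.
have nbS k : hnorm b k.+1 = hnorm a k.
  rewrite /hnorm sum_tuple_cons (bigD1 i) //= [X in _ + X]big1 ?addr0.
    by apply: eq_bigr => w _; rewrite /b /= eqxx mul1r.
  by move=> j /negPf ji; rewrite big1 // => w _; rewrite /b /= ji mul0r normr0.
exists b; split=> [[|N]|h hh].
- by have := ha 0%N; rewrite !big_nil => M0; rewrite mulr_ge0 // ltW.
- rewrite big_nat_recl // nb0 mulr0 add0r.
  apply: le_trans (ler_wpM2l (ltW r0) (ha N)); rewrite mulr_sumr.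
  by apply: ler_sum => k _; rewrite nbS exprS mulrA.
- rewrite -cvg_shiftS /=.
  rewrite (_ : (fun N => _) = fun N => h 0 i * \sum_(0 <= k < N) hpart a h k).
    by apply: cvgMl_tmp; exact: hf.
  apply/funext => N; rewrite big_nat_recl // hb0 add0r mulr_sumr.
  by apply: eq_bigr => k _; rewrite hbS.
Qed.

Lemma wseries_mul_wmon s f rho M : 0 < rho -> wseries f rho M ->
  wseries (fun h => wmon h s * f h) rho (rho ^+ size s * M).
Proof.
move=> r0 hf; elim: s => [|i s IH].
  by rewrite expr0 mul1r; apply: wseries_ext hf => h _; rewrite /wmon big_nil mul1r.
rewrite exprS -mulrA; apply: wseries_ext (wseries_mul_coord i r0 IH) => h _.
by rewrite mulrA /wmon big_cons.
Qed.

(** Only [f] is expanded: each of its words multiplies the whole of [g], and [wseries_sum] collects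
    the results, so no Cauchy product of coefficients is formed. *)
Lemma wseriesM f g rho M N : 0 < rho -> wseries f rho M -> wseries g rho N ->
  wseries (fun h => f h * g h) rho (M * N).
Proof.
move=> r0 [a [ha hf]] hg; have N0 := wseries_ge0 hg.
apply: (@wseries_sum (fun k h => hpart a h k * g h)
   (fun k => rho ^+ k * hnorm a k * N)) => //.
- move=> k; have : wseries (fun h => \sum_(w : k.-tuple 'I_m) a w * (wmon h w * g h)) rho
     (\sum_(w : k.-tuple 'I_m) `|a w| * (rho ^+ size w * N)).
    by apply: wseries_fsum => // w; apply: wseries_scale; exact: wseries_mul_wmon.
  rewrite (_ : \sum_(w : k.-tuple _) _ = rho ^+ k * hnorm a k * N).
    by apply: wseries_ext => h _; rewrite mulr_suml; apply: eq_bigr => w _; rewrite mulrA.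
  rewrite mulrAC /hnorm mulr_sumr; apply: eq_bigr => w _.
  by rewrite size_tuple mulrC.
- by move=> I; rewrite -mulr_suml ler_wpM2r.
- move=> h hh; rewrite (_ : (fun I => _) = fun I => (\sum_(0 <= k < I) hpart a h k) * g h).
    by apply: cvgMr_tmp; exact: hf.
  by apply/funext => I; rewrite mulr_suml.
Qed.

End PowerSeries.

Section Analytic.
Context {R : realType}.

(** Substituting [g] into a word of length k gives norm at most sigma'^k, so the bound [M] of [f] at
    radius sigma survives. The strict inequality sigma' < sigma keeps the values of [g] in the open
    ball where [f] is the sum of its series. *)
Lemma wseries_comp m p (f : 'rV[R]_p -> R) (g : 'I_p -> 'rV[R]_m -> R)
    (rho sigma sigma' M : R) :
  0 < rho -> 0 <= sigma' < sigma -> wseries f sigma M ->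
  (forall j, wseries (g j) rho sigma') ->
  wseries (fun h => f (\row_j g j h)) rho M.
Proof.
move=> r0 /andP[s0 ss] [a [ha hf]] hg.
have wg s : wseries (fun h => wmon (\row_j g j h) s) rho (sigma' ^+ size s).
  elim: s => [|i s IH].
    rewrite expr0 -(normr1 R); apply: wseries_ext (wseries_cst 1 r0) => h _.
    by rewrite /wmon big_nil.
  rewrite exprS; apply: wseries_ext (wseriesM r0 (hg i) IH) => h _.
  by rewrite /wmon big_cons mxE.
apply: (@wseries_sum _ _ (fun k h => hpart a (\row_j g j h) k)
   (fun k => sigma' ^+ k * hnorm a k)) => //.
- move=> k; rewrite /hnorm mulr_sumr.
  rewrite (eq_bigr (fun w : k.-tuple 'I_p => `|a w| * sigma' ^+ size w)); last first.
    by move=> w _; rewrite size_tuple mulrC.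
  by apply: wseries_fsum => // w; apply: wseries_scale.
- move=> K; apply: le_trans (ha K); apply: ler_sum => k _.
  rewrite ler_wpM2r ?hnorm_ge0 // lerXn2r // ?nnegrE // ?(ltW ss) //.
  by rewrite (le_trans s0) // ltW.
- move=> h hh; apply: hf; apply: mx_norm_lt; first exact: le_lt_trans ss.
  by move=> i; rewrite mxE (le_lt_trans (wseries_norm_le hh (hg i))).
Qed.

Lemma common_radius (T : finType) (P : T -> R -> R -> Prop) :
  (forall t (r r' M M' : R), 0 < r' -> r' <= r -> M <= M' -> P t r M -> P t r' M') ->
  (forall t, exists r M, 0 < r /\ P t r M) ->
  exists r M, 0 < r /\ forall t, P t r M.
Proof.
move=> mono H.
suff : forall s : seq T, exists r M, 0 < r /\ forall t, t \in s -> P t r M.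
  by move=> /(_ (enum T)) [r [M [r0 h]]]; exists r, M; split=> // t; apply: h; rewrite mem_enum.
elim=> [|t s [r [M [r0 h]]]]; first by exists 1, 0.
have [r' [M' [r'0 h']]] := H t.
exists (Num.min r r'), (Num.max M M'); split; first by rewrite lt_min r0.
move=> u; rewrite inE => /orP[/eqP ->|/h hu].
  by apply: mono h'; rewrite ?lt_min ?r0 // ?ge_min ?le_max ?lexx ?orbT.
by apply: mono hu; rewrite ?lt_min ?r0 // ?ge_min ?le_max ?lexx ?orbT.
Qed.

(** Translates coefficients indexed by a degree and a tuple into coefficients on sequences, and a
    finite extended sum into a bound on partial sums. *)
Lemma analytic_atP m (f : 'rV[R]_m -> R) x :
  analytic_at f x <-> exists rho M, 0 < rho /\ wseries (fun h => f (x + h)) rho M.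
Proof.
split=> [[a [rho [r0 fin hf]]]|[rho [M [r0 [a [ha hf]]]]]].
  pose b (s : seq 'I_m) := a (size s) (in_tuple s).
  have bE k (w : k.-tuple 'I_m) : b w = a k w.
    case: w => s sk; rewrite /b /=; have sk' := eqP sk; subst k.
    by congr (a _ _); apply: val_inj.
  have nE k : hnorm b k = \sum_(w : k.-tuple 'I_m) `|a k w|.
    by apply: eq_bigr => w _; rewrite bE.
  pose S := (\sum_(0 <= k <oo) (rho ^+ k * hnorm b k)%:E)%E.
  have SE : S = (\sum_(0 <= k <oo) (rho ^+ k * \sum_(w : k.-tuple 'I_m) `|a k w|)%:E)%E.
    by apply: eq_eseriesr => k _; rewrite nE.
  have u0 k : (0 <= (rho ^+ k * hnorm b k)%:E)%E.
    by rewrite lee_fin mulr_ge0 ?hnorm_ge0 // exprn_ge0 // ltW.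
  have Sfin : S \is a fin_num.
    by rewrite ge0_fin_numE ?SE // -SE; apply: nneseries_ge0.
  exists rho, (fine S); split=> //; exists b; split=> [N|h hh].
    rewrite -lee_fin fineK // -sumEFin; exact: nneseries_lim_ge.
  apply: cvgn_ext (hf h hh) => N; apply: eq_bigr => k _.
  apply: eq_bigr => w _; rewrite bE; congr (_ * _).
  by rewrite /wmon big_tuple.
exists (fun k (w : k.-tuple 'I_m) => a w), rho; split=> //.
  apply: (@le_lt_trans _ _ M%:E); last exact: ltry.
  apply: lime_le.
    apply: is_cvg_nneseries => k _ _.
    by rewrite lee_fin mulr_ge0 ?hnorm_ge0 ?sumr_ge0 // exprn_ge0 // ltW.
  by exists 0%N => // N _; rewrite sumEFin lee_fin; exact: ha.
move=> h hh; apply: cvgn_ext (hf h hh) => N.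
apply: eq_bigr => k _; apply: eq_bigr => w _; congr (_ * _).
by rewrite /wmon big_tuple.
Qed.

Lemma near_ball_mx m (P : 'rV[R]_m -> Prop) (x : 'rV[R]_m) :
  (\forall y \near x, P y) <-> exists2 r : R, 0 < r & forall h : 'rV[R]_m, `|h| < r -> P (x + h).
Proof.
split=> [/nbhs_ballP [r /= r0 H]|[r r0 H]].
  exists r => // h hh; apply: H; rewrite -ball_normE /= opprD addrA subrr add0r normrN //.
apply/nbhs_ballP; exists r => //= y; rewrite -ball_normE /= => yx.
by rewrite -(subrK x y) addrC; apply: H; rewrite distrC.
Qed.

Lemma analytic_at_ext m (f g : 'rV[R]_m -> R) (x : 'rV[R]_m) :
  (\forall y \near x, f y = g y) -> analytic_at f x -> analytic_at g x.
Proof.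
move=> /near_ball_mx [r r0 fg] /analytic_atP [rho [M [rho0 hf]]].
apply/analytic_atP; exists (Num.min r rho), M; split; first by rewrite lt_min r0.
apply: wseries_ext (wseries_le _ _ (lexx M) hf).
- by move=> h; rewrite lt_min => /andP[hr _]; exact: fg.
- by rewrite le_min !ltW.
- by rewrite ge_min lexx orbT.
Qed.

Lemma analytic_at_eq m (f g : 'rV[R]_m -> R) x : f =1 g -> analytic_at f x -> analytic_at g x.
Proof. by move=> /funext ->. Qed.

Lemma analytic_at_cst m (c : R) (x : 'rV[R]_m) : analytic_at (fun=> c) x.
Proof. by apply/analytic_atP; exists 1, `|c|; split => //; exact: wseries_cst. Qed.

Lemma analytic_at2 m (f g k : 'rV[R]_m -> R) x (op : R -> R -> R) :
  (forall y, k y = op (f y) (g y)) ->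
  (forall (f' g' : 'rV[R]_m -> R) rho M N, 0 < rho -> wseries f' rho M -> wseries g' rho N ->
     exists K, wseries (fun h => op (f' h) (g' h)) rho K) ->
  analytic_at f x -> analytic_at g x -> analytic_at k x.
Proof.
move=> kE H /analytic_atP [r [M [r0 hf]]] /analytic_atP [s [N [s0 hg]]].
have t0 : 0 < Num.min r s by rewrite lt_min r0.
have minl : Num.min r s <= r by rewrite ge_min lexx.
have minr : Num.min r s <= s by rewrite ge_min lexx orbT.
have [K hK] := H _ _ (Num.min r s) M N t0
  (wseries_le (ltW t0) minl (lexx M) hf)
  (wseries_le (ltW t0) minr (lexx N) hg).
apply/analytic_atP; exists (Num.min r s), K; split => //.
by apply: wseries_ext hK => h _; rewrite kE.
Qed.

Lemma analytic_atD m (f g : 'rV[R]_m -> R) x : analytic_at f x -> analytic_at g x ->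
  analytic_at (fun y => f y + g y) x.
Proof.
apply: (analytic_at2 (op := +%R)) => // f' g' rho M N r0 hf hg.
by exists (M + N); exact: wseriesD.
Qed.

Lemma analytic_atM m (f g : 'rV[R]_m -> R) x : analytic_at f x -> analytic_at g x ->
  analytic_at (fun y => f y * g y) x.
Proof.
apply: (analytic_at2 (op := *%R)) => // f' g' rho M N r0 hf hg.
by exists (M * N); exact: wseriesM.
Qed.

Lemma analytic_at_coord m (i : 'I_m) (x : 'rV[R]_m) : analytic_at (fun y => y 0 i) x.
Proof.
apply/analytic_atP; exists 1, (`|x 0 i| + 1); split => //.
apply: wseries_ext (wseriesD ltr01 (wseries_cst (x 0 i) ltr01) (wseries_coord i ltr01)).
by move=> h _; rewrite mxE.
Qed.

(** After subtraction of the constant term, a smaller radius makes the norm as small as desired;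
    compositions and continuity both use this gain. *)
Lemma wseries_osc m (f : 'rV[R]_m -> R) rho M t : 0 < rho -> 0 <= t <= 1 ->
  wseries f rho M -> wseries (fun h => f h - f 0) (t * rho) (t * (M + `|f 0|)).
Proof.
move=> r0 t01 hf; apply: wseries_shrink => //; rewrite ?subrr //; first exact: ltW.
have := wseriesD r0 hf (wseries_cst (- f 0) r0); rewrite normrN; exact: wseries_ext.
Qed.

Lemma analytic_at_comp m p (f : 'rV[R]_p -> R) (g : 'rV[R]_m -> 'rV[R]_p) x :
  analytic_at f (g x) -> analytic_map_at g x -> analytic_at (f \o g) x.
Proof.
move=> /analytic_atP [sigma [M [s0 hf]]] hg.
have [|j|r [N [r0 hN]]] := @common_radius 'I_p
   (fun j r N => wseries (fun h => g (x + h) 0 j) r N).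
- by move=> j r r' N N' r'0 rr NN; apply: wseries_le => //; exact: ltW.
- by have /analytic_atP := hg j.
(* [B] bounds the norm of each component of [g] minus its value at [x], and is at least 1 so that it
   can be divided by. The factor [t] below shrinks these norms to sigma / 2. *)
pose B := \sum_j `|g x 0 j| + `|N| + 1.
have B1 : 1 <= B by rewrite lerDr addr_ge0 ?sumr_ge0.
have Bj j : N + `|g x 0 j| <= B.
  have := ler_norm N; rewrite /B (bigD1 j) //=.
  have : 0 <= \sum_(i < p | i != j) `|g x 0 i| by apply: sumr_ge0.
  lra.
pose t := Num.min 1 (sigma / 2 / B).
have B0 : 0 < B by apply: lt_le_trans B1.
have t0 : 0 < t by rewrite lt_min ltr01 !divr_gt0.
have t1 : t <= 1 by rewrite ge_min lexx.
have tB : t * B <= sigma / 2 by rewrite -ler_pdivlMr // ge_min lexx orbT.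
apply/analytic_atP; exists (t * r), M; split; first exact: mulr_gt0.
have tr0 : 0 < t * r by rewrite mulr_gt0.
have : wseries (fun h => f (g x + \row_j (g (x + h) 0 j - g (x + 0) 0 j))) (t * r) M.
  apply: (@wseries_comp _ _ (fun k => f (g x + k)) _ _ sigma (sigma / 2)) => //.
    by apply/andP; split; lra.
  move=> j; have t01 : 0 <= t <= 1 by rewrite t1 ltW.
  apply: wseries_le (wseries_osc r0 t01 (hN j)); rewrite ?lexx ?(ltW tr0) //.
  by rewrite addr0; apply: le_trans tB; rewrite ler_wpM2l // (ltW t0).
apply: wseries_ext => h _ /=; congr f; apply/rowP => j.
by rewrite !mxE addr0 addrC subrK.
Qed.

(** Re-expansion at a nearby point is substitution of a translation, whose norm at radius r/4 is at
    most r/4 + r/4 < r. *)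
Lemma analytic_at_near m (f : 'rV[R]_m -> R) (x : 'rV[R]_m) : analytic_at f x ->
  \forall y \near x, analytic_at f y.
Proof.
move=> /analytic_atP [r [M [r0 hf]]]; have r40 : 0 < r / 4 by rewrite divr_gt0.
apply/near_ball_mx; exists (r / 4) => // h0 hh0.
apply/analytic_atP; exists (r / 4), M; split=> //.
have : wseries (fun h => f (x + \row_j (h0 0 j + h 0 j))) (r / 4) M.
  apply: (@wseries_comp _ _ (fun k => f (x + k)) _ _ r (r / 2)) => //.
    by apply/andP; split; lra.
  move=> j; apply: wseries_le (wseriesD r40 (wseries_cst (h0 0 j) r40) (wseries_coord j r40));
    rewrite ?(ltW r40) ?lexx //.
  by have := mx_norm_coord h0 j; lra.
apply: wseries_ext => h _; rewrite -addrA; congr f; congr (_ + _).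
by apply/rowP => j; rewrite !mxE.
Qed.

Lemma analytic_at_cts m (f : 'rV[R]_m -> R) (x : 'rV[R]_m) : analytic_at f x -> {for x, continuous f}.
Proof.
move=> /analytic_atP [r [M [r0 hf]]]; apply/(@cvgrPdist_le _ _ _ (nbhs x) (nbhs_filter x)) => e e0.
pose B := `|M| + `|f x| + 1.
have B0 : 0 < B by rewrite /B; have := normr_ge0 M; have := normr_ge0 (f x); lra.
pose t := Num.min 1 (e / B).
have t0 : 0 < t by rewrite lt_min ltr01 divr_gt0.
have t1 : t <= 1 by rewrite ge_min lexx.
have tB : t * B <= e by rewrite -ler_pdivlMr // ge_min lexx orbT.
apply/near_ball_mx; exists (t * r); first exact: mulr_gt0.
have t01 : 0 <= t <= 1 by rewrite t1 ltW.
move=> h hh; have := wseries_norm_le hh (wseries_osc r0 t01 hf).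
rewrite addr0 distrC => H; apply: le_trans H (le_trans _ tB); rewrite ler_wpM2l ?(ltW t0) //.
by rewrite /B; have := ler_norm M; lra.
Qed.

End Analytic.

(** * Hadamard quotients and partial derivatives *)

Section Hadamard.
Context {R : realType} {p q : nat}.
Implicit Types (F : 'rV[R]_(p + q) -> R) (s : seq 'I_(p + q)).

(* The word s with its first letter of the second block erased, if that letter
   is l: this is the contribution of s to the l-th Hadamard quotient. *)
Fixpoint hquot (l : 'I_q) s (x : 'rV[R]_(p + q)) : R :=
  if s is i :: s' then
    match fintype.split i with
    | inl _ => x 0 i * hquot l s' x
    | inr j => (j == l)%:R * wmon x s'
    end
  else 0.

Lemma wmon_hadamard s (h : 'rV[R]_p) (k : 'rV[R]_q) :
  wmon (row_mx h k) s =
    wmon (row_mx h 0) s + \sum_l k 0 l * hquot l s (row_mx h k).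
Proof.
elim: s => [|i s IH] /=.
  by rewrite /wmon !big_nil big1 ?addr0 // => l _; rewrite mulr0.
rewrite {1 2}/wmon !big_cons -!/(wmon _ s).
case: (splitP i) => j ij; last first.
  rewrite (_ : i = rshift p j); last exact: val_inj.
  rewrite !row_mxEr mxE mul0r add0r (bigD1 j) //= eqxx mul1r [X in _ + X]big1 ?addr0 //.
  by move=> l /negPf lj; rewrite eq_sym lj mul0r mulr0.
rewrite (_ : i = lshift q j); last exact: val_inj.
rewrite !row_mxEl IH mulrDr mulr_sumr; congr (_ + _).
by apply: eq_bigr => l _; rewrite mulrCA.
Qed.

Lemma wseries_hquot l s rho : 0 < rho -> wseries (hquot l s) rho (rho ^+ size s / rho).
Proof.
move=> r0; elim: s => [|i s IH].
  apply: (@wseries_le _ _ _ rho _ 0) => //; rewrite ?(ltW r0) ?lexx //.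
    by rewrite expr0 div1r invr_ge0 ltW.
  exact: wseries0.
rewrite /=; case: (splitP i) => j ij.
  rewrite exprS -mulrA.
  by apply: wseries_ext (wseries_mul_coord i r0 IH) => h _ /=.
rewrite exprS mulrC mulKf ?(gt_eqF r0) //.
have := wseries_scale (j == l)%:R (wseries_wmon s (ltW r0)).
apply: wseries_le; rewrite ?(ltW r0) //.
by rewrite ler_piMl ?exprn_ge0 ?(ltW r0) //; case: (j == l); rewrite ?normr1 ?normr0.
Qed.

Lemma row_mx0_norm (h : 'rV[R]_p) (k : 'rV[R]_q) (rho : R) :
  `|row_mx h k| < rho -> `|row_mx h (0 : 'rV[R]_q)| < rho.
Proof.
move=> hk; have r0 : 0 < rho by apply: le_lt_trans hk.
apply: mx_norm_lt => // i; case: (splitP i) => j ij.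
  rewrite (_ : i = lshift q j); last exact: val_inj.
  rewrite row_mxEl -(row_mxEl h k); exact: le_lt_trans (mx_norm_coord _ _) hk.
rewrite (_ : i = rshift p j); last exact: val_inj.
by rewrite row_mxEr mxE normr0.
Qed.

(** Erasing one letter divides the norm of a word by [rho], so the quotients converge absolutely at
    the same radius. The factorization holds word by word and passes to the limit. *)
Lemma wseries_hadamard F rho M : 0 < rho -> wseries F rho M ->
  exists G : 'I_q -> 'rV[R]_(p + q) -> R,
    (forall l, wseries (G l) rho (M / rho)) /\
    forall h k, `|row_mx h k| < rho ->
      F (row_mx h k) = F (row_mx h 0) + \sum_l k 0 l * G l (row_mx h k).
Proof.
move=> r0 [a [ha hF]].
pose T l k x := \sum_(w : k.-tuple 'I_(p + q)) a w * hquot l w x.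
have wT l k : wseries (T l k) rho (rho ^+ k * hnorm a k / rho).
  rewrite mulrAC /hnorm mulr_sumr.
  rewrite (eq_bigr (fun w : k.-tuple 'I_(p + q) => `|a w| * (rho ^+ size w / rho))).
    by apply: wseries_fsum => // w; apply: wseries_scale; exact: wseries_hquot.
  by move=> w _; rewrite size_tuple mulrC.
have sT I : \sum_(0 <= k < I) rho ^+ k * hnorm a k / rho <= M / rho.
  by rewrite -mulr_suml ler_pM2r ?invr_gt0.
pose G l x := limn (fun I => \sum_(0 <= k < I) T l k x).
have cG l x : `|x| < rho -> (fun I => \sum_(0 <= k < I) T l k x) @ \oo --> G l x.
  move=> xr; apply: (@abs_cvg_series _ _ (M / rho)) => I.
  apply: le_trans (sT I); apply: ler_sum => k _; exact: wseries_norm_le (wT l k).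
exists G; split; first by move=> l; apply: (wseries_sum r0 (wT l)) => // x; exact: cG.
move=> h k hk; have h0 := row_mx0_norm hk.
apply: (@cvg_unique _ (@Rhausdorff R) _ _ _ _ (hF _ hk)).
apply: cvgn_ext (cvgD (hF _ h0) (cvg_fsum (s := index_enum 'I_q)
   (v := fun l I => k 0 l * \sum_(0 <= j < I) T l j (row_mx h k))
   (fun l => cvgMl_tmp (a := k 0 l) (cG l _ hk)))) => I /=.
change (\sum_(0 <= j < I) hpart a (row_mx h 0) j +
  \sum_l k 0 l * (\sum_(0 <= j < I) T l j (row_mx h k)) =
  \sum_(0 <= j < I) hpart a (row_mx h k) j).
under [X in _ + X = _]eq_bigr do rewrite mulr_sumr.
rewrite [X in _ + X = _]exchange_big -big_split /=; apply: eq_bigr => j _.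
rewrite /hpart; under [X in _ + X = _]eq_bigr do rewrite mulr_sumr.
rewrite [X in _ + X = _]exchange_big -big_split /=; apply: eq_bigr => w _.
rewrite (wmon_hadamard _ h k) mulrDr; congr (_ + _); rewrite mulr_sumr.
by apply: eq_bigr => l _; rewrite mulrCA.
Qed.

(** The partial derivatives in the second block are the Hadamard quotients taken at zero increment
    of that block, which are analytic in the first block by construction. *)
Lemma analytic_partial (F : 'rV[R]_(p + q) -> R) (x : 'rV[R]_p) (y : 'rV[R]_q) :
  analytic_at F (row_mx x y) ->
  exists G : 'I_q -> 'rV[R]_p -> R,
    (forall l, analytic_at (G l) x) /\
    \forall x' \near x, forall v : 'rV[R]_q,
      is_derive y v (fun y' => F (row_mx x' y') : R^o) (\sum_l v 0 l * G l x').
Proof.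
move=> /analytic_atP [r [M [r0 hF]]].
have [G [wG hG]] := wseries_hadamard r0 hF.
have aG l : analytic_at (G l) 0.
  by apply/analytic_atP; exists r, (M / r); split => //; apply: wseries_ext (wG l) => h _;
     rewrite add0r.
have row0 : row_mx 0 0 = 0 :> 'rV[R]_(p + q) by rewrite row_mx0.
exists (fun l x' => G l (row_mx (x' - x) 0)); split.
  move=> l; apply: (@analytic_at_comp _ _ _ (G l) (fun x' => row_mx (x' - x) 0)).
    by rewrite subrr row0.
  move=> j; case: (splitP j) => i ji.
    rewrite (_ : j = lshift q i); last exact: val_inj.
    apply: analytic_at_eq (analytic_atD (analytic_at_coord i x) (analytic_at_cst (- x 0 i) x)).
    by move=> z; rewrite row_mxEl !mxE.
  rewrite (_ : j = rshift p i); last exact: val_inj.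
  by apply: analytic_at_eq (analytic_at_cst 0 x) => z; rewrite row_mxEr mxE.
have cG : \forall z \near (0 : 'rV[R]_(p + q)), forall l, {for z, continuous (G l)}.
  apply: (@filter_forall _ 'I_q (fun l z => {for z, continuous (G l)}) (nbhs (0 : 'rV[R]_(p + q))) (nbhs_filter _)) => l.
  by apply: filterS (analytic_at_near (aG l)) => z; exact: analytic_at_cts.
have [d d0 hd] := (near_ball_mx _ _).1 cG.
pose e := Num.min d r; have e0 : 0 < e by rewrite lt_min d0.
apply/near_ball_mx; exists e => // h hh v; rewrite addrAC subrr add0r.
have hh0 : `|row_mx h (0 : 'rV[R]_q)| < e.
  apply: mx_norm_lt => // i; case: (splitP i) => j ij.
    rewrite (_ : i = lshift q j); last exact: val_inj.
    by rewrite row_mxEl (le_lt_trans (mx_norm_coord _ _)).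
  rewrite (_ : i = rshift p j); last exact: val_inj.
  by rewrite row_mxEr mxE normr0.
have ctsG l : {for row_mx h 0, continuous (G l)}.
  have := hd (row_mx h 0); rewrite add0r; apply.
  by apply: lt_le_trans hh0 _; rewrite ge_min lexx.
suff C : (fun t : R => t^-1 *: ((F (row_mx (x + h) (t *: v + y)) : R^o) -
    F (row_mx (x + h) y))) @ 0^' --> (\sum_l v 0 l * G l (row_mx h 0) : R^o).
  split; first by apply/cvg_ex; eexists; exact: C.
  exact: cvg_lim C.
have v0 : 0 < `|v| + 1 by rewrite ltr_wpDl.
have small e' (t : R) i : 0 < e' -> `|t| < e' / (`|v| + 1) -> `|(t *: v) 0 i| < e'.
  move=> e'0; rewrite ltr_pdivlMr // => h1; apply: le_lt_trans h1.
  rewrite mxE normrM ler_wpM2l // (le_trans (mx_norm_coord _ _)) //.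
  by rewrite lerDl.
have ct : (fun t : R => row_mx h (t *: v) : 'rV[R]_(p + q)) @ 0^' --> row_mx h (0 : 'rV[R]_q).
  apply/(@cvgrPdist_lt _ _ _ _ _) => e' e'0.
  near=> t; rewrite opp_row_mx add_row_mx subrr sub0r.
  have h1 : `|t| < e' / (`|v| + 1).
    by near: t; apply: dnbhs0_lt; rewrite divr_gt0.
  apply: mx_norm_lt => // i; case: (splitP i) => j ij.
    rewrite (_ : i = lshift q j); last exact: val_inj.
    by rewrite row_mxEl mxE normr0.
  rewrite (_ : i = rshift p j); last exact: val_inj.
  by rewrite row_mxEr mxE normrN; exact: small.
have C2 : (fun t : R => \sum_l v 0 l * G l (row_mx h (t *: v))) @ 0^' -->
    (\sum_l v 0 l * G l (row_mx h 0) : R^o).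
  apply: cvg_fsum => l; apply: cvgMl_tmp.
  exact: (@cvg_comp _ _ _ _ (G l) _ _ _ ct (ctsG l)).
(* For small nonzero t the difference quotient equals the combination of Hadamard quotients at the
   increment t v, whose limit is already known by continuity. *)
apply: cvg_trans C2; apply: near_eq_cvg.
near=> t.
have t0 : t != 0 by near: t; exact: nbhs_dnbhs_neq.
have ht : `|row_mx h (t *: v)| < e.
  have h1 : `|t| < e / (`|v| + 1).
    by near: t; apply: dnbhs0_lt; rewrite divr_gt0.
  apply: mx_norm_lt => // i; case: (splitP i) => j ij.
    rewrite (_ : i = lshift q j); last exact: val_inj.
    by rewrite row_mxEl (le_lt_trans (mx_norm_coord _ _)).
  rewrite (_ : i = rshift p j); last exact: val_inj.
  by rewrite row_mxEr; exact: small.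
have xE k : F (row_mx (x + h) (k + y)) = F (row_mx x y + row_mx h k).
  by rewrite add_row_mx [y + k]addrC.
have xE0 : F (row_mx (x + h) y) = F (row_mx x y + row_mx h 0) by rewrite -xE add0r.
rewrite xE xE0 hG; last first.
  by apply: lt_le_trans ht _; rewrite ge_min lexx orbT.
rewrite [X in X - _]addrC addrK scaler_sumr; apply: eq_bigr => l _.
by rewrite mxE /GRing.scale /= -mulrA mulKf.
Unshelve. all: by end_near.
Qed.

End Hadamard.

Section RowBlocks.
Context {R : realType}.

Lemma lsubmx_norm p q (h : 'rV[R]_(p + q)) : `|lsubmx h| <= `|h|.
Proof.
rewrite leNgt; apply/negP => H; suff : `|lsubmx h| < `|lsubmx h| by rewrite ltxx.
apply: mx_norm_lt; first exact: le_lt_trans H.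
by move=> i; rewrite mxE; apply: le_lt_trans (mx_norm_coord _ _) H.
Qed.

Lemma rsubmx_norm p q (h : 'rV[R]_(p + q)) : `|rsubmx h| <= `|h|.
Proof.
rewrite leNgt; apply/negP => H; suff : `|rsubmx h| < `|rsubmx h| by rewrite ltxx.
apply: mx_norm_lt; first exact: le_lt_trans H.
by move=> i; rewrite mxE; apply: le_lt_trans (mx_norm_coord _ _) H.
Qed.

Lemma lsubmx_near p q (P : 'rV[R]_p -> Prop) (z : 'rV[R]_(p + q)) :
  (\forall x \near lsubmx z, P x) -> \forall z' \near z, P (lsubmx z').
Proof.
move=> /near_ball_mx [r r0 H]; apply/near_ball_mx; exists r => // h hr.
by rewrite linearD; apply: H; apply: le_lt_trans (lsubmx_norm _) hr.
Qed.

Lemma rsubmx_near p q (P : 'rV[R]_q -> Prop) (z : 'rV[R]_(p + q)) :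
  (\forall x \near rsubmx z, P x) -> \forall z' \near z, P (rsubmx z').
Proof.
move=> /near_ball_mx [r r0 H]; apply/near_ball_mx; exists r => // h hr.
by rewrite linearD; apply: H; apply: le_lt_trans (rsubmx_norm _) hr.
Qed.

(** The two-block factorization is applied to [f] as a function of the second block, with a dummy
    first block. Halving the radius provides the strict inequality that substitution requires. *)
Lemma analytic_hadamard m (f : 'rV[R]_m -> R) (x : 'rV[R]_m) : analytic_at f x ->
  exists G : 'I_m -> 'rV[R]_m -> R, (forall l, analytic_at (G l) x) /\
    \forall y \near x, f y = f x + \sum_l (y 0 l - x 0 l) * G l y.
Proof.
move=> /analytic_atP [r [M [r0 hf]]]; have r20 : 0 < r / 2 by rewrite divr_gt0.
have : wseries (fun z : 'rV[R]_(m + m) => f (x + \row_j z 0 (rshift m j))) (r / 2) M.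
  apply: (@wseries_comp _ _ _ (fun k => f (x + k)) _ _ r (r / 2)) => //.
    by apply/andP; split; lra.
  by move=> j; exact: wseries_coord.
move=> /(wseries_hadamard r20) [G [wG hG]].
exists (fun l y => G l (row_mx 0 (y - x))); split.
  move=> l; apply: (@analytic_at_comp _ _ _ (G l) (fun y => row_mx 0 (y - x))).
    rewrite subrr row_mx0; apply/analytic_atP; exists (r / 2), (M / (r / 2)); split=> //.
    by apply: wseries_ext (wG l) => h _; rewrite add0r.
  move=> j; case: (splitP j) => i ji; last first.
    rewrite (_ : j = rshift m i); last exact: val_inj.
    apply: analytic_at_eq (analytic_atD (analytic_at_coord i x) (analytic_at_cst (- x 0 i) x)).
    by move=> z; rewrite row_mxEr !mxE.
  rewrite (_ : j = lshift m i); last exact: val_inj.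
  by apply: analytic_at_eq (analytic_at_cst 0 x) => z; rewrite row_mxEl mxE.
apply/near_ball_mx; exists (r / 2) => // h hh.
have hh0 : `|row_mx (0 : 'rV[R]_m) h| < r / 2.
  apply: mx_norm_lt => // i; case: (splitP i) => j ij.
    rewrite (_ : i = lshift m j); last exact: val_inj.
    by rewrite row_mxEl mxE normr0.
  rewrite (_ : i = rshift m j); last exact: val_inj.
  by rewrite row_mxEr (le_lt_trans (mx_norm_coord _ _)).
have rowE (k : 'rV[R]_m) : \row_j row_mx (0 : 'rV[R]_m) k 0 (rshift m j) = k.
  by apply/rowP => j; rewrite mxE row_mxEr.
have := hG 0 h hh0; rewrite !rowE addr0 => ->; congr (_ + _); apply: eq_bigr => l _.
by rewrite mxE [_ + h]addrC addrK [x 0 l + _]addrC addrK.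
Qed.

End RowBlocks.

(** * Analytic germs on a Lie group *)

Section GroupAnalytic.
Context {R : realType} {n : nat} {G : lieGroup R n}.
Implicit Types (f : G -> R) (g : G) (c : chart R n G).

Lemma chart_inv_near c g (P : G -> Prop) : chart_dom c g ->
  (\forall g' \near g, P g') -> \forall x \near chart_fun c g, P (chart_inv c x).
Proof.
move=> cg Pg; have := @chart_inv_continuous _ _ _ c (chart_fun c g).
have gK : chart_inv c (chart_fun c g) = g by apply: (chart_funK (c := c)); exact: mem_set.
have gI : chart_fun c g \in chart_fun c @` chart_dom c by apply: mem_set; exists g.
by move=> /(_ gI); rewrite /continuous_at gK => /(_ _ Pg).
Qed.

Lemma chart_fun_near c g (P : 'rV[R]_n -> Prop) : chart_dom c g ->
  (\forall x \near chart_fun c g, P x) -> \forall g' \near g, P (chart_fun c g').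
Proof.
by move=> cg Px; have := @chart_fun_continuous _ _ _ c g (mem_set cg) _ Px.
Qed.

Lemma chart_dom_near c g : chart_dom c g -> \forall g' \near g, chart_dom c g'.
Proof. by move=> cg; apply: open_nbhs_nbhs; split => //; exact: chart_dom_open. Qed.

Lemma chart_invK c g : chart_dom c g -> chart_inv c (chart_fun c g) = g.
Proof. by move=> cg; apply: (chart_funK (c := c)); exact: mem_set. Qed.

Lemma chart_inv_near_K c g : chart_dom c g ->
  \forall x \near chart_fun c g, chart_fun c (chart_inv c x) = x.
Proof.
move=> cg; have : \forall x \near chart_fun c g, (chart_fun c @` chart_dom c) x.
  by apply: open_nbhs_nbhs; split; [exact: chart_img_open|exists g].
by apply: filterS => _ [p cp <-]; rewrite chart_invK.
Qed.

(** One chart is asked for; compatibility of the atlas transfers analyticity to every other chart,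
    see [analytic_germ_chart]. *)
Definition analytic_germ f g : Prop :=
  exists2 c, lg_atlas c & chart_dom c g /\ analytic_at (f \o chart_inv c) (chart_fun c g).

Lemma analytic_germ_chart f g c : analytic_germ f g -> lg_atlas c -> chart_dom c g ->
  analytic_at (f \o chart_inv c) (chart_fun c g).
Proof.
move=> [c1 ac1 [c1g af]] ac cg.
apply: analytic_at_ext (@analytic_at_comp _ _ _ (f \o chart_inv c1)
  (chart_fun c1 \o chart_inv c) _ _ (lg_compatible ac ac1 cg c1g)).
  apply: filterS (chart_inv_near cg (chart_dom_near c1g)) => x xc1 /=.
  by rewrite chart_invK.
by rewrite /= chart_invK.
Qed.

Lemma analytic_germ_ext f f' g : (\forall g' \near g, f g' = f' g') ->
  analytic_germ f g -> analytic_germ f' g.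
Proof.
move=> ff' [c ac [cg af]]; exists c => //; split => //.
by apply: analytic_at_ext af; exact: chart_inv_near cg ff'.
Qed.

Lemma analytic_germ_eq f f' g : f =1 f' -> analytic_germ f g -> analytic_germ f' g.
Proof. by move=> /funext ->. Qed.

Lemma analytic_germ_near f g : analytic_germ f g -> \forall g' \near g, analytic_germ f g'.
Proof.
move=> [c ac [cg /analytic_at_near af]].
apply: filterS2 (chart_dom_near cg) (chart_fun_near cg af) => g' cg' a'.
by exists c.
Qed.

Lemma analytic_germ_cst (a : R) g : analytic_germ (fun=> a) g.
Proof.
have [c ac cg] := lg_cover g; exists c => //; split=> //.
exact: analytic_at_cst.
Qed.

Lemma analytic_germD f f' g : analytic_germ f g -> analytic_germ f' g ->
  analytic_germ (fun x => f x + f' x) g.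
Proof.
move=> [c ac [cg af]] af'; exists c => //; split => //.
exact: analytic_atD af (analytic_germ_chart af' ac cg).
Qed.

Lemma analytic_germM f f' g : analytic_germ f g -> analytic_germ f' g ->
  analytic_germ (fun x => f x * f' x) g.
Proof.
move=> [c ac [cg af]] af'; exists c => //; split => //.
exact: analytic_atM af (analytic_germ_chart af' ac cg).
Qed.

Lemma analytic_germZ (a : R) f g : analytic_germ f g -> analytic_germ (fun x => a * f x) g.
Proof. by apply: analytic_germM; exact: analytic_germ_cst. Qed.

Lemma analytic_germB f f' g : analytic_germ f g -> analytic_germ f' g ->
  analytic_germ (fun x => f x - f' x) g.
Proof.
move=> af af'; apply: analytic_germ_eq (analytic_germD af (analytic_germZ (-1) af')).
by move=> x; rewrite mulN1r.
Qed.

Lemma analytic_germ_sum (T : Type) (s : seq T) (f : T -> G -> R) g :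
  (forall t, analytic_germ (f t) g) -> analytic_germ (fun x => \sum_(t <- s) f t x) g.
Proof.
move=> hf; elim: s => [|t s IH].
  by apply: analytic_germ_eq (analytic_germ_cst 0 g) => y; rewrite big_nil.
by apply: analytic_germ_eq (analytic_germD (hf t) IH) => y; rewrite big_cons.
Qed.

Lemma analytic_germ_coord c g l : lg_atlas c -> chart_dom c g ->
  analytic_germ (fun x => chart_fun c x 0 l) g.
Proof.
move=> ac cg; exists c => //; split => //.
apply: analytic_at_ext (analytic_at_coord l (chart_fun c g)).
by apply: filterS (chart_inv_near_K cg) => x /= ->.
Qed.

(** Multiplication is analytic in charts; its continuity keeps nearby products in the domain of the
    third chart, where [chart_inv] really inverts [chart_fun]. *)
Lemma analytic_germ_mul f c1 c2 g h : lg_atlas c1 -> lg_atlas c2 ->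
  chart_dom c1 g -> chart_dom c2 h -> analytic_germ f (g * h)%g ->
  analytic_at (fun z : 'rV[R]_(n + n) =>
      f (chart_inv c1 (lsubmx z) * chart_inv c2 (rsubmx z))%g)
    (row_mx (chart_fun c1 g) (chart_fun c2 h)).
Proof.
move=> ac1 ac2 c1g c2h [c3 ac3 [c3gh af]].
have := lg_mul_analytic ac1 ac2 ac3 c1g c2h c3gh => am.
apply: analytic_at_ext (@analytic_at_comp _ _ _ (f \o chart_inv c3) _ _ _ am); last first.
  by rewrite /= row_mxKl row_mxKr !chart_invK.
have [[U V] /= [Ug Vh] UV] := @lg_mul_continuous _ _ G (g, h) _ (chart_dom_near c3gh).
have UL : \forall z \near row_mx (chart_fun c1 g) (chart_fun c2 h), U (chart_inv c1 (lsubmx z)).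
  apply: (@lsubmx_near _ _ _ (fun x => U (chart_inv c1 x))); rewrite row_mxKl.
  exact: chart_inv_near.
have VL : \forall z \near row_mx (chart_fun c1 g) (chart_fun c2 h), V (chart_inv c2 (rsubmx z)).
  apply: (@rsubmx_near _ _ _ (fun x => V (chart_inv c2 x))); rewrite row_mxKr.
  exact: chart_inv_near.
apply: (@filterS2 _ _ (nbhs_filter _) _ _ _ _ UL VL) => z Uz Vz /=.
by rewrite chart_invK //; exact: (UV (_, _)).
Qed.

Lemma analytic_germ_translate f a g : analytic_germ f (a * g)%g ->
  analytic_germ (fun x => f (a * x)%g) g.
Proof.
move=> af; have [c1 ac1 c1a] := lg_cover a; have [c2 ac2 c2g] := lg_cover g.
exists c2 => //; split=> //.
have := @analytic_at_comp _ _ _ _ (fun y : 'rV[R]_n => row_mx (chart_fun c1 a) y) (chart_fun c2 g)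
  (analytic_germ_mul ac1 ac2 c1a c2g af).
move=> H; apply: analytic_at_eq (H _) => [y|j] /=.
  by rewrite row_mxKl row_mxKr chart_invK.
case: (splitP j) => i ji; last first.
  rewrite (_ : j = rshift n i); last exact: val_inj.
  by apply: analytic_at_eq (analytic_at_coord i _) => z; rewrite row_mxEr.
rewrite (_ : j = lshift n i); last exact: val_inj.
by apply: analytic_at_eq (analytic_at_cst (chart_fun c1 a 0 i) _) => z; rewrite row_mxEl.
Qed.

End GroupAnalytic.

(** * Left-invariant derivatives *)

Section LieDerivative.
Context {R : realType} {n : nat} {G : lieGroup R n} (F : frame G).
Implicit Types (f : G -> R) (g : G) (xi eta : 'rV[R]_n).

Let c0 := fr_chart F.
Let x0 := chart_fun c0 1%g.
Let pull f g := fun x : 'rV[R]_n => (f (g * chart_inv c0 x)%g : R^o).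

(** In coordinates, f(g' y) is analytic in the pair (g', y), and [analytic_partial] yields its
    derivatives at y = e as analytic functions of g', together with linearity in the direction
    [v]. *)
Lemma lieR_germ f g : analytic_germ f g ->
  exists D : 'I_n -> G -> R, (forall l, analytic_germ (D l) g) /\
    \forall g' \near g, forall v, is_derive x0 v (pull f g') (\sum_l v 0 l * D l g').
Proof.
move=> af; have [c ac cg] := lg_cover g.
have af1 : analytic_germ f (g * 1)%g by rewrite mulg1.
have [D [aD hD]] := analytic_partial
  (analytic_germ_mul ac (fr_chart_atlas F) cg (fr_chart_unit F) af1).
exists (fun l g' => D l (chart_fun c g')); split.
  move=> l; exists c => //; split=> //.
  by apply: analytic_at_ext (aD l); apply: filterS (chart_inv_near_K cg) => x /= ->.
apply: filterS2 (chart_dom_near cg) (chart_fun_near cg hD) => g' cg' H v.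
have := H v; congr is_derive; apply/funext => y.
by rewrite row_mxKl row_mxKr chart_invK.
Qed.

Lemma lieR_derive f g v : analytic_germ f g -> derivable (pull f g) x0 v.
Proof. by move=> /lieR_germ [D [_ /nbhs_singleton /(_ v) []]]. Qed.

Lemma analytic_germ_lieR xi f g : analytic_germ f g -> analytic_germ (lieR F xi f) g.
Proof.
move=> /lieR_germ [D [aD hD]].
apply: analytic_germ_ext (analytic_germ_sum (index_enum 'I_n)
  (fun l => analytic_germZ ((xi *m fr_basis F) 0 l) (aD l))).
by apply: filterS hD => g' /(_ (xi *m fr_basis F)) [_ <-].
Qed.

Lemma translate_near (P : G -> Prop) g : (\forall h \near g, P h) ->
  \forall h \near (1%g : G), P (g * h)%g.
Proof.
rewrite -{1}[g]mulg1 => Pg.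
have [[U V] /= [Ug V1] UV] := @lg_mul_continuous _ _ G (g, 1%g) _ Pg.
by apply: filterS V1 => h Vh; apply: (UV (g, h)); split => //; exact: nbhs_singleton.
Qed.

Lemma lieR_ext xi f f' g : (\forall h \near g, f h = f' h) -> lieR F xi f g = lieR F xi f' g.
Proof.
move=> ff'; rewrite /lieR; apply: near_eq_derive.
apply: (chart_inv_near (P := fun h => f (g * h)%g = f' (g * h)%g) (fr_chart_unit F)).
exact: (translate_near (P := fun h => f h = f' h) ff').
Qed.

Lemma derive_coord (v x : 'rV[R]_n) l : 'D_v (fun y : 'rV[R]_n => y 0 l : R^o) x = v 0 l.
Proof.
apply: cvg_lim => //; apply: cvg_near_cst; near=> t.
have t0 : t != 0 by near: t; exact: nbhs_dnbhs_neq.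
by rewrite /= !mxE addrK /GRing.scale /= mulKf.
Unshelve. all: by end_near. Qed.

Lemma lieR_near xi f f' g : (\forall h \near g, f h = f' h) ->
  \forall h \near g, lieR F xi f h = lieR F xi f' h.
Proof.
by move=> /near_join; apply: filterS => h; exact: lieR_ext.
Qed.

Lemma lieR_lin xi f g : analytic_germ f g ->
  lieR F xi f g = \sum_i xi 0 i * lieR F (basis_vec i) f g.
Proof.
move=> /lieR_germ [D [_ /nbhs_singleton hD]].
have E v : 'D_v (pull f g) x0 = \sum_l v 0 l * D l g by case: (hD v).
rewrite {1}/lieR -/x0 -/c0 -/(pull f g) E.
under eq_bigr do rewrite mxE mulr_suml.
rewrite exchange_big; apply: eq_bigr => i _ /=.
rewrite /lieR -/x0 -/c0 -/(pull f g) E mulr_sumr; apply: eq_bigr => l _.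
by rewrite -rowE mxE mulrA.
Qed.

Lemma lieR_cst xi (a : R) g : lieR F xi (fun=> a) g = 0.
Proof. exact: derive_cst. Qed.

Lemma lieRD xi f f' g : analytic_germ f g -> analytic_germ f' g ->
  lieR F xi (fun x => f x + f' x) g = lieR F xi f g + lieR F xi f' g.
Proof. by move=> af af'; apply: deriveD; exact: lieR_derive. Qed.

Lemma lieRM xi f f' g : analytic_germ f g -> analytic_germ f' g ->
  lieR F xi (fun x => f x * f' x) g = lieR F xi f g * f' g + f g * lieR F xi f' g.
Proof.
move=> af af'.
have := deriveM (lieR_derive (v := xi *m fr_basis F) af) (lieR_derive (v := xi *m fr_basis F) af').
rewrite /pull /= chart_invK ?mulg1; last exact: fr_chart_unit.
by rewrite addrC [_ *: _]mulrC /lieR => <-.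
Qed.

Lemma lieRZ xi (a : R) f g : analytic_germ f g ->
  lieR F xi (fun x => a * f x) g = a * lieR F xi f g.
Proof.
by move=> af; rewrite lieRM ?lieR_cst ?mul0r ?add0r //; exact: analytic_germ_cst.
Qed.

Lemma lieRB xi f f' g : analytic_germ f g -> analytic_germ f' g ->
  lieR F xi (fun x => f x - f' x) g = lieR F xi f g - lieR F xi f' g.
Proof. by move=> af af'; apply: deriveB; exact: lieR_derive. Qed.

Lemma lieR_sum xi (T : Type) (s : seq T) (f : T -> G -> R) g :
  (forall t, analytic_germ (f t) g) ->
  lieR F xi (fun x => \sum_(t <- s) f t x) g = \sum_(t <- s) lieR F xi (f t) g.
Proof.
move=> af; elim: s => [|t s IH].
  rewrite big_nil; transitivity (lieR F xi (fun=> 0) g); last exact: lieR_cst.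
  by congr (lieR F xi _ g); apply/funext => x; rewrite big_nil.
rewrite big_cons -IH -lieRD //; last exact: analytic_germ_sum.
by congr (lieR F xi _ g); apply/funext => x; rewrite big_cons.
Qed.

Lemma lieR_translate xi f a g :
  lieR F xi (fun x => f (a * x)%g) g = lieR F xi f (a * g)%g.
Proof.
rewrite /lieR (_ : (fun x => _) = (fun x => (f (a * g * chart_inv (fr_chart F) x)%g : R^o))) //.
by apply/funext => x; rewrite mulgA.
Qed.

(* A germ at the unit is determined modulo products of two vanishing germs by
   the chart coordinates (Hadamard), so a derivation there is determined by its
   values on them. *)
Lemma derivation_ext (D D' : (G -> R) -> R) :
  (forall E, E = D \/ E = D' ->
    [/\ forall f f', (\forall h \near (1%g : G), f h = f' h) -> E f = E f',
        forall a, E (fun=> a) = 0,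
        forall f f', analytic_germ f 1%g -> analytic_germ f' 1%g ->
          E (fun x => f x + f' x) = E f + E f' &
        forall f f', analytic_germ f 1%g -> analytic_germ f' 1%g ->
          E (fun x => f x * f' x) = E f * f' 1%g + f 1%g * E f']) ->
  (forall l, D (fun x => chart_fun c0 x 0 l) = D' (fun x => chart_fun c0 x 0 l)) ->
  forall f, analytic_germ f 1%g -> D f = D' f.
Proof.
move=> HE HD f af.
have c01 : chart_dom c0 1%g := fr_chart_unit F.
have ac0 : lg_atlas c0 := fr_chart_atlas F.
have [H [aH hH]] := analytic_hadamard (analytic_germ_chart af ac0 c01).
have hf : \forall g \near (1%g : G), f g = f 1%g +
    \sum_l (chart_fun c0 g 0 l + - x0 0 l) * H l (chart_fun c0 g).
  apply: filterS2 (chart_dom_near c01) (chart_fun_near c01 hH) => g cg.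
  by rewrite /= !chart_invK.
have aH' l : analytic_germ (fun g => H l (chart_fun c0 g)) 1%g.
  exists c0 => //; split => //.
  by apply: analytic_at_ext (aH l); apply: filterS (chart_inv_near_K c01) => x /= ->.
have ax l : analytic_germ (fun g => chart_fun c0 g 0 l + - x0 0 l) 1%g.
  by apply: analytic_germD (analytic_germ_cst _ _); exact: analytic_germ_coord.
have axH l := analytic_germM (ax l) (aH' l).
suff EE E : E = D \/ E = D' ->
    E f = \sum_l E (fun x => chart_fun c0 x 0 l) * H l x0.
  rewrite (EE D) ?(EE D'); [|by right|by left].
  by apply: eq_bigr => l _; rewrite HD.
move=> /HE [loc cst add mul]; rewrite (loc _ _ hf) add ?cst ?add0r.
- elim: (index_enum 'I_n) => [|l s IH].
    rewrite big_nil -[RHS](cst 0); congr E; apply/funext => x; by rewrite big_nil.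
  rewrite big_cons -IH; pose A k g := (chart_fun c0 g 0 k + - x0 0 k) * H k (chart_fun c0 g).
  transitivity (E (fun g => A l g + \sum_(k <- s) A k g)).
    by congr E; apply/funext => x; rewrite big_cons.
  rewrite add; [|exact: axH|exact: (analytic_germ_sum s axH)].
  have acst := analytic_germ_cst (- x0 0 l) (1%g : G).
  have aco := analytic_germ_coord l ac0 c01.
  congr (_ + _); rewrite mul // add // cst addr0; first by rewrite subrr mul0r addr0.
- exact: analytic_germ_cst.
- exact: analytic_germ_sum.
Qed.

Lemma lieR_coord xi l :
  lieR F xi (fun g => chart_fun c0 g 0 l) 1%g = (xi *m fr_basis F) 0 l.
Proof.
rewrite /lieR (@near_eq_derive _ _ _ _ (fun y : 'rV[R]_n => y 0 l : R^o)).
  by rewrite derive_coord.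
apply: filterS (chart_inv_near_K (fr_chart_unit F)) => x xK.
by rewrite mul1g -/c0 [chart_fun c0 _]xK.
Qed.

(** Left translation moves the claim to the unit. The commutator of two derivations is a derivation
    there, since the mixed products of first derivatives cancel, and [bracket] is defined so that
    both sides agree on the chart coordinates. *)
Lemma lieR_comm xi eta f g : analytic_germ f g ->
  lieR F xi (lieR F eta f) g - lieR F eta (lieR F xi f) g = lieR F (bracket F xi eta) f g.
Proof.
move=> af; pose fg x := f (g * x)%g.
have afg : analytic_germ fg 1%g by apply: analytic_germ_translate; rewrite mulg1.
have tr zeta f' : lieR F zeta f' g = lieR F zeta (fun x => f' (g * x)%g) 1%g.
  by rewrite lieR_translate mulg1.
have tr2 zeta : (fun x => lieR F zeta f (g * x)%g) = lieR F zeta fg.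
  by apply/funext => x; rewrite /fg lieR_translate.
rewrite !tr !tr2 -/fg {tr tr2}.
apply: (@derivation_ext
  (fun f => lieR F xi (lieR F eta f) 1%g - lieR F eta (lieR F xi f) 1%g)
  (lieR F (bracket F xi eta) ^~ 1%g)) afg => [E [->|->]|l].
- split=> [f1 f2 f12|a|f1 f2 a1 a2|f1 f2 a1 a2].
  + by rewrite (lieR_ext xi (lieR_near eta f12)) (lieR_ext eta (lieR_near xi f12)).
  + rewrite (_ : lieR F eta _ = fun=> 0); last by apply/funext => x; rewrite lieR_cst.
    rewrite (_ : lieR F xi (fun=> a) = fun=> 0); last by apply/funext => x; rewrite lieR_cst.
    by rewrite !lieR_cst subrr.
  + have D zeta : \forall h \near (1%g : G), lieR F zeta (fun x => f1 x + f2 x) h =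
        lieR F zeta f1 h + lieR F zeta f2 h.
      apply: filterS2 (analytic_germ_near a1) (analytic_germ_near a2) => h; exact: lieRD.
    rewrite (lieR_ext xi (D eta)) (lieR_ext eta (D xi)) !lieRD;
      try exact: analytic_germ_lieR.
    by rewrite opprD addrACA.
  + have D zeta : \forall h \near (1%g : G), lieR F zeta (fun x => f1 x * f2 x) h =
        lieR F zeta f1 h * f2 h + f1 h * lieR F zeta f2 h.
      apply: filterS2 (analytic_germ_near a1) (analytic_germ_near a2) => h; exact: lieRM.
    have al zeta f' : analytic_germ f' 1%g -> analytic_germ (lieR F zeta f') 1%g.
      exact: analytic_germ_lieR.
    have D2 zeta theta : lieR F theta (lieR F zeta (fun x => f1 x * f2 x)) 1%g =
        lieR F theta (lieR F zeta f1) 1%g * f2 1%g + lieR F zeta f1 1%g * lieR F theta f2 1%g +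
       (lieR F theta f1 1%g * lieR F zeta f2 1%g + f1 1%g * lieR F theta (lieR F zeta f2) 1%g).
      rewrite (lieR_ext theta (D zeta)).
      have a1' := al zeta _ a1; have a2' := al zeta _ a2.
      rewrite lieRD; [|exact: analytic_germM|exact: analytic_germM].
      by congr (_ + _); exact: lieRM.
    rewrite (D2 eta xi) (D2 xi eta).
    move: (lieR F xi (lieR F eta f1) 1%g) (lieR F eta (lieR F xi f1) 1%g)
      (lieR F xi (lieR F eta f2) 1%g) (lieR F eta (lieR F xi f2) 1%g)
      (lieR F xi f1 1%g) (lieR F eta f1 1%g) (lieR F xi f2 1%g) (lieR F eta f2 1%g)
      (f1 1%g) (f2 1%g) => *; ring.
- split=> [f1 f2 f12|a|f1 f2 a1 a2|f1 f2 a1 a2].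
  + exact: lieR_ext.
  + exact: lieR_cst.
  + exact: lieRD.
  + exact: lieRM.
- by rewrite lieR_coord /bracket mulmxKV ?fr_basis_unit // mxE.
Qed.

End LieDerivative.

(** * Weighted norms on the monoid algebras *)

Section Cabs.
Context {R : realType}.
Implicit Types z w : cplx R.

Lemma cabsE z : cabs z = ComplexField.Normc.normc z.
Proof. by case: z => a b; rewrite /cabs /cre normc_def. Qed.

Lemma cabsM z w : cabs (z * w) = cabs z * cabs w.
Proof. by rewrite !cabsE; exact: ComplexField.Normc.normcM. Qed.

Lemma cabsD z w : cabs (z + w) <= cabs z + cabs w.
Proof. by rewrite !cabsE; exact: le_normcD. Qed.

Lemma cabs_ge0 z : 0 <= cabs z.
Proof. by rewrite cabsE; case: z => a b /=; exact: sqrtr_ge0. Qed.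

Lemma cabs0 : cabs (0 : cplx R) = 0.
Proof. by rewrite cabsE ComplexField.Normc.normc0. Qed.

Lemma cabs1 : cabs (1 : cplx R) = 1.
Proof. by rewrite cabsE ComplexField.Normc.normc1. Qed.

Lemma cabs0_eq z : cabs z = 0 -> z = 0.
Proof. by rewrite cabsE; exact: ComplexField.Normc.eq0_normc. Qed.

Lemma cabsV z : cabs z^-1 = (cabs z)^-1.
Proof. by rewrite !cabsE; exact: ComplexField.Normc.normcV. Qed.

Lemma cabsX z k : cabs (z ^+ k) = cabs z ^+ k.
Proof. by elim: k => [|k IH]; rewrite ?expr0 ?cabs1 // !exprS cabsM IH. Qed.

Lemma cabsN z : cabs (- z) = cabs z.
Proof. by rewrite !cabsE normcN. Qed.

Lemma cabs_creal (x : R) : cabs (creal x) = `|x|.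
Proof. by rewrite cabsE /= expr0n /= addr0 sqrtr_sqr. Qed.

Lemma crealE : (creal : R -> cplx R) = real_complex R.
Proof. by []. Qed.

Lemma creal_sum (I : Type) (s : seq I) (P : pred I) (f : I -> R) :
  creal (\sum_(i <- s | P i) f i) = \sum_(i <- s | P i) creal (f i) :> cplx R.
Proof. exact: (rmorph_sum (real_complex R)). Qed.

Lemma cabs_nat k : cabs (k%:R : cplx R) = k%:R.
Proof.
rewrite -[RHS]ger0_norm ?ler0n // -cabs_creal; congr cabs.
by rewrite crealE rmorph_nat.
Qed.

Lemma cabs_sum (I : Type) (s : seq I) (P : pred I) (f : I -> cplx R) :
  cabs (\sum_(i <- s | P i) f i) <= \sum_(i <- s | P i) cabs (f i).
Proof.
elim/big_rec2: _ => [|i x y _ H]; first by rewrite cabs0.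
by apply: le_trans (cabsD _ _) _; rewrite lerD2l.
Qed.

(** Such phases are the values of the norm-one functional that bounds [proj_power] from below. *)
Lemma phase_exists z : exists w, cabs w <= 1 /\ z * w = creal (cabs z).
Proof.
case: (eqVneq z 0) => [->|z0]; first by exists 0; rewrite mulr0 cabs0.
exists (creal (cabs z) / z); split; last by rewrite mulrC divfK.
have cz : cabs z != 0 by apply: contra_neq z0; exact: cabs0_eq.
by rewrite cabsM cabsV cabs_creal ger0_norm ?cabs_ge0 // divff.
Qed.

End Cabs.

Section Coefficients.
Context {A : zmodType} {K : choiceType}.

(** Elements with different supports are compared on one common finite set. The coefficient is an
    argument of [phi] so that nonlinear expressions, such as norms of coefficients, are covered. *)
Lemma sum_msupp (V : nmodType) (v : malg K A) (D : {fset K}) (phi : A -> K -> V) :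
  (forall m, phi 0 m = 0) -> fsubset (msupp v) D ->
  \sum_(m <- finmap.enum_fset D) phi (mcoeff m v) m =
  \sum_(m <- finmap.enum_fset (msupp v)) phi (mcoeff m v) m.
Proof.
move=> phi0 vD; apply/esym/(big_fset_incl _ vD) => m _ mv.
by rewrite mcoeff_outdom.
Qed.

Lemma sum_msupp_delta (V : nmodType) m (phi : A -> V) (v : malg K A) : phi 0 = 0 ->
  \sum_(k <- finmap.enum_fset (msupp v)) phi (mcoeff k v) *+ (k == m) = phi (mcoeff m v).
Proof.
move=> phi0; rewrite -(@sum_msupp _ v (fsetU [fset m]%fset (msupp v))
    (fun c k => phi c *+ (k == m))) ?fsubsetUr //; last by move=> k; rewrite phi0 mul0rn.
rewrite (bigD1_seq m) ?fset_uniq ?in_fsetU ?in_fset1 ?eqxx //= big1 ?addr0 // => k km.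
by rewrite (negPf km).
Qed.

End Coefficients.

Section WeightedNorm.
Context {R : realType} {K : choiceType}.
Implicit Types (W : K -> R) (v : malg K (cplx R)).

Definition lext (V : lmodType (cplx R)) (phi : K -> V) v : V :=
  \sum_(m <- finmap.enum_fset (msupp v)) mcoeff m v *: phi m.

Definition wnorm W v : R :=
  \sum_(m <- finmap.enum_fset (msupp v)) cabs (mcoeff m v) * W m.

Lemma lextw (V : lmodType (cplx R)) (phi : K -> V) v (D : {fset K}) :
  fsubset (msupp v) D -> lext phi v = \sum_(m <- finmap.enum_fset D) mcoeff m v *: phi m.
Proof.
move=> vD; rewrite (@sum_msupp _ _ _ v D (fun c m => c *: phi m)) // => m.
exact: scale0r.
Qed.

Lemma lext_is_linear (V : lmodType (cplx R)) (phi : K -> V) : linear (lext phi).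
Proof.
move=> a u v; pose D := fsetU (msupp (a *: u + v)) (fsetU (msupp u) (msupp v)).
rewrite !(@lextw _ phi _ D) ?fsubsetUl //; last 2 first.
- by rewrite /D fsetUA fsubsetUr.
- by rewrite /D fsetUCA fsubsetUl.
rewrite scaler_sumr -big_split; apply: eq_bigr => m _ /=.
by rewrite mcoeffD mcoeffZ scalerDl scalerA.
Qed.

HB.instance Definition _ (V : lmodType (cplx R)) (phi : K -> V) :=
  GRing.isLinear.Build (cplx R) (malg K (cplx R)) V *:%R (lext phi) (lext_is_linear phi).

Lemma lextD (V : lmodType (cplx R)) (phi : K -> V) u v :
  lext phi (u + v) = lext phi u + lext phi v.
Proof. exact: (linearD (lext phi)). Qed.

Lemma lextZ (V : lmodType (cplx R)) (phi : K -> V) c v :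
  lext phi (c *: v) = c *: lext phi v.
Proof. exact: (linearZ_LR (lext phi)). Qed.

Lemma lext_sum (V : lmodType (cplx R)) (phi : K -> V) (I : Type) (s : seq I) (P : pred I)
    (f : I -> malg K (cplx R)) :
  lext phi (\sum_(i <- s | P i) f i) = \sum_(i <- s | P i) lext phi (f i).
Proof. exact: (linear_sum (lext phi)). Qed.

Lemma lextU (V : lmodType (cplx R)) (phi : K -> V) c m :
  lext phi (mkmalgU m c) = c *: phi m.
Proof.
rewrite (@lextw _ _ _ [fset m]%fset) ?msuppU_le //.
by rewrite big_seq_fset1 mcoeffUU.
Qed.

Lemma mkmalgU_scale m (c : cplx R) : mkmalgU m c = c *: mkmalgU m 1 :> malg K (cplx R).
Proof.
by apply/malgP => k; rewrite mcoeffZ !mcoeffU; case: eqP; rewrite ?mulr1 // mulr0.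
Qed.

Lemma malg_lext v : v = lext (fun m => mkmalgU m 1) v.
Proof. by rewrite {1}(monalgE v); apply: eq_bigr => m _; rewrite mkmalgU_scale. Qed.

Lemma wnorm_ge0 W v : (forall m, 0 <= W m) -> 0 <= wnorm W v.
Proof. by move=> W0; apply: sumr_ge0 => m _; rewrite mulr_ge0 ?cabs_ge0. Qed.

Lemma wnormw W v (D : {fset K}) : fsubset (msupp v) D ->
  wnorm W v = \sum_(m <- finmap.enum_fset D) cabs (mcoeff m v) * W m.
Proof.
move=> vD; rewrite (@sum_msupp _ _ _ v D (fun c m => cabs c * W m)) // => m.
by rewrite cabs0 mul0r.
Qed.

Lemma wnormU W c m : wnorm W (mkmalgU m c) = cabs c * W m.
Proof.
rewrite (@wnormw _ _ [fset m]%fset) ?msuppU_le //.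
by rewrite big_seq_fset1 mcoeffUU.
Qed.

Lemma wnormZ W c v : wnorm W (c *: v) = cabs c * wnorm W v.
Proof.
rewrite (@wnormw _ _ (msupp v)) ?msuppZ_le // mulr_sumr.
by apply: eq_bigr => m _; rewrite mcoeffZ cabsM mulrA.
Qed.

Lemma wnormD W u v : (forall m, 0 <= W m) -> wnorm W (u + v) <= wnorm W u + wnorm W v.
Proof.
move=> W0; pose D := fsetU (msupp (u + v)) (fsetU (msupp u) (msupp v)).
rewrite !(@wnormw _ _ D) ?fsubsetUl //; last 2 first.
- by rewrite /D fsetUA fsubsetUr.
- by rewrite /D fsetUCA fsubsetUl.
rewrite -big_split; apply: ler_sum => m _ /=.
by rewrite mcoeffD -mulrDl ler_wpM2r // cabsD.
Qed.

Lemma wnorm0 W : wnorm W 0 = 0.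
Proof. by rewrite /wnorm msupp0 big_seq_fset0. Qed.

Lemma wnorm_sum W (I : Type) (s : seq I) (P : pred I) (f : I -> malg K (cplx R)) :
  (forall m, 0 <= W m) ->
  wnorm W (\sum_(i <- s | P i) f i) <= \sum_(i <- s | P i) wnorm W (f i).
Proof.
move=> W0; elim/big_rec2: _ => [|i x y _ H]; first by rewrite wnorm0.
by apply: le_trans (wnormD _ _ W0) _; rewrite lerD2l.
Qed.

Lemma le_wnorm W W' v : (forall m, W m <= W' m) -> wnorm W v <= wnorm W' v.
Proof. by move=> WW; apply: ler_sum => m _; rewrite ler_wpM2l ?cabs_ge0. Qed.

Lemma cabs_lext (phi : K -> (cplx R)^o) v : (forall m, cabs (phi m) <= 1) ->
  cabs (lext phi v) <= wnorm (fun=> 1) v.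
Proof.
move=> H; apply: le_trans (cabs_sum _ _ _) _; apply: ler_sum => m _.
by rewrite cabsM ler_wpM2l ?cabs_ge0.
Qed.

End WeightedNorm.

Lemma wnorm_lext (R : realType) (K K' : choiceType) (W : K' -> R) (W1 : K -> R) (phi : K -> malg K' (cplx R)) (v : malg K (cplx R)) :
  (forall m, 0 <= W m) -> (forall m, wnorm W (phi m) <= W1 m) ->
  wnorm W (lext phi v) <= wnorm W1 v.
Proof.
move=> W0 H; apply: le_trans (wnorm_sum _ _ _ W0) _.
by apply: ler_sum => m _; rewrite wnormZ ler_wpM2l ?cabs_ge0.
Qed.

Lemma sum_perm_const (V : nmodType) k (x : V) : \sum_(s : 'S_k) x = x *+ k`!.
Proof.
rewrite (eq_bigl (fun s => s \in [set: 'S_k]%SET)) => [|s]; last by rewrite inE.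
by rewrite sumr_const cardsT card_Sn.
Qed.

(** * Words, symmetrization and the seminorms on Sym(g) *)

Section Words.
Context {R : realType} {n : nat}.
Let C := cplx R.
Implicit Types (w : seq 'I_n) (m : cmonom 'I_n) (z : C) (v : symAlg R n).

Definition tword w : tensAlg R n := mkmalgU (FMonom w) 1.

Definition smon m : symAlg R n := mkmalgU m 1.

(** The monomial that a word becomes when its letters commute. *)
Definition cword w : cmonom 'I_n := foldr (fun i m => mulcm (ucm i) m) (onecm _) w.

Lemma tscaleAl (c : C) (s t : tensAlg R n) : c *: (s * t) = (c *: s) * t.
Proof. exact: fgscaleAl. Qed.

Lemma tscaleAr (c : C) (s t : tensAlg R n) : c *: (s * t) = s * (c *: t).
Proof.
apply/malgP => k.
have E := @mcoeffMlw _ _ (msupp s) (msupp t) s (c *: t) k (fsubset_refl _) (msuppZ_le _ _).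
rewrite [LHS]mcoeffZ; apply: esym; apply: etrans E _; apply: esym.
rewrite [mcoeff k (s * t)]mcoeffMl mulr_sumr; apply: eq_bigr => a _.
rewrite mulr_sumr; apply: eq_bigr => b _.
by rewrite mcoeffZ mulrnAr mulrCA.
Qed.

Lemma tword_cat w w' : tword (w ++ w') = tword w * tword w'.
Proof. by rewrite /tword [RHS]fgmulUU mulr1; congr mkmalgU; exact/esym/fmmulE. Qed.

Lemma tword0 : tword [::] = 1.
Proof. by rewrite /tword -fmoneE. Qed.

Lemma tens_lext (t : tensAlg R n) : t = lext (fun w : fmonom 'I_n => tword (fmonom_val w)) t.
Proof.
rewrite {1}(malg_lext t) /lext; apply: eq_bigr => w _; congr (_ *: _).
by rewrite /tword fmK.
Qed.

Lemma tens_mull (s t : tensAlg R n) : s * t = lext (fun w : fmonom 'I_n => tword (fmonom_val w) * t) s.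
Proof.
rewrite {1}(tens_lext s) /lext mulr_suml; apply: eq_bigr => w _.
by rewrite tscaleAl.
Qed.

Lemma tens_mulr (s t : tensAlg R n) : s * t = lext (fun w : fmonom 'I_n => s * tword (fmonom_val w)) t.
Proof.
rewrite {1}(tens_lext t) /lext mulr_sumr; apply: eq_bigr => w _.
by rewrite tscaleAr.
Qed.

Lemma tword_prod (T : Type) (s : seq T) (f : T -> 'I_n) :
  \prod_(j <- s) tword [:: f j] = tword (map f s).
Proof.
elim: s => [|j s IH]; first by rewrite big_nil /= tword0.
by rewrite big_cons IH -tword_cat.
Qed.

Lemma prod_enum k (A : pzSemiRingType) (f : 'I_k -> A) :
  \prod_(j <- enum 'I_k) f j = \prod_(j < k) f j.
Proof. by rewrite enumT /index_enum; unlock. Qed.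

Lemma tensVecE i : tensVec (cvec (basis_vec i)) = tword [:: i] :> tensAlg R n.
Proof.
rewrite /tensVec (bigD1 i) //= big1 ?addr0.
  rewrite !mxE !eqxx /= /tword -fmuE; congr mkmalgU.
by move=> j ji; rewrite !mxE eqxx (negPf ji) /= [creal 0](_ : _ = 0) // monalgU0.
Qed.

Lemma symVecE i : symVec (cvec (basis_vec i)) = smon (ucm i) :> symAlg R n.
Proof.
rewrite /symVec (bigD1 i) //= big1 ?addr0.
  by rewrite !mxE !eqxx /=; congr mkmalgU.
by move=> j ji; rewrite !mxE eqxx (negPf ji) /= [creal 0](_ : _ = 0) // monalgU0.
Qed.

Lemma smonM m m' : smon m * smon m' = smon (mulcm m m').
Proof. by rewrite /smon [LHS]fgmulUU mulr1. Qed.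

Lemma smon_cword w : smon (cword w) = \prod_(i <- w) smon (ucm i).
Proof.
elim: w => [|i w IH]; first by rewrite big_nil.
by rewrite big_cons -IH smonM.
Qed.

Lemma cwordE w i : cword w i = count_mem i w.
Proof.
elim: w => [|j w IH] /=; first exact: onecmE.
by rewrite mulcmE ucmE IH.
Qed.

Lemma mdeg_cword w : mdeg (cword w) = size w.
Proof.
elim: w => [|j w IH]; first exact: mdeg1.
rewrite -[LHS]/(mdeg (mulcm (ucm j) (cword w))).
by have := mdegM (ucm j) (cword w); rewrite IH mdegU.
Qed.

Lemma cword_perm w w' : perm_eq w w' -> cword w = cword w'.
Proof. by move=> /seq.permP ww; apply/eqP/cmP => i; rewrite !cwordE ww. Qed.

Lemma cword_monom m : cword (cmonom_word m) = m.
Proof.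
apply/eqP/cmP => i; rewrite cwordE /cmonom_word count_flatten -map_comp.
rewrite sumnE big_map big_enum (bigD1 i) //= big1 ?addn0.
  by rewrite count_nseq /= eqxx mul1n.
by move=> j ji; rewrite count_nseq /= (negPf ji) mul0n.
Qed.

Lemma size_cmonom_word m : size (cmonom_word m) = mdeg m.
Proof. by rewrite -mdeg_cword cword_monom. Qed.

Lemma cmonom_wordK w : perm_eq (cmonom_word (cword w)) w.
Proof. by apply/allP => i _ /=; rewrite -!cwordE cword_monom. Qed.

(** Symmetrization of an indexed family; a fixed [k] avoids permutations that depend on the size of
    a sequence. *)
Definition symfun k (u : 'I_k -> 'I_n) : tensAlg R n :=
  ((k`!)%:R^-1 : C) *: \sum_(s : 'S_k) tword [seq u (s j) | j <- enum 'I_k].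

Lemma symfun_perm k (u : 'I_k -> 'I_n) (p : 'S_k) : symfun (u \o p) = symfun u.
Proof.
rewrite /symfun; congr (_ *: _).
rewrite [RHS](reindex_inj (mulIg p)); apply: eq_bigr => s _.
by congr tword; apply: eq_map => j; rewrite permM.
Qed.

Lemma symmetrize_tuple k (t : k.-tuple 'I_n) : symmetrize_word R t = symfun (tnth t).
Proof.
have -> : symmetrize_word R t = symfun (tnth (in_tuple t)).
  rewrite /symmetrize_word /symfun; congr (_ *: _); apply: eq_bigr => s _.
  under eq_bigr do rewrite tensVecE.
  by rewrite -(tword_prod (enum 'I_(size t))) prod_enum.
case: t => w wk; have wk' := eqP wk; subst k => /=.
by congr symfun; apply/funext => j; congr tnth; apply: val_inj.
Qed.

Lemma symmetrize_symfun k (u : 'I_k -> 'I_n) :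
  symmetrize_word R [seq u j | j <- enum 'I_k] = symfun u.
Proof.
have -> : [seq u j | j <- enum 'I_k] = tval [tuple u j | j < k] by rewrite -[enum _]val_ord_tuple.
rewrite symmetrize_tuple.
by congr symfun; apply/funext => j; rewrite tnth_mktuple.
Qed.

Lemma symmetrize_perm w w' : perm_eq w w' -> symmetrize_word R w = symmetrize_word R w'.
Proof.
move=> /(@tuple_permP _ _ _ (in_tuple w')) [p ->]; rewrite symmetrize_tuple.
rewrite -[w' in RHS]/(val (in_tuple w')) symmetrize_tuple -[RHS](symfun_perm _ p).
by congr symfun; apply/funext => j; rewrite tnth_mktuple.
Qed.

Lemma quantizeE z : quantize z =
  lext (fun m => z ^+ mdeg m *: symmetrize_word R (cmonom_word m)).
Proof.
apply/funext => v; rewrite /quantize /lext; apply: eq_bigr => m _.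
by rewrite [RHS]scalerA.
Qed.

Lemma quantizeZ z c v : quantize z (c *: v) = c *: quantize z v.
Proof. by rewrite quantizeE; exact: lextZ. Qed.

Lemma quantizeD z (u v : symAlg R n) : quantize z (u + v) = quantize z u + quantize z v.
Proof. by rewrite quantizeE; exact: lextD. Qed.

Lemma quantize_sum z (I : Type) (s : seq I) (P : pred I) (f : I -> symAlg R n) :
  quantize z (\sum_(i <- s | P i) f i) = \sum_(i <- s | P i) quantize z (f i).
Proof. by rewrite quantizeE; exact: lext_sum. Qed.

Lemma quantize_smon z m : quantize z (smon m) =
  z ^+ mdeg m *: symmetrize_word R (cmonom_word m).
Proof. by rewrite quantizeE lextU scale1r. Qed.

Lemma quantize_cword z w : quantize z (smon (cword w)) =
  z ^+ size w *: symmetrize_word R w.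
Proof.
by rewrite quantize_smon mdeg_cword (symmetrize_perm (cmonom_wordK w)).
Qed.

(** All rearrangements of [w] have the same commutative image, so averaging over them does not
    change a functional that factors through this image. *)
Lemma lext_symmetrize (theta : cmonom 'I_n -> C) w :
  lext (fun m : fmonom 'I_n => theta (cword (fmonom_val m)) : C^o) (symmetrize_word R w) =
  theta (cword w).
Proof.
rewrite -[w]/(val (in_tuple w)) symmetrize_tuple /symfun lextZ lext_sum.
rewrite (eq_bigr (fun=> theta (cword w))).
  rewrite sum_perm_const.
  change (((size w)`!)%:R^-1 * (theta (cword w) *+ (size w)`!) = theta (cword w) :> C).
  by rewrite -[X in _ * X = _]mulr_natl mulKf // pnatr_eq0 -lt0n fact_gt0.
move=> s _; rewrite lextU scale1r /=; congr theta; apply: cword_perm.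
have := @tuple_permP _ _ [seq tnth (in_tuple w) (s j) | j <- enum 'I_(size w)] (in_tuple w).
by move=> H; apply/H; exists s.
Qed.

Definition symW (W : nat -> R) : symAlg R n -> R := wnorm (fun m => W (mdeg m)).

Lemma wnorm1_tens (s t : tensAlg R n) :
  wnorm (fun=> 1) (s * t) <= wnorm (fun=> 1) s * wnorm (fun=> 1) t.
Proof.
rewrite [s * t]malgME; apply: le_trans (wnorm_sum _ _ _ _) _; first by move=> *; exact: ler01.
rewrite /wnorm mulr_suml; apply: ler_sum => a _.
apply: le_trans (wnorm_sum _ _ _ _) _; first by move=> *; exact: ler01.
by rewrite mulr_sumr; apply: ler_sum => b _; rewrite wnormU cabsM !mulr1.
Qed.

Lemma wnorm1_tensVec (x : 'rV[C]_n) : wnorm (fun=> 1) (tensVec x) <= l1norm x.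
Proof.
apply: le_trans (wnorm_sum _ _ _ _) _; first by move=> *; exact: ler01.
by apply: ler_sum => i _; rewrite wnormU mulr1.
Qed.

Definition proj_rep k (t : tensAlg R n) (y : R) : Prop :=
  exists (N : nat) (a : 'I_N -> C) (x : 'I_N -> 'I_k -> 'rV[C]_n),
    t = \sum_(i < N) a i *: \prod_(j < k) tensVec (x i j) /\
    y = \sum_(i < N) cabs (a i) * \prod_(j < k) l1norm (x i j).

(** The l^1-norm on words is submultiplicative and at most [l1norm] on vectors, so it is a lower
    bound for the cost of every decomposition. *)
Lemma proj_rep_ge k t y : proj_rep k t y -> wnorm (fun=> 1) t <= y.
Proof.
move=> [N [a [x [-> ->]]]]; apply: le_trans (wnorm_sum _ _ _ _) _; first by move=> *; exact: ler01.
apply: ler_sum => i _; rewrite wnormZ ler_wpM2l ?cabs_ge0 //.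
elim/big_rec2: _ => [|j y1 y2 _ H]; first by rewrite wnormU cabs1 mulr1.
apply: le_trans (wnorm1_tens _ _) _; rewrite ler_pM ?wnorm1_tensVec //;
  by apply: wnorm_ge0 => *; exact: ler01.
Qed.

Lemma proj_repD k s t y y' : proj_rep k s y -> proj_rep k t y' -> proj_rep k (s + t) (y + y').
Proof.
move=> [N [a [x [-> ->]]]] [N' [a' [x' [-> ->]]]].
pose sel T (f : 'I_N -> T) (f' : 'I_N' -> T) (i : 'I_(N + N')) :=
  match fintype.split i with inl j => f j | inr j => f' j end.
exists (N + N')%N, (sel _ a a'), (sel _ x x').
have selL T f f' j : sel T f f' (lshift N' j) = f j.
  by rewrite /sel; case: split_ordP => j' /eqP; rewrite ?eq_lshift ?eq_lrshift // => /eqP ->.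
have selR T f f' j : sel T f f' (rshift N j) = f' j.
  by rewrite /sel; case: split_ordP => j' /eqP; rewrite ?eq_rshift ?eq_rlshift // => /eqP ->.
split.
  rewrite [RHS]big_split_ord; apply: f_equal2; apply: eq_bigr => i _.
    by rewrite !selL.
  by rewrite !selR.
rewrite [RHS]big_split_ord; apply: f_equal2; apply: eq_bigr => i _.
  by rewrite !selL.
by rewrite !selR.
Qed.

Lemma proj_rep0 k : proj_rep k 0 0.
Proof. by exists 0%N, (fun=> 0), (fun _ _ => 0); rewrite !big_ord0. Qed.

Lemma proj_rep_sum k (I : Type) (s : seq I) (P : pred I) (t : I -> tensAlg R n) (y : I -> R) :
  (forall i, P i -> proj_rep k (t i) (y i)) ->
  proj_rep k (\sum_(i <- s | P i) t i) (\sum_(i <- s | P i) y i).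
Proof.
move=> H; elim/big_rec2: _ => [|i t' y' Pi IH]; first exact: proj_rep0.
exact: proj_repD (H i Pi) IH.
Qed.

Lemma proj_rep_word k (u : 'I_k -> 'I_n) (a : C) :
  proj_rep k (a *: tword [seq u j | j <- enum 'I_k]) (cabs a).
Proof.
exists 1%N, (fun=> a), (fun _ j => cvec (basis_vec (u j))).
rewrite !big_ord1; split.
  by rewrite -(tword_prod (enum 'I_k)) prod_enum; congr (_ *: _); apply: eq_bigr => j _; rewrite tensVecE.
rewrite big1 ?mulr1 // => j _; rewrite /l1norm (bigD1 (u j)) //= big1 ?addr0.
  by rewrite !mxE !eqxx cabs_creal normr1.
by move=> i /negPf iu; rewrite !mxE eqxx iu /= cabs_creal normr0.
Qed.

Lemma proj_rep_symmetrize k m (a : C) : mdeg m = k ->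
  proj_rep k (a *: symmetrize_word R (cmonom_word m)) (cabs a).
Proof.
move=> <-; rewrite -size_cmonom_word; set w := cmonom_word m.
rewrite -[X in symmetrize_word _ X]/(val (in_tuple w)) symmetrize_tuple.
rewrite /symfun scalerA scaler_sumr.
have -> : cabs a = \sum_(s : 'S_(size w)) cabs (a / (size w)`!%:R).
  have k0 : ((size w)`!)%:R != 0 :> R by rewrite pnatr_eq0 -lt0n fact_gt0.
  by rewrite sum_perm_const cabsM cabsV cabs_nat -[RHS]mulr_natl mulrCA divff ?mulr1.
apply: proj_rep_sum => s _; exact: (proj_rep_word (fun j => tnth (in_tuple w) (s j))).
Qed.

(** The symmetrized words themselves are a decomposition of this cost. Conversely every
    decomposition costs at least the l^1-norm on words, hence at least the value of any functional
    bounded by 1 on words; the one with the phases of the coefficients of [v] takes the value on the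
    right. *)
Lemma proj_power_sym_part k v : proj_power k (quantize 1 (sym_part k v)) =
  wnorm (fun m => (mdeg m == k)%:R) v.
Proof.
set N := wnorm _ v; set t := quantize 1 _.
have NE : N = \sum_(m <- finmap.enum_fset (msupp v) | mdeg m == k) cabs (mcoeff m v).
  by rewrite /N /wnorm [RHS]big_mkcond; apply: eq_bigr => m _; case: eqP;
     rewrite ?mulr1 ?mulr0.
have tE : t = \sum_(m <- finmap.enum_fset (msupp v) | mdeg m == k)
     mcoeff m v *: symmetrize_word R (cmonom_word m).
  rewrite /t /sym_part quantize_sum; apply: eq_bigr => m _.
  have -> : mkmalgU m (mcoeff m v) = mcoeff m v *: smon m by exact: mkmalgU_scale.
  by rewrite quantizeZ quantize_smon expr1n scale1r.
clearbody N t.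
have repN : proj_rep k t N.
  by rewrite tE NE; apply: proj_rep_sum => m /eqP; exact: proj_rep_symmetrize.
have lbN : lbound [set y | proj_rep k t y] N.
  move=> y /proj_rep_ge; apply: le_trans.
  have [theta htheta] := choice (fun m => phase_exists (mcoeff m v)).
  pose L : tensAlg R n -> C^o :=
    lext (fun m : fmonom 'I_n => theta (cword (fmonom_val m)) : C^o).
  have -> : N = cabs (L t).
    rewrite tE /L lext_sum.
    rewrite (eq_bigr (fun m => creal (cabs (mcoeff m v)))).
      rewrite NE; transitivity (cabs (creal
        (\sum_(m <- finmap.enum_fset (msupp v) | mdeg m == k) cabs (mcoeff m v)))).
        by rewrite cabs_creal ger0_norm // sumr_ge0 // => m _; exact: cabs_ge0.
      by congr cabs; exact: creal_sum.
    move=> m _; rewrite lextZ lext_symmetrize cword_monom /GRing.scale /=.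
    by case: (htheta m).
  by apply: cabs_lext => m; case: (htheta (cword (fmonom_val m))).
apply/eqP; rewrite eq_le; apply/andP; split.
  by apply: ge_inf => //; exists N.
by apply: lb_le_inf => //; exists N.
Qed.

(** The infima disappear and a single weighted l^1-norm on monomials remains; all estimates on
    Sym(g) are made in this form. *)
Lemma sym_normE r c : sym_norm r c = symW (fun k => (k`!%:R `^ r) * c ^+ k).
Proof.
apply/funext => v; rewrite /sym_norm /symW.
under eq_bigr do rewrite proj_power_sym_part /wnorm mulr_sumr.
rewrite exchange_big; apply: eq_big_seq => m mv /=.
have mk : (mdeg m < mmeasure (@mdeg 'I_n) v)%N by apply: msize_mdeg_lt.
rewrite (bigD1 (Ordinal mk)) //= eqxx mulr1 [X in _ + X]big1 ?addr0 1?mulrC //.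
by move=> k; rewrite -val_eqE /= eq_sym => /negPf ->; rewrite !mulr0.
Qed.

End Words.

(* Comparing distinct products in the monoid algebras by conversion is costly,
   so ring identities are proved for abstract rings. *)
Lemma mulr_assoc5 (A : pzRingType) (s a b u v : A) :
  s * (a * b * u) * v = (s * a) * b * (u * v).
Proof. by rewrite !mulrA. Qed.

Lemma commutator_expand (A : pzRingType) (a x y k b : A) :
  a * (x * y - y * x - k) * b = a * (x * (y * b)) - a * (y * (x * b)) - a * (k * b).
Proof. by rewrite !mulrBr !mulrBl !mulrA. Qed.

(** * Injectivity of the symmetrization into the enveloping algebra *)

Section LieWords.
Context {R : realType} {n : nat} {G : lieGroup R n} (F : frame G).
Let C := cplx R.
Implicit Types (f : G -> R) (g : G) (s : seq 'rV[R]_n) (w : seq 'I_n).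

Definition lieRs s f : G -> R := foldr (lieR F) f s.

Lemma lieRs_cat s s' f : lieRs (s ++ s') f = lieRs s (lieRs s' f).
Proof. exact: foldr_cat. Qed.

Lemma analytic_germ_lieRs s f g : analytic_germ f g -> analytic_germ (lieRs s f) g.
Proof. by move=> af; elim: s => //= xi s IH; exact: analytic_germ_lieR. Qed.

Lemma lieRs_near s f f' g : (\forall h \near g, f h = f' h) ->
  \forall h \near g, lieRs s f h = lieRs s f' h.
Proof. by move=> ff'; elim: s => //= xi s IH; exact: lieR_near. Qed.

Lemma lieRs_ext s f f' g : (\forall h \near g, f h = f' h) -> lieRs s f g = lieRs s f' g.
Proof. by move=> /(lieRs_near s) /nbhs_singleton. Qed.

Lemma lieRs_lin s (a : R) f f' g : analytic_germ f g -> analytic_germ f' g ->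
  lieRs s (fun x => a * f x + f' x) g = a * lieRs s f g + lieRs s f' g.
Proof.
move=> af af'; suff : \forall h \near g, lieRs s (fun x => a * f x + f' x) h =
    a * lieRs s f h + lieRs s f' h by exact: nbhs_singleton.
elim: s => [|xi s IH] /=; first exact: nearW.
have := near_join IH; apply: filterS3 (analytic_germ_near af) (analytic_germ_near af')
  => h ah a'h IHh.
have as_ := analytic_germ_lieRs s ah; have as' := analytic_germ_lieRs s a'h.
by rewrite (lieR_ext F xi IHh) lieRD ?lieRZ //; exact: analytic_germZ.
Qed.

Lemma lieRs_cst0 s g : lieRs s (fun=> 0) g = 0.
Proof.
suff -> : lieRs s (fun=> 0) = fun=> 0 by [].
by elim: s => //= xi s ->; apply/funext => h; exact: lieR_cst.
Qed.

Lemma lieRs_sum s (T : Type) (r : seq T) (a : T -> R) (f : T -> G -> R) g :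
  (forall t, analytic_germ (f t) g) ->
  lieRs s (fun x => \sum_(t <- r) a t * f t x) g = \sum_(t <- r) a t * lieRs s (f t) g.
Proof.
move=> af; elim: r => [|t r IH].
  rewrite big_nil -[RHS](lieRs_cst0 s g); congr (lieRs s _ g).
  by apply/funext => x; rewrite big_nil.
rewrite big_cons -IH -lieRs_lin //; last first.
  by apply: analytic_germ_sum => t'; exact: analytic_germZ.
by congr (lieRs s _ g); apply/funext => x; rewrite big_cons.
Qed.

Lemma lieRsD s f f' g : analytic_germ f g -> analytic_germ f' g ->
  lieRs s (fun x => f x + f' x) g = lieRs s f g + lieRs s f' g.
Proof.
move=> af af'; rewrite -[X in X + _]mul1r -lieRs_lin //.
by congr (lieRs s _ g); apply/funext => x; rewrite mul1r.
Qed.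

Let bvec w := map (@basis_vec R n) w.

(* the action of T(g) by left-invariant differential operators *)
Definition tact f g (t : tensAlg R n) : C :=
  lext (fun w : fmonom 'I_n => creal (lieRs (bvec (fmonom_val w)) f g) : C^o) t.

Lemma tact_tword f g w : tact f g (tword w) = creal (lieRs (bvec w) f g).
Proof. by rewrite /tact lextU; exact: mul1r. Qed.

Lemma tactD f g (s t : tensAlg R n) : tact f g (s + t) = tact f g s + tact f g t.
Proof. exact: lextD. Qed.

Lemma tactZ f g (c : C) (t : tensAlg R n) : tact f g (c *: t) = c * tact f g t.
Proof. exact: lextZ. Qed.

Lemma tact_sum f g (I : Type) (r : seq I) (P : pred I) (t : I -> tensAlg R n) :
  tact f g (\sum_(i <- r | P i) t i) = \sum_(i <- r | P i) tact f g (t i).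
Proof. exact: lext_sum. Qed.

Lemma tactB f g (s t : tensAlg R n) : tact f g (s - t) = tact f g s - tact f g t.
Proof. exact: (linearB (lext _)). Qed.

Lemma tact0 f g : tact f g 0 = 0.
Proof. by rewrite /tact /lext msupp0 big_seq_fset0. Qed.

(** Each vector is expanded in the basis and its letters are appended to the word on the left, so
    the induction over [s] needs [w] arbitrary. *)
Lemma tact_tensVecs f g w s : analytic_germ f g ->
  tact f g (tword w * \prod_(xi <- s) tensVec (cvec xi)) =
  creal (lieRs (bvec w) (lieRs s f) g).
Proof.
move=> af; elim: s w => [|xi s IH] w; first by rewrite big_nil mulr1 tact_tword.
set P := \prod_(xi <- s) _ in IH.
have -> : tword w * \prod_(xi <- xi :: s) tensVec (cvec xi) =
    \sum_i creal (xi 0 i) *: (tword (w ++ [:: i]) * P).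
  rewrite big_cons -/P mulrA [tensVec _](_ : _ = \sum_i creal (xi 0 i) *: tword [:: i]).
    rewrite mulr_sumr mulr_suml; apply: eq_bigr => i _.
    by rewrite -tscaleAr -tscaleAl tword_cat.
  by apply: eq_bigr => i _; rewrite mkmalgU_scale mxE /tword -fmuE.
rewrite tact_sum.
rewrite (eq_bigr (fun i => creal (xi 0 i * lieRs (bvec w) (lieR F (basis_vec i) (lieRs s f)) g))).
  rewrite -creal_sum -lieRs_sum; last first.
    by move=> i; apply: analytic_germ_lieR; exact: analytic_germ_lieRs.
  congr creal; apply: lieRs_ext; have := analytic_germ_near (analytic_germ_lieRs s af).
  by apply: filterS => h ah; rewrite /= [RHS]lieR_lin.
move=> i _; rewrite tactZ IH /bvec map_cat lieRs_cat.
by rewrite /creal rmorphM.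
Qed.

Lemma env_ideal_tact f g t : env_ideal F t -> analytic_germ f g -> tact f g t = 0.
Proof.
(* The built-in left and right factors make [J] a two-sided ideal at once; what remains is that it
   contains the generators. *)
move=> tJ af; pose J : set (tensAlg R n) := [set t | forall (s u : tensAlg R n) f g, analytic_germ f g ->
  tact f g (s * t * u) = 0].
suff : J t by move=> /(_ 1 1 f g af); rewrite mul1r mulr1.
apply: tJ; first split.
- by move=> s u f' g' _; rewrite mulr0 mul0r tact0.
- move=> a b Ja Jb s u f' g' af'; rewrite mulrDr mulrDl tactD.
  by rewrite [X in X + _](Ja s u f' g' af') [X in _ + X](Jb s u f' g' af') addr0.
- move=> a b u Jb s' u' f' g' af'.
  rewrite mulr_assoc5.
  exact: (Jb (s' * a) (u * u') f' g' af').
move=> xi eta iota s u f' g' af' {t f g af}.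
set X := (_ - _)%R.
(* By bilinearity it is enough to have words on both sides, where the generator acts on an analytic
   germ as a commutator of left-invariant fields minus the field of the bracket. *)
have words (a b : seq 'I_n) : tact f' g' (tword a * X * tword b) = 0.
  have bE : tword b = \prod_(x <- bvec b) tensVec (cvec x) :> tensAlg R n.
    rewrite /bvec big_map -[in LHS](map_id b) -tword_prod.
    by apply: eq_bigr => i _; rewrite tensVecE.
  have T2 x y : tact f' g' (tword a * (iota x * (iota y * tword b))) =
      creal (lieRs (bvec a) (lieRs [:: x, y & bvec b] f') g').
    by rewrite -tact_tensVecs; [rewrite 2!big_cons -bE|].
  have T1 x : tact f' g' (tword a * (iota x * tword b)) =
      creal (lieRs (bvec a) (lieRs (x :: bvec b) f') g').
    by rewrite -tact_tensVecs; [rewrite big_cons -bE|].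
  rewrite /X commutator_expand tactB tactB.
  rewrite [X in X - _ - _]T2 [X in _ - X - _]T2 [X in _ - _ - X]T1.
  set fb := lieRs (bvec b) f'.
  have afb : analytic_germ fb g' by exact: analytic_germ_lieRs.
  have afxe := analytic_germ_lieR F xi (analytic_germ_lieR F eta afb).
  have afex := analytic_germ_lieR F eta (analytic_germ_lieR F xi afb).
  have E1 : lieRs (bvec a) (lieR F xi (lieR F eta fb)) g' =
      lieRs (bvec a) (lieR F eta (lieR F xi fb)) g' +
      lieRs (bvec a) (lieR F (bracket F xi eta) fb) g'.
    transitivity (lieRs (bvec a) (fun x => lieR F eta (lieR F xi fb) x +
        lieR F (bracket F xi eta) fb x) g'); last first.
      by apply: lieRsD; [exact: afex|exact: analytic_germ_lieR].
    apply: lieRs_ext; apply: filterS (analytic_germ_near afb) => h ah.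
    by rewrite -(lieR_comm F xi eta ah) addrC subrK.
  change (creal (lieRs (bvec a) (lieR F xi (lieR F eta fb)) g') -
    creal (lieRs (bvec a) (lieR F eta (lieR F xi fb)) g') -
    creal (lieRs (bvec a) (lieR F (bracket F xi eta) fb) g') = 0 :> C).
  rewrite [X in creal X - _ - _]E1.
  move: (lieRs _ _ _) (lieRs _ _ _) => p q.
  by rewrite /creal rmorphD addrAC addrK subrr.
rewrite -mulrA tens_mull /lext tact_sum; apply: big1 => a _.
rewrite tactZ mulrA tens_mulr /lext tact_sum big1 ?mulr0 // => b _.
by rewrite tactZ words mulr0.
Qed.

End LieWords.

(** * Order of vanishing at the unit and the pairing of words with monomials *)

Section PBW.
Context {R : realType} {n : nat} {G : lieGroup R n} (F : frame G).
Let C := cplx R.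
Implicit Types (f : G -> R) (w u : seq 'I_n).

Let bvec w := map (@basis_vec R n) w.
Let L w f : R := lieRs F (bvec w) f 1%g.
Let c0 := fr_chart F.

(** The order of vanishing at the unit, measured by left-invariant rather than coordinate
    derivatives. *)
Definition vanish k f : Prop :=
  analytic_germ f 1%g /\ forall w, (size w < k)%N -> L w f = 0.

Lemma L_rcons w i f : L (rcons w i) f = L w (lieR F (basis_vec i) f).
Proof. by rewrite /L /bvec map_rcons -cats1 lieRs_cat. Qed.

Lemma L_near w f f' : (\forall h \near (1%g : G), f h = f' h) -> L w f = L w f'.
Proof. exact: lieRs_ext. Qed.

Lemma vanish_lie k i f : vanish k f -> vanish k.-1 (lieR F (basis_vec i) f).
Proof.
move=> [af H]; split; first exact: analytic_germ_lieR.
by move=> w wk; rewrite -L_rcons; apply: H; rewrite size_rcons; case: k wk.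
Qed.

Lemma vanishD k f f' : vanish k f -> vanish k f' -> vanish k (fun x => f x + f' x).
Proof.
move=> [af H] [af' H']; split; first exact: analytic_germD.
by move=> w wk; rewrite /L lieRsD // -!/(L _ _) H // H' // addr0.
Qed.

Lemma lieRM_near xi f f' : analytic_germ f 1%g -> analytic_germ f' 1%g ->
  \forall h \near (1%g : G), lieR F xi (fun x => f x * f' x) h =
    lieR F xi f h * f' h + f h * lieR F xi f' h.
Proof.
by move=> af af'; apply: filterS2 (analytic_germ_near af) (analytic_germ_near af') => h;
  exact: lieRM.
Qed.

(** The Leibniz rule is applied to the innermost letter: in each summand one of the two orders drops
    by at most one, and the remaining word is shorter by one. *)
Lemma vanishM k l f f' : vanish k f -> vanish l f' -> vanish (k + l) (fun x => f x * f' x).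
Proof.
move=> vf vf'; split; first by apply: analytic_germM; [case: vf|case: vf'].
suff H w : forall k l f f', vanish k f -> vanish l f' -> (size w < k + l)%N ->
    L w (fun x => f x * f' x) = 0 by move=> w; exact: H.
elim/last_ind: w {k l f f' vf vf'} => [|w i IH] k l f f' [af H] [af' H'] /=.
  rewrite addn_gt0 => /orP[k0|l0]; rewrite /L /=.
    by have := H [::] k0; rewrite /L /= => ->; rewrite mul0r.
  by have := H' [::] l0; rewrite /L /= => ->; rewrite mulr0.
rewrite size_rcons => wkl; rewrite L_rcons (L_near w (lieRM_near (basis_vec i) af af')).
have vi := vanish_lie i (conj af H); have vi' := vanish_lie i (conj af' H').
rewrite /L lieRsD; last 2 first.
- by apply: analytic_germM => //; exact: analytic_germ_lieR.
- by apply: analytic_germM => //; exact: analytic_germ_lieR.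
rewrite -/(L w (fun x => lieR F (basis_vec i) f x * f' x)).
rewrite -/(L w (fun x => f x * lieR F (basis_vec i) f' x)).
have wkl1 : (size w < k.-1 + l)%N by move: wkl; clear; lia.
have wkl2 : (size w < k + l.-1)%N by move: wkl; clear; lia.
have e1 := IH k.-1 l _ _ vi (conj af' H') wkl1.
have e2 := IH k l.-1 _ _ (conj af H) vi' wkl2.
by rewrite [X in X + _]e1 [X in _ + X]e2 addr0.
Qed.

(* coordinates at the unit whose differentials are dual to the basis *)
Definition dual_coord (j : 'I_n) : G -> R := fun g =>
  \sum_l invmx (fr_basis F) l j * (chart_fun c0 g 0 l + - chart_fun c0 1%g 0 l).

Lemma dual_coord_germ j : analytic_germ (dual_coord j) 1%g.
Proof.
apply: analytic_germ_sum => l; apply: analytic_germZ; apply: analytic_germD.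
  exact: analytic_germ_coord (fr_chart_atlas F) (fr_chart_unit F).
exact: analytic_germ_cst.
Qed.

Lemma dual_coord1 j : dual_coord j 1%g = 0.
Proof. by rewrite /dual_coord big1 // => l _; rewrite subrr mulr0. Qed.

Lemma lieR_dual_coord i j : lieR F (basis_vec i) (dual_coord j) 1%g = (i == j)%:R.
Proof.
have aco l := analytic_germ_coord l (fr_chart_atlas F) (fr_chart_unit F).
have acst l := analytic_germ_cst (- chart_fun c0 1%g 0 l) (1%g : G).
rewrite /dual_coord lieR_sum; last by move=> l; apply: analytic_germZ; exact: analytic_germD.
rewrite (eq_bigr (fun l => fr_basis F i l * invmx (fr_basis F) l j)).
  transitivity ((fr_basis F *m invmx (fr_basis F)) i j); first by rewrite mxE.
  by rewrite mulmxV ?fr_basis_unit // mxE.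
move=> l _; rewrite lieRZ; last exact: analytic_germD.
by rewrite lieRD // lieR_cst addr0 lieR_coord -rowE mxE mulrC.
Qed.

Lemma vanish_dual_coord j : vanish 1 (dual_coord j).
Proof.
split; first exact: dual_coord_germ.
by case=> // _; exact: dual_coord1.
Qed.

Definition dual_mon u : G -> R := fun x => \prod_(j <- u) dual_coord j x.

Lemma dual_mon_cons j u : dual_mon (j :: u) = fun x => dual_coord j x * dual_mon u x.
Proof. by apply/funext => x; rewrite /dual_mon big_cons. Qed.

Lemma dual_mon_perm u u' : perm_eq u u' -> dual_mon u = dual_mon u'.
Proof. by move=> uu; apply/funext => x; exact: perm_big. Qed.

Lemma vanish_dual_mon u : vanish (size u) (dual_mon u).
Proof.
elim: u => [|j u IH]; last first.
  by rewrite dual_mon_cons /= -add1n; apply: vanishM => //; exact: vanish_dual_coord.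
split => //; rewrite (_ : dual_mon [::] = fun=> 1); first exact: analytic_germ_cst.
by apply/funext => x; rewrite /dual_mon big_nil.
Qed.

(** The derivative of the j-th coordinate along e_i is delta_ij up to a function vanishing at the
    unit. So, up to order [size u], it acts on monomials like the partial derivative of
    polynomials. *)
Lemma lie_dual_mon i u : exists2 s, vanish (size u) s &
  \forall x \near (1%g : G), lieR F (basis_vec i) (dual_mon u) x =
    (count_mem i u)%:R * dual_mon (rem i u) x + s x.
Proof.
elim: u => [|j u [s vs IH]].
  exists (fun=> 0); first by split => //; exact: analytic_germ_cst.
  apply: nearW => x; rewrite mul0r add0r (_ : dual_mon [::] = fun=> 1) ?lieR_cst //.
  by apply/funext => y; rewrite /dual_mon big_nil.
have [vu _] := vanish_dual_mon u.
pose r x := lieR F (basis_vec i) (dual_coord j) x - (i == j)%:R.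
have vr : vanish 1 r.
  split; last by case=> // _; rewrite /L /r /= lieR_dual_coord subrr.
  apply: analytic_germD; last exact: analytic_germ_cst.
  by apply: analytic_germ_lieR; exact: dual_coord_germ.
exists (fun x => r x * dual_mon u x + dual_coord j x * s x).
  by rewrite /= -add1n; apply: vanishD; apply: vanishM => //;
    [exact: vanish_dual_mon|exact: vanish_dual_coord].
rewrite dual_mon_cons.
apply: filterS2 IH (lieRM_near (basis_vec i) (dual_coord_germ j) vu) => x E ->.
rewrite E /=.
have E2 : lieR F (basis_vec i) (dual_coord j) x = r x + (i == j)%:R by rewrite /r subrK.
rewrite E2; case: (eqVneq j i) => [ji|ji] /=.
  subst j; rewrite /= natrD.
  have [iu|iu] := boolP (i \in u).
    have := dual_mon_perm (perm_to_rem iu); rewrite dual_mon_cons => /(congr1 (@^~ x)) ->.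
    ring.
  by rewrite (count_memPn iu); ring.
by rewrite dual_mon_cons add0n; ring.
Qed.

(** Each letter removes one equal letter of [u] with its multiplicity, while the remainder vanishes
    to an order beyond the length of the remaining word. Positivity is recorded because it excludes
    cancellation in sums over permutations. *)
Lemma dual_pairing w u : size w = size u ->
  if perm_eq w u then is_true (0 < L w (dual_mon u)) else L w (dual_mon u) = 0.
Proof.
elim/last_ind: w u => [|w i IH] u.
  by case: u => // _; rewrite /L /dual_mon /= big_nil.
rewrite size_rcons => su.
have [s vs E] := lie_dual_mon i u.
have [_ su0] := vs; have [as_ _] := vs.
have LE : L (rcons w i) (dual_mon u) = (count_mem i u)%:R * L w (dual_mon (rem i u)).
  rewrite L_rcons (L_near w E) /L lieRs_lin //; last by case: (vanish_dual_mon (rem i u)).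
  by rewrite -/(L w s) su0 ?addr0 // -su.
rewrite LE; have [iu|iu] := boolP (i \in u).
  have sr : size w = size (rem i u) by rewrite size_rem // -su.
  have pE : perm_eq (rcons w i) u = perm_eq w (rem i u).
    by rewrite perm_rcons (permPr (perm_to_rem iu)) perm_cons.
  have cnt0 : 0 < (count_mem i u)%:R :> R by rewrite ltr0n -has_count has_pred1.
  have := IH _ sr; rewrite pE; case: ifP => _; first exact: mulr_gt0.
  by move=> ->; rewrite mulr0.
rewrite (count_memPn iu) mul0r ifN //; apply: contra iu => /perm_mem <-.
by rewrite mem_rcons mem_head.
Qed.

(** Shorter words pair to zero by the order of vanishing. Among words of equal length only
    rearrangements of [u] survive, and these contribute positive numbers. *)
Lemma tact_symmetrize w u : (size w <= size u)%N ->
  if perm_eq w u then is_true (tact F (dual_mon u) 1%g (symmetrize_word R w) != 0)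
  else tact F (dual_mon u) 1%g (symmetrize_word R w) = 0.
Proof.
move=> wu; rewrite -[X in symmetrize_word R X]/(val (in_tuple w)) symmetrize_tuple /symfun.
rewrite tactZ tact_sum.
pose ws (s : 'S_(size w)) := [seq tnth (in_tuple w) (s j) | j <- enum 'I_(size w)].
have pw s : perm_eq (ws s) w by apply/(@tuple_permP _ _ _ (in_tuple w)); exists s.
rewrite (eq_bigr (fun s => creal (L (ws s) (dual_mon u)))); last first.
  by move=> s _; rewrite tact_tword.
rewrite -creal_sum.
have w0 : ((size w)`!)%:R != 0 :> C by rewrite pnatr_eq0 -lt0n fact_gt0.
case: ifP => pwu.
  rewrite mulf_neq0 ?invr_eq0 //.
  have Lpos s : 0 < L (ws s) (dual_mon u).
    have := @dual_pairing (ws s) u; rewrite (perm_trans (pw s) pwu); apply.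
    by rewrite (perm_size (pw s)) (perm_size pwu).
  have : 0 < \sum_s L (ws s) (dual_mon u).
    rewrite (bigD1 (1%g : 'S_(size w))) //=; apply: ltr_pwDl => //.
    by apply: sumr_ge0 => s _; exact: ltW.
  move: (\sum_s _) => x x0; apply/eqP => /(congr1 cre) /= xe.
  by move: x0; rewrite xe ltxx.
rewrite (_ : \sum_s _ = 0) ?mulr0 //. 
apply: big1 => s _; have sw := perm_size (pw s).
case: (ltngtP (size w) (size u)) wu => // wu _.
  by have [_] := vanish_dual_mon u; apply; rewrite sw.
have := @dual_pairing (ws s) u; rewrite (permPl (pw s)) pwu; apply.
by rewrite sw.
Qed.

Lemma quantize_inj (z : C) (v : symAlg R n) : z != 0 -> env_ideal F (quantize z v) -> v = 0.
Proof.
move=> z0 qv; apply/eqP; apply/negPn/negP => v0.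
(* With a monomial of maximal degree, the pairing with its dual monomial annihilates every other
   term of [v]. *)
have [m0 m0v mmax] : exists2 m0, m0 \in msupp v & forall m, m \in msupp v ->
    (mdeg m <= mdeg m0)%N.
  have : finmap.enum_fset (msupp v) != [::].
    apply: contraNneq v0 => e; rewrite -msupp_eq0; apply/eqP/fsetP => m.
    by rewrite -[m \in msupp v]/(m \in finmap.enum_fset (msupp v)) e.
  rewrite -[msupp v in X in _ -> X]/(msupp v).
  have H (s : seq (cmonom 'I_n)) : s != [::] ->
      exists2 m0, m0 \in s & forall m, m \in s -> (mdeg m <= mdeg m0)%N.
    elim: s => // m s IH _; case: (eqVneq s [::]) => [->|/IH [m1 m1s max1]].
      by exists m; rewrite ?mem_head // => m'; rewrite inE => /eqP ->.
    case: (leqP (mdeg m) (mdeg m1)) => mm.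
      exists m1; first by rewrite inE m1s orbT.
      by move=> m'; rewrite inE => /orP[/eqP ->|/max1].
    exists m; first by rewrite mem_head.
    move=> m'; rewrite inE => /orP[/eqP -> //|/max1 m'1].
    by rewrite (leq_trans m'1) // ltnW.
  exact: H.
pose u := cmonom_word m0.
have [af _] := vanish_dual_mon u.
have := env_ideal_tact qv af; rewrite quantizeE /lext tact_sum.
rewrite (big_fsetD1 m0) //= big1_fset ?addr0; last first.
  move=> m; rewrite in_fsetD1 => /andP[mm0 mv] _.
  have su : (size (cmonom_word m) <= size u)%N by rewrite !size_cmonom_word mmax.
  rewrite 2!tactZ; have := tact_symmetrize su; rewrite ifN => [->|]; first by rewrite !mulr0.
  by apply: contra mm0 => /cword_perm; rewrite !cword_monom => ->.
rewrite 2!tactZ => /eqP; rewrite !mulf_eq0 expf_eq0 (negPf z0) andbF /=.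
have := @tact_symmetrize u u (leqnn _); rewrite perm_refl => /negPf ->.
by rewrite orbF mcoeff_eq0 m0v.
Qed.

End PBW.

(** * Estimates for the Gutt star product *)

Section PermSums.

(** Permutations of k+1 points are enumerated by the image of a fixed point [i]; the variant
    [lift_perm_inj2] enumerates them by the preimage of [j]. *)
Lemma lift_perm_inj1 k (i : 'I_k.+1) :
  injective (fun p : 'I_k.+1 * 'S_k => lift_perm i p.1 p.2).
Proof.
move=> [j s] [j' s'] /= e.
have jj : j = j' by rewrite -(lift_perm_id i j s) e lift_perm_id.
subst j'; congr (_, _); apply/permP => l; apply: (@lift_inj _ j).
by rewrite -!(lift_perm_lift i) e.
Qed.

Lemma lift_perm_inj2 k (j : 'I_k.+1) :
  injective (fun p : 'I_k.+1 * 'S_k => lift_perm p.1 j p.2).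
Proof.
move=> [i s] [i' s'] /= e.
have ii : i = i' by apply: (@perm_inj _ (lift_perm i j s)); rewrite {2}e !lift_perm_id.
by subst i'; have [] := @lift_perm_inj1 _ i (j, s) (j, s') e => ->.
Qed.

(** An injective parametrization is bijective here because both sides have (k+1)! elements. *)
Lemma sum_lift_perm k (V : nmodType) (phi : 'S_k.+1 -> V)
    (h : 'I_k.+1 * 'S_k -> 'S_k.+1) : injective h ->
  \sum_s phi s = \sum_a \sum_s phi (h (a, s)).
Proof.
move=> hi; rewrite pair_big /= (reindex h) /=; first by apply: eq_bigr => -[].
apply: onW_bij; apply: inj_card_bij => //.
by rewrite card_prod !card_Sn card_ord factS.
Qed.

Definition pword (T : Type) k (u : 'I_k -> T) (s : 'S_k) : seq T :=
  [seq u (s j) | j <- enum 'I_k].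

Lemma size_pword (T : Type) k (u : 'I_k -> T) s : size (pword u s) = k.
Proof. by rewrite size_map size_enum_ord. Qed.

Lemma nth_pword (T : Type) x0 k (u : 'I_k -> T) s (l : 'I_k) :
  nth x0 (pword u s) l = u (s l).
Proof. by rewrite (nth_map l) ?size_enum_ord // nth_ord_enum. Qed.

(** Orderings of k+1 letters are orderings of k letters with one letter inserted; this turns sums
    over permutations into sums over insertions. *)
Lemma pword_lift (T : Type) k (u : 'I_k.+1 -> T) (i j : 'I_k.+1) (s : 'S_k) :
  let w := pword (u \o lift j) s in
  pword u (lift_perm i j s) = take i w ++ u j :: drop i w.
Proof.
move=> w; have sw : size w = k by exact: size_pword.
have ik : (i <= k)%N by rewrite -ltnS.
have st : size (take i w) = i by rewrite size_take sw; case: ltngtP ik => // ->.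
apply: (@eq_from_nth _ (u j)).
  by rewrite size_pword size_cat /= st size_drop sw addnS subnKC.
move=> l; rewrite size_pword => lk; rewrite -[l]/(val (Ordinal lk)) nth_pword nth_cat st /=.
case: (unliftP i (Ordinal lk)) => [l' el|el].
  rewrite el lift_perm_lift; have lE : l = bump i l' by have := congr1 val el.
  rewrite -[u (lift j (s l'))]/((u \o lift j) (s l')) -(nth_pword (u j) _ s) -/w.
  case: (leqP i l') => il; rewrite lE /bump.
    by rewrite il add1n ltnNge leqW //= subSn //= nth_drop subnKC.
  by rewrite (leqNgt i) il add0n il nth_take.
rewrite el lift_perm_id; have -> : l = i by have := congr1 val el.
by rewrite ltnn subnn.
Qed.

End PermSums.

Lemma sumr_norm_ge0 (R : realType) (I : Type) (s : seq I) (f : I -> R) :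
  0 <= \sum_(i <- s) `|f i|.
Proof. exact: sumr_ge0. Qed.

Lemma term_le_sum2 (R : realType) (I J : finType) (f : I -> J -> R) i j :
  (forall i j, 0 <= f i j) -> f i j <= \sum_i \sum_j f i j.
Proof.
move=> f0; rewrite (bigD1 i) //= (bigD1 j) //= -addrA lerDl.
by apply: addr_ge0; do ?[apply: sumr_ge0 => ? _].
Qed.

Section EnvelopingIdeal.
Context {R : realType} {n : nat} {G : lieGroup R n} (F : frame G).
Let C := cplx R.
Implicit Types (z : C) (w : seq 'I_n).
Implicit Types (t : tensAlg R n) (v : symAlg R n).

Lemma env_ideal0 : env_ideal F 0.
Proof. by move=> J [J0 _ _] _. Qed.

Lemma env_idealD t t' : env_ideal F t -> env_ideal F t' -> env_ideal F (t + t').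
Proof.
move=> It It' J HJ gen; have [_ JD _] := HJ.
by apply: JD; [exact: It|exact: It'].
Qed.

Lemma env_idealM s t t' : env_ideal F t -> env_ideal F (s * t * t').
Proof.
move=> It J HJ gen; have [_ _ JM] := HJ.
by apply: JM; exact: It.
Qed.

Lemma env_idealZ (a : C) t : env_ideal F t -> env_ideal F (a *: t).
Proof.
by move=> It; have := @env_idealM (a *: 1) t 1 It; rewrite mulr1 -tscaleAl mul1r.
Qed.

Lemma env_idealN t : env_ideal F t -> env_ideal F (- t).
Proof. by rewrite -scaleN1r; exact: env_idealZ. Qed.

Lemma env_ideal_sum (I : Type) (s : seq I) (P : pred I) (t : I -> tensAlg R n) :
  (forall i, P i -> env_ideal F (t i)) -> env_ideal F (\sum_(i <- s | P i) t i).
Proof.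
move=> H; elim/big_rec: _ => [|i t' Pi It']; first exact: env_ideal0.
by apply: env_idealD It'; exact: H.
Qed.

Definition struct_const (i j b : 'I_n) : R :=
  bracket F (basis_vec i) (basis_vec j) 0 b.

Definition struct_bound : R := \sum_i \sum_j \sum_b `|struct_const i j b|.

Lemma struct_bound_ge i j : \sum_b `|struct_const i j b| <= struct_bound.
Proof. by apply: (@term_le_sum2 R _ _ (fun i j => \sum_b `|struct_const i j b|)) => i' j'; exact: sumr_norm_ge0. Qed.

Lemma struct_bound_ge0 : 0 <= struct_bound.
Proof. by apply: sumr_ge0 => i _; apply: sumr_ge0 => j _; exact: sumr_norm_ge0. Qed.

Lemma env_swap a b i j :
  env_ideal F (tword (a ++ [:: i, j & b]) - tword (a ++ [:: j, i & b]) -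
    \sum_l creal (struct_const i j l) *: tword (a ++ l :: b)).
Proof.
have split1 x : tword (a ++ x :: b) = tword a * (tword [:: x] * tword b) :> tensAlg R n.
  exact: etrans (tword_cat a (x :: b)) (congr1 _ (tword_cat [:: x] b)).
have split2 x y : tword (a ++ [:: x, y & b]) = tword a * (tword [:: x] * (tword [:: y] * tword b))
    :> tensAlg R n.
  exact: etrans (tword_cat a [:: x, y & b]) (congr1 _ (etrans (tword_cat [:: x] (y :: b))
    (congr1 _ (tword_cat [:: y] b)))).
pose k : tensAlg R n := tensVec (cvec (bracket F (basis_vec i) (basis_vec j))).
have kE : \sum_l creal (struct_const i j l) *: tword (a ++ l :: b) = tword a * (k * tword b).
  rewrite /k /tensVec mulr_suml mulr_sumr; apply: eq_bigr => l _.
  rewrite split1 mxE mkmalgU_scale -/(tword _) fmuE.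
  by rewrite -tscaleAl -tscaleAr.
rewrite kE (split2 i j) (split2 j i) -commutator_expand; apply: env_idealM.
move=> J _ gen; rewrite -(tensVecE i) -(tensVecE j).
exact: (gen (basis_vec i) (basis_vec j)).
Qed.

Section Reordering.
Variable z : C.

(* weights whose growth absorbs the constants of one reordering step *)
Definition adm_weight (W : nat -> R) : Prop :=
  (forall k, 0 <= W k) /\
  forall k, 2 * (cabs z * struct_bound) * k%:R * W k <= W k.+1.

(** One representative modulo the ideal is bounded for all admissible weights simultaneously: when
    further letters are multiplied from the left, the same representative is measured again with a
    shifted weight. *)
Definition rep_bound t (beta : (nat -> R) -> R) : Prop :=
  exists v, env_ideal F (quantize z v - t) /\
    forall W, adm_weight W -> symW W v <= beta W.

Lemma rep_bound_le t beta beta' : (forall W, adm_weight W -> beta W <= beta' W) ->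
  rep_bound t beta -> rep_bound t beta'.
Proof.
by move=> H [v [Iv Hv]]; exists v; split => // W aW; apply: le_trans (H _ aW); exact: Hv.
Qed.

Lemma rep_bound_congr t t' beta : env_ideal F (t - t') -> rep_bound t beta -> rep_bound t' beta.
Proof.
move=> It [v [Iv Hv]]; exists v; split => //.
rewrite -[X in X - _](subrK t) -addrA; exact: env_idealD.
Qed.

Lemma rep_bound0 : rep_bound 0 (fun=> 0).
Proof.
exists 0; split=> [|W _]; last by rewrite /symW wnorm0.
rewrite subr0 (_ : quantize z 0 = 0); first exact: env_ideal0.
by rewrite -(scale0r 0) quantizeZ scale0r.
Qed.

Lemma rep_boundD t t' beta beta' : rep_bound t beta -> rep_bound t' beta' ->
  rep_bound (t + t') (fun W => beta W + beta' W).
Proof.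
move=> [v [Iv Hv]] [v' [Iv' Hv']]; exists (v + v'); split=> [|W aW].
  by rewrite quantizeD opprD addrACA; exact: env_idealD.
apply: le_trans (wnormD _ _ _) _; first by move=> m; case: aW.
by apply: lerD; [exact: Hv|exact: Hv'].
Qed.

Lemma rep_boundZ (a : C) t beta : rep_bound t beta ->
  rep_bound (a *: t) (fun W => cabs a * beta W).
Proof.
move=> [v [Iv Hv]]; exists (a *: v); split=> [|W aW].
  by rewrite quantizeZ -scalerBr; exact: env_idealZ.
by rewrite /symW wnormZ ler_wpM2l ?cabs_ge0 //; exact: Hv.
Qed.

Lemma rep_bound_sum (I : Type) (s : seq I) (t : I -> tensAlg R n) (beta : I -> (nat -> R) -> R) :
  (forall i, rep_bound (t i) (beta i)) ->
  rep_bound (\sum_(i <- s) t i) (fun W => \sum_(i <- s) beta i W).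
Proof.
move=> H; elim: s => [|i s IH].
  rewrite big_nil; apply: rep_bound_le rep_bound0 => W _; by rewrite big_nil.
rewrite big_cons; apply: rep_bound_le (rep_boundD (H i) IH) => W _.
by rewrite big_cons.
Qed.

(* sum over the orderings of u_0 ... u_(k-1), with x inserted at position i *)
Definition insert_sum k i (x : 'I_n) (u : 'I_k -> 'I_n) : tensAlg R n :=
  \sum_(s : 'S_k) tword (take i (pword u s) ++ x :: drop i (pword u s)).

(** The sum over permutations is split according to the letter [u j] at position [i]. Moving [x]
    past it leaves a commutator, in which the pair is replaced by a single letter [b]. *)
Lemma insert_step k (i : 'I_k.+1) x (u : 'I_k.+1 -> 'I_n) :
  env_ideal F (insert_sum i x u - insert_sum i.+1 x u -
    \sum_j \sum_b creal (struct_const x (u j) b) *: insert_sum i b (u \o lift j)).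
Proof.
rewrite /insert_sum !(@sum_lift_perm _ _ _ _ (@lift_perm_inj1 _ i)) -!sumrB.
apply: env_ideal_sum => j _ /=.
rewrite (eq_bigr (fun b => \sum_(s : 'S_k) creal (struct_const x (u j) b) *:
   tword (take i (pword (u \o lift j) s) ++ b :: drop i (pword (u \o lift j) s)))); last first.
  by move=> b _; rewrite scaler_sumr.
rewrite exchange_big -!sumrB; apply: env_ideal_sum => s _ /=.
rewrite pword_lift; set w := pword _ s.
have st : size (take i w) = i.
  have ik : (i <= k)%N by rewrite -ltnS.
  by rewrite size_take size_pword; case: ltngtP ik => // ->.
have -> : take i (take i w ++ u j :: drop i w) = take i w by rewrite -{1}st take_size_cat.
have -> : drop i (take i w ++ u j :: drop i w) = u j :: drop i w.
  by rewrite -{1}st drop_size_cat.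
have -> : take i.+1 (take i w ++ u j :: drop i w) = rcons (take i w) (u j).
  by rewrite -cat_rcons take_size_cat // size_rcons st.
have -> : drop i.+1 (take i w ++ u j :: drop i w) = drop i w.
  by rewrite -cat_rcons drop_size_cat // size_rcons st.
by rewrite cat_rcons; exact: env_swap.
Qed.

Definition ucons k (x : 'I_n) (u : 'I_k -> 'I_n) (l : 'I_k.+1) : 'I_n :=
  if unlift ord0 l is Some l' then u l' else x.

(** Inserting [x] at every position of every ordering produces each ordering of the enlarged family
    exactly once. *)
Lemma insert_sum_all k x (u : 'I_k -> 'I_n) :
  \sum_(i < k.+1) insert_sum i x u = (k.+1`!)%:R *: symfun (ucons x u).
Proof.
rewrite /symfun scalerA divff ?scale1r ?pnatr_eq0 -?lt0n ?fact_gt0 //.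
rewrite (@sum_lift_perm _ _ _ _ (@lift_perm_inj2 _ ord0)); apply: eq_bigr => i _.
apply: eq_bigr => s _ /=; rewrite -/(pword _ _) pword_lift /ucons unlift_none.
rewrite (_ : _ \o _ = u) //; apply/funext => l /=; by rewrite liftK.
Qed.

(** Normalized so that position 0 gives z x times the quantization of the product of the [u l]. *)
Let ins k i x u : tensAlg R n := (z ^+ k.+1 / (k`!)%:R) *: @insert_sum k i x u.

Lemma scaled_mean (V : lmodType C) N (t : V) (f : 'I_N.+1 -> V) :
  t = (N.+1%:R)^-1 *: \sum_i f i + \sum_i (N.+1%:R)^-1 *: (t - f i).
Proof.
rewrite -scaler_sumr -scalerDr sumrB addrC subrK sumr_const card_ord.
by rewrite -[t *+ _]scaler_nat scalerA mulVf ?scale1r // pnatr_eq0.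
Qed.

Lemma ins_mean k x (u : 'I_k -> 'I_n) :
  ((k.+1%:R)^-1 : C) *: \sum_(i < k.+1) ins i x u =
  quantize z (smon (cword [seq ucons x u l | l <- enum 'I_k.+1])).
Proof.
rewrite -scaler_sumr insert_sum_all 2!scalerA quantize_cword symmetrize_symfun.
rewrite size_map size_enum_ord; congr (_ *: _).
have k1 : k.+1%:R != 0 :> C by rewrite pnatr_eq0.
have k2 : (k`!)%:R != 0 :> C by rewrite pnatr_eq0 -lt0n fact_gt0.
rewrite factS natrM; move: k1 k2.
move: (k.+1%:R : C) ((k`!)%:R : C) (z ^+ k.+1) => a b c a0 b0.
by field; rewrite ?a0 ?b0.
Qed.

Lemma rep_bound_quantize_cword w :
  rep_bound (quantize z (smon (cword w))) (fun W => W (size w)).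
Proof.
exists (smon (cword w)); split=> [|W aW]; first by rewrite subrr; exact: env_ideal0.
by rewrite /symW wnormU cabs1 mul1r mdeg_cword.
Qed.

(** The normalizations for k+1 and k letters differ by z / (k+1), which compensates the k+1 choices
    of the letter passed. The structure constants contribute [struct_bound], and the factor 2 is
    that of the induction hypothesis. *)
Lemma rep_bound_ins_step k (i : 'I_k.+1) x (u : 'I_k.+1 -> 'I_n) :
  (forall i x (u : 'I_k -> 'I_n), (i <= k)%N -> rep_bound (ins i x u) (fun W => 2 * W k.+1)) ->
  rep_bound (ins i x u - ins i.+1 x u)
    (fun W => 2 * (cabs z * struct_bound) * W k.+1).
Proof.
move=> IH.
have H := env_idealN (env_idealZ (z ^+ k.+2 / (k.+1`!)%:R) (insert_step i x u)).
have k1 : k.+1%:R != 0 :> C by rewrite pnatr_eq0.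
have k2 : (k`!)%:R != 0 :> C by rewrite pnatr_eq0 -lt0n fact_gt0.
have E : (z ^+ k.+2 / (k.+1`!)%:R) *: (\sum_j \sum_b creal (struct_const x (u j) b) *:
      insert_sum i b (u \o lift j)) =
    \sum_j \sum_b (z * creal (struct_const x (u j) b) / k.+1%:R) *: ins i b (u \o lift j).
  rewrite scaler_sumr; apply: eq_bigr => j _; rewrite scaler_sumr; apply: eq_bigr => b _.
  rewrite /ins !scalerA; congr (_ *: _); rewrite factS natrM exprS.
  move: k1 k2 (creal _) => + + e.
  move: (k.+1%:R : C) ((k`!)%:R : C) (z ^+ k.+1) => a b' c a0 b0.
  by field; rewrite ?a0 ?b0.
rewrite scalerBr scalerBr opprB E in H.
apply: rep_bound_congr H _.
apply: rep_bound_le (rep_bound_sum _ (fun j => rep_bound_sum _ (fun b =>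
   rep_boundZ (z * creal (struct_const x (u j) b) / k.+1%:R)
     (IH i b (u \o lift j) (ltn_ord i))))) => W [W0 _] /=.
apply: (@le_trans _ _ (\sum_(j < k.+1) (cabs z / k.+1%:R * 2 * W k.+1) * struct_bound)).
  apply: ler_sum => j _; apply: le_trans (ler_wpM2l _ (struct_bound_ge x (u j))).
    rewrite mulr_sumr; apply: ler_sum => b _.
    rewrite !cabsM cabs_creal cabsV cabs_nat le_eqVlt; apply/orP; left; apply/eqP.
    by move: (`|_|) (k.+1%:R^-1) (W _) => p q r; ring.
  by rewrite !mulr_ge0 ?cabs_ge0 ?invr_ge0.
rewrite sumr_const card_ord -[X in X <= _]mulr_natl le_eqVlt; apply/orP; left; apply/eqP.
have k1' : k.+1%:R != 0 :> R by rewrite pnatr_eq0.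
by move: k1' (cabs z) struct_bound (W _); move: (k.+1%:R : R) => a a0 p q r; field.
Qed.

Lemma rep_boundN t beta : rep_bound t beta -> rep_bound (- t) beta.
Proof.
move=> H; rewrite -scaleN1r; apply: rep_bound_le (rep_boundZ (-1) H) => W _.
by rewrite cabsN cabs1 mul1r.
Qed.

(** A fixed position is the mean over all positions plus the mean of its differences to them. The
    former is a symmetrized word and costs one weight. Each difference takes at most as many swaps
    as there are other letters, so admissibility bounds it by one more weight; hence the factor
    2. *)
Lemma rep_bound_ins k : forall i x (u : 'I_k -> 'I_n), (i <= k)%N ->
  rep_bound (ins i x u) (fun W => 2 * W k.+1).
Proof.
elim: k => [|k IH] i x u ik.
  (* Without other letters there is a single position, which is its own mean. *)
  have -> : ins i x u = (1%:R^-1 : C) *: \sum_(j < 1) ins j x u.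
    by move: ik; rewrite leqn0 => /eqP ->; rewrite big_ord1 invr1 scale1r.
  rewrite ins_mean; apply: rep_bound_le (rep_bound_quantize_cword _) => W [W0 _].
  by rewrite size_map size_enum_ord; have := W0 1%N; lra.
rewrite (scaled_mean (ins i x u) (fun j : 'I_k.+2 => ins j x u)) ins_mean.
pose kap := cabs z * struct_bound.
have kap0 : 0 <= kap by rewrite mulr_ge0 ?cabs_ge0 // struct_bound_ge0.
have dist d i1 : (i1 + d <= k.+1)%N -> rep_bound (ins i1 x u - ins (i1 + d) x u)
    (fun W => d%:R * (2 * kap * W k.+1)).
  elim: d => [|d IHd] le1.
    rewrite addn0 subrr; apply: rep_bound_le rep_bound0 => W _; by rewrite mul0r.
  rewrite addnS in le1; have := rep_bound_ins_step (Ordinal le1) x u IH.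
  move=> /= step; have := rep_boundD (IHd (ltnW le1)) step.
  rewrite addrA subrK addnS; apply: rep_bound_le => W _.
  change (d%:R * (2 * kap * W k.+1) + (2 * kap * W k.+1) <= d.+1%:R * (2 * kap * W k.+1)).
  by move: (2 * kap * W k.+1) => q; rewrite -[d.+1%:R]natr1 mulrDl mul1r.
have dist2 (j : 'I_k.+2) : rep_bound (ins i x u - ins j x u) (fun W => W k.+2).
  have aW W d : adm_weight W -> (d <= k.+1)%N -> d%:R * (2 * kap * W k.+1) <= W k.+2.
    move=> [W0 aW] dk; apply: le_trans (aW k.+1).
    have -> : 2 * (cabs z * struct_bound) * k.+1%:R * W k.+1 = k.+1%:R * (2 * kap * W k.+1).
      by rewrite /kap; move: (cabs z * struct_bound) (W _) (k.+1%:R : R) => p q r; ring.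
    apply: ler_wpM2r; last by rewrite ler_nat.
    by apply: mulr_ge0 => //; apply: mulr_ge0.
  have jk : (j <= k.+1)%N by rewrite -ltnS.
  case: (leqP i j) => ij.
    have := @dist (j - i)%N i; rewrite subnKC // => /(_ jk); apply: rep_bound_le => W aW'.
    by apply: aW => //; rewrite leq_subLR (leq_trans jk) // leq_addl.
  rewrite -opprB; apply: rep_boundN.
  have := @dist (i - j)%N j; rewrite subnKC ?(ltnW ij) // => /(_ ik).
  apply: rep_bound_le => W aW'.
  by apply: aW => //; rewrite leq_subLR (leq_trans ik) // leq_addl.
apply: rep_bound_le (rep_boundD (rep_bound_quantize_cword _)
  (rep_bound_sum _ (fun j : 'I_k.+2 => rep_boundZ (k.+2%:R^-1) (dist2 j)))) => W _ /=.
rewrite size_map size_enum_ord sumr_const card_ord cabsV cabs_nat.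
rewrite -[X in _ + X]mulr_natl mulVKf ?pnatr_eq0 //; lra.
Qed.

Lemma rep_bound_letter x m :
  rep_bound ((z *: tword [:: x]) * quantize z (smon m)) (fun W => 2 * W (mdeg m).+1).
Proof.
rewrite quantize_smon -size_cmonom_word; set w := cmonom_word m.
have := @rep_bound_ins (size w) 0 x (tnth (in_tuple w)) isT.
congr rep_bound; rewrite /ins /insert_sum.
rewrite -[X in symmetrize_word R X]/(val (in_tuple w)) symmetrize_tuple /symfun.
rewrite -tscaleAl -!tscaleAr !scalerA -exprS mulr_sumr; congr (_ *: _).
apply: eq_bigr => s _; rewrite take0 drop0 /=.
exact: (tword_cat [:: x]).
Qed.

Lemma rep_bound_letter_sym x v :
  rep_bound ((z *: tword [:: x]) * quantize z v) (fun W => 2 * symW (fun k => W k.+1) v).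
Proof.
rewrite {1}(malg_lext v) /lext quantize_sum mulr_sumr.
apply: rep_bound_le (rep_bound_sum _ (beta := fun m W => cabs (mcoeff m v) * (2 * W (mdeg m).+1)) _).
  move=> W _; rewrite /symW /wnorm mulr_sumr le_eqVlt; apply/orP; left; apply/eqP.
  by apply: eq_bigr => m _; rewrite mulrCA.
move=> m; rewrite quantizeZ -tscaleAr; apply: rep_boundZ; exact: rep_bound_letter.
Qed.

Lemma adm_weightS W : adm_weight W -> adm_weight (fun k => W k.+1).
Proof.
move=> [W0 aW]; split=> [k|k]; first exact: W0.
apply: le_trans (aW k.+1); rewrite ler_wpM2r // ler_wpM2l ?ler_nat //.
by rewrite !mulr_ge0 ?cabs_ge0 // struct_bound_ge0.
Qed.

Lemma rep_bound_word w v :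
  rep_bound ((z ^+ size w *: tword w) * quantize z v)
    (fun W => 2 ^+ size w * symW (fun k => W (k + size w)%N) v).
Proof.
elim: w => [|x w [v' [Iv' Hv']]].
  exists v; split=> [|W _]; last first.
    rewrite expr0 mul1r /symW; apply: le_wnorm => m; by rewrite addn0.
  by rewrite expr0 scale1r tword0 mul1r subrr; exact: env_ideal0.
have I1 := @env_idealM (z *: tword [:: x]) _ 1 Iv'.
rewrite mulr1 mulrBr in I1.
have E : z ^+ size (x :: w) *: tword (x :: w) =
    (z *: tword [:: x]) * (z ^+ size w *: tword w) :> tensAlg R n.
  rewrite -tscaleAl -tscaleAr scalerA -exprS; apply: congr1.
  exact: (tword_cat [:: x]).
rewrite E -[X in rep_bound X _]mulrA.
apply: rep_bound_congr I1 _.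
apply: rep_bound_le (rep_bound_letter_sym x v') => W aW.
have := Hv' _ (adm_weightS aW); rewrite exprS -mulrA => H.
rewrite ler_wpM2l //; apply: le_trans H _; rewrite ler_wpM2l ?exprn_ge0 //.
by apply: le_wnorm => m; rewrite /= addnS.
Qed.

Lemma rep_bound_cword w v :
  rep_bound (quantize z (smon (cword w)) * quantize z v)
    (fun W => 2 ^+ size w * symW (fun k => W (k + size w)%N) v).
Proof.
have E : quantize z (smon (cword w)) = (((size w)`!)%:R^-1 : C) *:
    \sum_(s : 'S_(size w)) (z ^+ size w *: tword (pword (tnth (in_tuple w)) s)).
  rewrite quantize_cword -[X in symmetrize_word R X]/(val (in_tuple w)) symmetrize_tuple /symfun.
  by rewrite [LHS]scalerA [X in X *: _ = _]mulrC -[LHS]scalerA; apply: congr1; rewrite scaler_sumr.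
rewrite E -tscaleAl mulr_suml.
apply: rep_bound_le (rep_boundZ _ (rep_bound_sum _ (beta := fun (s : 'S_(size w)) W =>
   2 ^+ size w * symW (fun k => W (k + size w)%N) v) _)).
  move=> W _; rewrite sum_perm_const cabsV cabs_nat; move: (2 ^+ _ * _) => q.
  have k0 : ((size w)`!)%:R != 0 :> R by rewrite pnatr_eq0 -lt0n fact_gt0.
  by rewrite -[q *+ _]mulr_natl mulKf.
move=> s; have := rep_bound_word (pword (tnth (in_tuple w)) s) v.
by rewrite size_pword.
Qed.

End Reordering.
End EnvelopingIdeal.

(** * Existence, bilinearity and estimate of the Gutt star product *)

Section GuttProduct.
Context {R : realType} {n : nat} {G : lieGroup R n} (F : frame G).
Let C := cplx R.
Implicit Types (z c : C) (a b v : symAlg R n) (w : seq 'I_n).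

Lemma lin_sub (V : lmodType C) c (x y s t : V) :
  (c *: x + y) - (c *: s + t) = c *: (x - s) + (y - t).
Proof. by rewrite scalerBr opprD addrACA. Qed.

Lemma quantize_lin z c a b : quantize z (c *: a + b) = c *: quantize z a + quantize z b.
Proof. by rewrite quantizeD quantizeZ. Qed.

Lemma tens_lin_l c (s t u : tensAlg R n) : (c *: s + t) * u = c *: (s * u) + t * u.
Proof. by rewrite mulrDl tscaleAl. Qed.

Lemma tens_lin_r c (s t u : tensAlg R n) : u * (c *: s + t) = c *: (u * s) + u * t.
Proof. by rewrite mulrDr tscaleAr. Qed.

Lemma rep_bound_exists z (t : tensAlg R n) beta : rep_bound F z t beta ->
  exists v, env_ideal F (quantize z v - t).
Proof. by move=> [v [Iv _]]; exists v. Qed.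

(** The spanning half of Poincare-Birkhoff-Witt, a by-product of the reordering estimates, which
    construct the representative. *)
Lemma gutt_exists z a b : exists v, env_ideal F (quantize z v - quantize z a * quantize z b).
Proof.
have H m : rep_bound F z (quantize z (mcoeff m a *: smon m) * quantize z b)
    (fun W => cabs (mcoeff m a) * (2 ^+ size (cmonom_word m) *
       symW (fun k => W (k + size (cmonom_word m))%N) b)).
  rewrite quantizeZ -tscaleAl; apply: rep_boundZ; rewrite -[X in smon X]cword_monom.
  exact: rep_bound_cword.
have [v Iv] := rep_bound_exists (rep_bound_sum (finmap.enum_fset (msupp a)) H).
by exists v; rewrite {1}(malg_lext a) /lext quantize_sum mulr_suml.
Qed.

Lemma gutt_spec z a b : z != 0 ->
  env_ideal F (quantize z (gutt F z a b) - quantize z a * quantize z b).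
Proof.
move=> /negPf z0; rewrite /gutt z0.
exact: (@xgetPex _ 0 [set v | env_ideal F (quantize z v - quantize z a * quantize z b)]
  (gutt_exists z a b)).
Qed.

Lemma gutt_eq z a b v : z != 0 ->
  env_ideal F (quantize z v - quantize z a * quantize z b) -> gutt F z a b = v.
Proof.
move=> z0 Iv; apply/eqP; rewrite -subr_eq0; apply/eqP; apply: (quantize_inj (F := F) z0).
have := env_idealD (gutt_spec a b z0) (env_idealN Iv).
move: (quantize z a * quantize z b) => t.
rewrite opprB addrA subrK -scaleN1r -quantizeZ -quantizeD scaleN1r.
by [].
Qed.

(** Linearity is invisible in the choice made by [gutt]; the linear combination on the right
    satisfies the defining congruence, whose solution is unique. *)
Lemma gutt_linl z c a a' b :
  gutt F z (c *: a + a') b = c *: gutt F z a b + gutt F z a' b.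
Proof.
case: (eqVneq z 0) => [z0|z0].
  rewrite /gutt z0 eqxx mulrDl; congr (_ + _); exact/esym/fgscaleAl.
apply: gutt_eq => //.
have I1 := env_idealD (env_idealZ c (gutt_spec a b z0)) (gutt_spec a' b z0).
by rewrite quantize_lin (quantize_lin z c a a') tens_lin_l lin_sub.
Qed.

Lemma gutt_linr z c a b b' :
  gutt F z a (c *: b + b') = c *: gutt F z a b + gutt F z a b'.
Proof.
case: (eqVneq z 0) => [z0|z0].
  rewrite /gutt z0 eqxx mulrDr; congr (_ + _).
  by rewrite mulrC [a * b]mulrC; exact/esym/fgscaleAl.
apply: gutt_eq => //.
have I1 := env_idealD (env_idealZ c (gutt_spec a b z0)) (gutt_spec a b' z0).
by rewrite quantize_lin (quantize_lin z c b b') tens_lin_r lin_sub.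
Qed.

Lemma gutt0l z b : gutt F z 0 b = 0.
Proof. by have := gutt_linl z (-1) 0 0 b; rewrite scaler0 addr0 scaleN1r addNr. Qed.

Lemma guttZl z c a b : gutt F z (c *: a) b = c *: gutt F z a b.
Proof. by rewrite -[X in gutt F z X b]addr0 gutt_linl [X in _ + X]gutt0l addr0. Qed.

Lemma guttDl z a a' b : gutt F z (a + a') b = gutt F z a b + gutt F z a' b.
Proof. by rewrite -[X in gutt F z (X + a') b]scale1r gutt_linl [X in X + _]scale1r. Qed.

Lemma gutt_suml z (I : Type) (s : seq I) (P : pred I) (f : I -> symAlg R n) b :
  gutt F z (\sum_(i <- s | P i) f i) b = \sum_(i <- s | P i) gutt F z (f i) b.
Proof. exact: (big_morph (fun a => gutt F z a b) (fun a a' => guttDl z a a' b) (gutt0l z b)). Qed.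

(** For nonzero z, uniqueness identifies the product with the representative already estimated. For
    z = 0 degrees simply add, and the power of 2 is slack. *)
Lemma gutt_bound z (W : nat -> R) w v : adm_weight F z W ->
  symW W (gutt F z (smon (cword w)) v) <=
    2 ^+ size w * symW (fun k => W (k + size w)%N) v.
Proof.
move=> aW; case: (eqVneq z 0) => [z0|z0]; last first.
  have [v' [Iv' Hv']] := rep_bound_cword F z w v.
  by rewrite (gutt_eq z0 Iv'); exact: Hv'.
have [W0 _] := aW; rewrite /gutt z0 eqxx.
have -> : smon (cword w) * v = lext (fun m => smon (mulcm (cword w) m)) v.
  rewrite {1}(malg_lext v) /lext mulr_sumr; apply: eq_bigr => m _.
  by rewrite -smonM mulrC [X in _ = _ *: X]mulrC; exact/esym/fgscaleAl.
apply: (@le_trans _ _ (symW (fun k => W (k + size w)%N) v)).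
  apply: wnorm_lext => m //; rewrite wnormU cabs1 mul1r -(mdeg_cword w) addnC.
  by rewrite -[mdeg (mulcm _ _)]/(mdeg (mulcm (cword w) m)) [X in W X <= _](mdegM (cword w) m).
rewrite ler_peMl //; first by apply: wnorm_ge0.
by rewrite exprn_ege1 // ler1n.
Qed.

End GuttProduct.

(** * Seminorms of analytic functions *)

Section FactWeight.
Context {R : realType}.

Definition fweight (r : R) (k : nat) : R := (k`!)%:R `^ (r - 1).

Lemma fact_gt0R k : 0 < (k`!)%:R :> R.
Proof. by rewrite ltr0n fact_gt0. Qed.

Lemma fweight_gt0 r k : 0 < fweight r k.
Proof. by apply: powR_gt0; exact: fact_gt0R. Qed.

Lemma fweightE r k : fweight r k = (k`!)%:R `^ r / (k`!)%:R.
Proof.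
rewrite /fweight powRB; last by apply/implyP => _; rewrite gt_eqF ?fact_gt0R.
by rewrite powRr1 // ltW // fact_gt0R.
Qed.

Lemma bin_le_exp2 k p : ('C(k, p) <= 2 ^ k)%N.
Proof.
case: (leqP p k) => pk; last by rewrite bin_small.
rewrite (Pascal 1 1 k) => //=; under eq_bigr do rewrite !exp1n !muln1.
by rewrite (bigD1 (Ordinal (pk : (p < k.+1)%N))) //= leq_addr.
Qed.

(** The binomial coefficient on the left, divided by k!, is 1/(p! (k-p)!). The r-th power of k! =
    C(k,p) p! (k-p)! leaves C(k,p)^r, which is at most 2^(r k). *)
Lemma fweight_split r k p : 0 <= r -> (p <= k)%N ->
  ('C(k, p))%:R * fweight r k <= (2 `^ r) ^+ k * (fweight r p * fweight r (k - p)).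
Proof.
move=> r0 pk; rewrite !fweightE.
have kE : (k`!)%:R = ('C(k, p))%:R * ((p`!)%:R * ((k - p)`!)%:R) :> R.
  by rewrite -!natrM bin_fact.
have k1 := fact_gt0R k; have p1 := fact_gt0R p; have q1 := fact_gt0R (k - p).
have b0 : 0 < ('C(k, p))%:R :> R by rewrite ltr0n bin_gt0.
have H : (k`!)%:R `^ r <= (2 `^ r) ^+ k * ((p`!)%:R `^ r * ((k - p)`!)%:R `^ r).
  rewrite kE (powRM _ (ltW b0) (mulr_ge0 (ltW p1) (ltW q1))) (powRM _ (ltW p1) (ltW q1)).
  rewrite ler_wpM2r ?mulr_ge0 ?powR_ge0 //.
  rewrite -powR_mulrn ?powR_ge0 // -powRrM [r * _]mulrC powRrM powR_mulrn //.
  by rewrite ge0_ler_powR // ?nnegrE ?ler0n ?exprn_ge0 // -natrX ler_nat bin_le_exp2.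
rewrite mulrA [X in X <= _]mulrAC.
rewrite [X in _ <= X](_ : _ = ('C(k, p))%:R / (k`!)%:R *
   ((2 `^ r) ^+ k * ((p`!)%:R `^ r * ((k - p)`!)%:R `^ r))).
  by rewrite [X in X <= _](_ : _ = ('C(k, p))%:R / (k`!)%:R * (k`!)%:R `^ r) ?ler_pM2l
     ?divr_gt0 //; ring.
have alg (a b c d e g : R) : d != 0 -> e != 0 -> g != 0 ->
    a * (b / e * (c / g)) = d / (d * (e * g)) * (a * (b * c)).
  by move=> d0 e0 g0; field; rewrite d0 e0 g0.
by rewrite [X in _ / X]kE; apply: alg; exact: lt0r_neq0.
Qed.

(** The power r of the factorial is increasing, and the remaining quotient (k+p)!/k! is p! times a
    binomial coefficient, at most 2^(k+p). *)
Lemma fweight_shift r k p : 0 <= r ->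
  fweight r k <= 2 ^+ (k + p) * (p`!)%:R * fweight r (k + p).
Proof.
move=> r0; rewrite !fweightE.
have k1 := fact_gt0R k; have p1 := fact_gt0R p; have q1 := fact_gt0R (k + p).
have kE : ((k + p)`!)%:R = ('C(k + p, p))%:R * ((p`!)%:R * (k`!)%:R) :> R.
  by rewrite -!natrM -(bin_fact (leq_addl k p)) addnK.
have H1 : (k`!)%:R `^ r <= ((k + p)`!)%:R `^ r :> R.
  by rewrite ge0_ler_powR // ?nnegrE ?(ltW k1) ?(ltW q1) // ler_nat leq_fact // leq_addr.
have H2 : ((k + p)`!)%:R <= 2 ^+ (k + p) * (p`!)%:R * (k`!)%:R :> R.
  by rewrite kE mulrA ler_pM2r // ler_pM2r // -natrX ler_nat bin_le_exp2.
apply: (@le_trans _ _ (((k + p)`!)%:R `^ r / (k`!)%:R)).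
  by rewrite ler_pM2r // invr_gt0.
have alg (a b c d : R) : 0 <= a -> 0 < b -> 0 < d -> d <= c * b -> a / b <= c * (a / d).
  move=> a0 b0 d0 dcb; rewrite mulrCA ler_wpM2l // ler_pdivlMr //.
  by rewrite mulrC ler_pdivrMr.
by apply: alg => //; exact: powR_ge0.
Qed.

End FactWeight.

Section BinomialConvolution.
Context {R : realType}.

(** The iterated product rule as a recursion: each derivative falls on the first or on the second
    factor. Estimates follow the recursion, and binomial coefficients enter only through
    [leibniz_sumE]. *)
Fixpoint leibniz_sum k (f : nat -> nat -> R) : R :=
  if k is k'.+1 then leibniz_sum k' (fun p q => f p.+1 q) + leibniz_sum k' (fun p q => f p q.+1)
  else f 0%N 0%N.

Lemma leibniz_sumE k f :
  leibniz_sum k f = \sum_(p < k.+1) ('C(k, p))%:R * f p (k - p)%N.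
Proof.
elim: k f => [|k IH] f /=; first by rewrite big_ord1 bin0 mul1r.
rewrite !IH.
rewrite [RHS]big_ord_recl bin0 mul1r subn0 /=.
under [in RHS]eq_bigr => p _ do rewrite /bump /= add1n binS natrD mulrDl subSS.
rewrite [in RHS]big_split /= [RHS]addrA [RHS]addrC; congr (_ + _).
rewrite [in LHS]big_ord_recl bin0 mul1r subn0 [in RHS]big_ord_recr /= bin_small // mul0r addr0.
congr (_ + _); apply: eq_bigr => p _; rewrite /bump /= add1n; congr (_ * f _ _).
by rewrite subnSK.
Qed.

End BinomialConvolution.

(** * Left-invariant derivatives of complex-valued functions *)

Section ComplexFunctions.
Context {R : realType} {n : nat} {G : lieGroup R n} (F : frame G).
Let C := cplx R.
Implicit Types (phi psi : G -> C) (g : G) (s : seq 'rV[R]_n) (w : seq 'I_n).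

Lemma creD (x y : C) : cre (x + y) = cre x + cre y. Proof. by case: x; case: y. Qed.
Lemma cimD (x y : C) : cim (x + y) = cim x + cim y. Proof. by case: x; case: y. Qed.
Lemma creM (x y : C) : cre (x * y) = cre x * cre y - cim x * cim y.
Proof. by case: x; case: y. Qed.
Lemma cimM (x y : C) : cim (x * y) = cre x * cim y + cim x * cre y.
Proof. by case: x; case: y. Qed.

Lemma cplx_eq (x y : C) : cre x = cre y -> cim x = cim y -> x = y.
Proof. by case: x => a b; case: y => c d /= -> ->. Qed.

Definition germC phi g : Prop :=
  analytic_germ (cre \o phi) g /\ analytic_germ (cim \o phi) g.

Lemma analytic_funP phi : analytic_fun phi <-> forall g, germC phi g.
Proof.
split=> [H g|H c ac g cg].
  have [c ac cg] := lg_cover g; have [h1 h2] := H c ac g cg.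
  by split; exists c.
by have [h1 h2] := H g; split; apply: analytic_germ_chart.
Qed.

Lemma germC_cst (a : C) g : germC (fun=> a) g.
Proof. by split; exact: analytic_germ_cst. Qed.

Lemma germCD phi psi g : germC phi g -> germC psi g -> germC (fun x => phi x + psi x) g.
Proof.
move=> [p1 p2] [q1 q2]; split.
  by apply: analytic_germ_eq (analytic_germD p1 q1) => x /=; rewrite creD.
by apply: analytic_germ_eq (analytic_germD p2 q2) => x /=; rewrite cimD.
Qed.

Lemma germCM phi psi g : germC phi g -> germC psi g -> germC (fun x => phi x * psi x) g.
Proof.
move=> [p1 p2] [q1 q2]; split.
  apply: analytic_germ_eq (analytic_germB (analytic_germM p1 q1) (analytic_germM p2 q2)).
  by move=> x /=; rewrite creM.
apply: analytic_germ_eq (analytic_germD (analytic_germM p1 q2) (analytic_germM p2 q1)).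
by move=> x /=; rewrite cimM.
Qed.

Lemma germC_lie xi phi g : germC phi g -> germC (lie F xi phi) g.
Proof.
move=> [p1 p2]; split.
  by apply: analytic_germ_eq (analytic_germ_lieR F xi p1) => x.
by apply: analytic_germ_eq (analytic_germ_lieR F xi p2) => x.
Qed.

Lemma lie_cst xi (a : C) g : lie F xi (fun=> a) g = 0.
Proof.
by apply: cplx_eq; [exact: (lieR_cst F xi (cre a))|exact: (lieR_cst F xi (cim a))].
Qed.

Lemma lieD xi phi psi g : germC phi g -> germC psi g ->
  lie F xi (fun x => phi x + psi x) g = lie F xi phi g + lie F xi psi g.
Proof.
move=> [p1 p2] [q1 q2]; apply: cplx_eq; rewrite ?creD ?cimD.
  rewrite -[RHS](lieRD F xi p1 q1); congr (lieR F xi _ g).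
  by apply/funext => x /=; rewrite creD.
rewrite -[RHS](lieRD F xi p2 q2); congr (lieR F xi _ g).
by apply/funext => x /=; rewrite cimD.
Qed.

Lemma lieM xi phi psi g : germC phi g -> germC psi g ->
  lie F xi (fun x => phi x * psi x) g = lie F xi phi g * psi g + phi g * lie F xi psi g.
Proof.
move=> [p1 p2] [q1 q2]; apply: cplx_eq; rewrite ?creD ?cimD ?creM ?cimM.
  transitivity (lieR F xi (fun x => (cre \o phi) x * (cre \o psi) x -
      (cim \o phi) x * (cim \o psi) x) g).
    by congr (lieR F xi _ g); apply/funext => x /=; rewrite creM.
  rewrite lieRB; [|exact: analytic_germM|exact: analytic_germM].
  rewrite (lieRM F xi p1 q1) (lieRM F xi p2 q2) /=.
  move: (lieR _ _ _ _) (lieR _ _ _ _) (lieR _ _ _ _) (lieR _ _ _ _) => a b c d; ring.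
transitivity (lieR F xi (fun x => (cre \o phi) x * (cim \o psi) x +
    (cim \o phi) x * (cre \o psi) x) g).
  by congr (lieR F xi _ g); apply/funext => x /=; rewrite cimM.
rewrite lieRD; [|exact: analytic_germM|exact: analytic_germM].
rewrite (lieRM F xi p1 q2) (lieRM F xi p2 q1) /=.
move: (lieR _ _ _ _) (lieR _ _ _ _) (lieR _ _ _ _) (lieR _ _ _ _) => a b c d; ring.
Qed.

Lemma lieZ xi (a : C) phi g : germC phi g -> lie F xi (fun x => a * phi x) g = a * lie F xi phi g.
Proof. by move=> p; rewrite lieM ?lie_cst ?mul0r ?add0r //; exact: germC_cst. Qed.

Lemma lie_lin xi phi g : germC phi g ->
  lie F xi phi g = \sum_i creal (xi 0 i) * lie F (basis_vec i) phi g.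
Proof.
move=> [p1 p2].
have reS (I : Type) (r : seq I) (f : I -> C) : cre (\sum_(i <- r) f i) = \sum_(i <- r) cre (f i).
  exact: (big_morph _ creD).
have imS (I : Type) (r : seq I) (f : I -> C) : cim (\sum_(i <- r) f i) = \sum_(i <- r) cim (f i).
  exact: (big_morph _ cimD).
apply: cplx_eq.
  rewrite reS [LHS](lieR_lin F xi p1); apply: eq_bigr => i _.
  by rewrite creM /= mul0r subr0.
rewrite imS [LHS](lieR_lin F xi p2); apply: eq_bigr => i _.
by rewrite cimM /= mul0r addr0.
Qed.

Lemma analytic_fun_lies s phi : analytic_fun phi -> analytic_fun (lies F s phi).
Proof.
move=> /analytic_funP p; apply/analytic_funP; elim: s => //= xi s IH g.
exact: germC_lie.
Qed.

Lemma analytic_funM phi psi : analytic_fun phi -> analytic_fun psi ->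
  analytic_fun (fun x => phi x * psi x).
Proof. by move=> /analytic_funP p /analytic_funP q; apply/analytic_funP => g; exact: germCM. Qed.

Lemma analytic_funD phi psi : analytic_fun phi -> analytic_fun psi ->
  analytic_fun (fun x => phi x + psi x).
Proof. by move=> /analytic_funP p /analytic_funP q; apply/analytic_funP => g; exact: germCD. Qed.

Lemma analytic_fun_cst (a : C) : analytic_fun ((fun=> a) : G -> C).
Proof. by apply/analytic_funP => g; exact: germC_cst. Qed.

Lemma lies_lin s (a : C) phi psi : analytic_fun phi -> analytic_fun psi ->
  lies F s (fun x => a * phi x + psi x) = fun x => a * lies F s phi x + lies F s psi x.
Proof.
move=> p q; elim: s => //= xi s ->; apply/funext => g.
have /analytic_funP p' := analytic_fun_lies s p; have /analytic_funP q' := analytic_fun_lies s q.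
rewrite lieD ?lieZ //; exact: (germCM (germC_cst a g) (p' g)).
Qed.

Lemma lies0 s : lies F s (fun=> 0 : C) = fun=> 0.
Proof. by elim: s => //= xi s ->; apply/funext => g; exact: lie_cst. Qed.

Lemma liesZ s (a : C) phi : analytic_fun phi ->
  lies F s (fun x => a * phi x) = fun x => a * lies F s phi x.
Proof.
move=> p; have := lies_lin s a p (analytic_fun_cst 0); rewrite lies0.
by move=> E; apply/funext => g; move: (congr1 (@^~ g) E); rewrite addr0 => <-;
  congr (lies F s _ g); apply/funext => x; rewrite addr0.
Qed.

Lemma lies_cat s s' phi : lies F (s ++ s') phi = lies F s (lies F s' phi).
Proof. exact: foldr_cat. Qed.

Lemma lies_multilin s1 xi s2 phi : analytic_fun phi ->
  lies F (s1 ++ xi :: s2) phi =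
  fun g => \sum_i creal (xi 0 i) * lies F (s1 ++ basis_vec i :: s2) phi g.
Proof.
move=> p; rewrite lies_cat /=.
have p2 := analytic_fun_lies s2 p; set f := lies F s2 phi in p2.
have -> : lie F xi f = fun g => \sum_i creal (xi 0 i) * lie F (basis_vec i) f g.
  by apply/funext => g; apply: lie_lin; exact: (iffLR (analytic_funP f) p2 g).
have E (r : seq 'I_n) : analytic_fun (fun g => \sum_(i <- r) creal (xi 0 i) * lie F (basis_vec i) f g) /\
  lies F s1 (fun g => \sum_(i <- r) creal (xi 0 i) * lie F (basis_vec i) f g) =
  fun g => \sum_(i <- r) creal (xi 0 i) * lies F s1 (lie F (basis_vec i) f) g.
  elim: r => [|i r [IH1 IH2]].
    rewrite (_ : (fun g => _) = fun=> 0 : C); last by apply/funext => g; rewrite big_nil.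
    split; first exact: analytic_fun_cst.
    by rewrite lies0; apply/funext => g; rewrite big_nil.
  have pi : analytic_fun (lie F (basis_vec i) f) by exact: (analytic_fun_lies [:: basis_vec i] p2).
  have -> : (fun g => \sum_(j <- i :: r) creal (xi 0 j) * lie F (basis_vec j) f g) =
     (fun g => creal (xi 0 i) * lie F (basis_vec i) f g +
       (\sum_(j <- r) creal (xi 0 j) * lie F (basis_vec j) f g)).
    by apply/funext => g; rewrite big_cons.
  split.
    apply: analytic_funD IH1; apply: analytic_funM pi; exact: analytic_fun_cst.
  rewrite lies_lin // IH2; apply/funext => g; by rewrite big_cons.
have [_ ->] := E (index_enum 'I_n); apply/funext => g; apply: eq_bigr => i _.
by rewrite lies_cat.
Qed.

Definition jet k phi : R :=
  \sum_(alpha : k.-tuple 'I_n) cabs (lies F (map (@basis_vec R n) alpha) phi 1%g).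

Lemma jet_ge0 k phi : 0 <= jet k phi.
Proof. by apply: sumr_ge0 => *; exact: cabs_ge0. Qed.

Lemma sum_tuple_rcons (V : nmodType) k (f : k.+1.-tuple 'I_n -> V) :
  \sum_w f w = \sum_i \sum_(w : k.-tuple 'I_n) f [tuple of rcons w i].
Proof.
rewrite pair_big /= (reindex (fun p : 'I_n * k.-tuple 'I_n => [tuple of rcons p.2 p.1])) //=.
apply: onW_bij; apply: inj_card_bij; last by rewrite card_prod !card_tuple card_ord expnS.
move=> [i w] [j w'] /= /(congr1 val) /= /rcons_inj [ww ij].
by congr (_, _) => //; apply: val_inj.
Qed.

Lemma jet0 phi : jet 0 phi = cabs (phi 1%g).
Proof.
rewrite /jet (bigD1 [tuple]) //= big1 ?addr0 // => w /negP[].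
by apply/eqP; exact: tuple0.
Qed.

Lemma jetS k phi : jet k.+1 phi = \sum_i jet k (lie F (basis_vec i) phi).
Proof.
rewrite /jet sum_tuple_rcons; apply: eq_bigr => i _; apply: eq_bigr => w _ /=.
by rewrite map_rcons -cats1 lies_cat.
Qed.

Lemma jetD k phi psi : analytic_fun phi -> analytic_fun psi ->
  jet k (fun x => phi x + psi x) <= jet k phi + jet k psi.
Proof.
move=> p q; rewrite /jet -big_split; apply: ler_sum => w _ /=.
have := lies_lin (map (@basis_vec R n) w) 1 p q.
rewrite (_ : (fun x => 1 * phi x + psi x) = fun x => phi x + psi x); last first.
  by apply/funext => x; rewrite mul1r.
by move=> ->; rewrite mul1r cabsD.
Qed.

Lemma jetZ k (a : C) phi : analytic_fun phi ->
  jet k (fun x => a * phi x) = cabs a * jet k phi.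
Proof.
move=> p; rewrite /jet mulr_sumr; apply: eq_bigr => w _.
by rewrite liesZ // cabsM.
Qed.

Lemma jet_lie k i phi : jet k (lie F (basis_vec i) phi) <= jet k.+1 phi.
Proof.
rewrite jetS (bigD1 i) //= lerDl; apply: sumr_ge0 => *; exact: jet_ge0.
Qed.

Lemma jet_lies k w phi : jet k (lies F (map (@basis_vec R n) w) phi) <= jet (k + size w) phi.
Proof.
elim: w k => [|i w IH] k /=; first by rewrite addn0.
by apply: le_trans (jet_lie _ _ _) _; rewrite addnS -addSn; exact: IH.
Qed.

(** Induction on the innermost derivative: each summand of the product rule is again a product, and
    summation over the basis raises one of the two indices. *)
Lemma jetM k phi psi : analytic_fun phi -> analytic_fun psi ->
  jet k (fun x => phi x * psi x) <=
  \sum_(p < k.+1) ('C(k, p))%:R * (jet p phi * jet (k - p) psi).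
Proof.
rewrite -(leibniz_sumE k (fun p q => jet p phi * jet q psi)).
have mono f f' : (forall p q, f p q <= f' p q) -> leibniz_sum k f <= leibniz_sum k f'.
  elim: (k) f f' => //= k' IH f f' ff'; apply: lerD; apply: IH => *; exact: ff'.
have sumE k' (I : Type) (r : seq I) (f : I -> nat -> nat -> R) :
    \sum_(i <- r) leibniz_sum k' (f i) = leibniz_sum k' (fun p q => \sum_(i <- r) f i p q).
  elim: k' f => //= k' IH f; by rewrite big_split /= !IH.
elim: k phi psi {mono} => [|k IH] phi psi p q; first by rewrite /= !jet0 cabsM.
rewrite jetS /=.
have pl i : analytic_fun (lie F (basis_vec i) phi) by exact: (analytic_fun_lies [:: basis_vec i] p).
have ql i : analytic_fun (lie F (basis_vec i) psi) by exact: (analytic_fun_lies [:: basis_vec i] q).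
have step i : jet k (lie F (basis_vec i) (fun x => phi x * psi x)) <=
    leibniz_sum k (fun p' q' => jet p' (lie F (basis_vec i) phi) * jet q' psi) +
    leibniz_sum k (fun p' q' => jet p' phi * jet q' (lie F (basis_vec i) psi)).
  apply: le_trans (lerD (IH _ _ (pl i) q) (IH _ _ p (ql i))).
  have -> : lie F (basis_vec i) (fun x => phi x * psi x) =
     fun x => lie F (basis_vec i) phi x * psi x + phi x * lie F (basis_vec i) psi x.
    apply/funext => x; apply: lieM; by move: p q => /analytic_funP p /analytic_funP q.
  by apply: jetD; exact: analytic_funM.
apply: le_trans (ler_sum _ (fun i _ => step i)) _.
rewrite big_split /= !sumE le_eqVlt; apply/orP; left; apply/eqP.
congr (leibniz_sum k _ + leibniz_sum k _); apply/funext => p'; apply/funext => q' /=.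
  by rewrite jetS mulr_suml.
by rewrite jetS mulr_sumr.
Qed.

End ComplexFunctions.

(** The convolution runs over a triangle inside the square on the right. *)
Lemma cauchy_product_le (R : realType) (u v : nat -> R) N :
  (forall k, 0 <= u k) -> (forall k, 0 <= v k) ->
  \sum_(k < N) \sum_(p < k.+1) u p * v (k - p)%N <=
    (\sum_(k < N) u k) * (\sum_(k < N) v k).
Proof.
move=> u0 v0.
under eq_bigr => k _ do rewrite (big_ord_widen_cond N xpredT (fun p => u p * v (k - p)%N)) //.
rewrite (exchange_big_dep xpredT) //= mulr_suml; apply: ler_sum => p _.
rewrite -mulr_sumr ler_wpM2l //.
have -> : \sum_(i < N | (p < i.+1)%N) v (i - p)%N = \sum_(0 <= i < N | (p <= i)%N) v (i - p)%N.
  by rewrite big_mkord.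
have -> : \sum_(k < N) v k = \sum_(0 <= k < N) v k by rewrite big_mkord.
have <- : \sum_(p <= i < N) v (i - p)%N = \sum_(0 <= i < N | (p <= i)%N) v (i - p)%N.
  by rewrite (@big_nat_widenl _ _ _ p 0).
rewrite -{1}[val p]add0n big_addn.
rewrite (eq_bigr v) => [|k _]; last by rewrite addnK.
rewrite [leRHS](@big_cat_nat _ _ _ (N - p)) ?leq_subr //= lerDl; exact: sumr_ge0.
Qed.

(** * The seminorms of entire functions *)

Section FunNorm.
Context {R : realType} {n : nat} {G : lieGroup R n} (F : frame G) (r : R).
Hypothesis r0 : 0 <= r.
Let C := cplx R.
Implicit Types (phi psi : G -> C) (c : R) (w : seq 'I_n).

Let term c phi k : R := fweight r k * c ^+ k * jet F k phi.

Lemma term_ge0 c phi k : 0 <= c -> 0 <= term c phi k.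
Proof. by move=> c0; rewrite !mulr_ge0 ?exprn_ge0 ?jet_ge0 // ltW // fweight_gt0. Qed.

Lemma fun_normE c phi : fun_norm F r c phi = (\sum_(0 <= k <oo) (term c phi k)%:E)%E.
Proof. by []. Qed.

Lemma fun_norm_le c phi M : 0 <= c -> (forall N, \sum_(k < N) term c phi k <= M) ->
  (fun_norm F r c phi <= M%:E)%E.
Proof.
move=> c0 H; rewrite fun_normE; apply: lime_le.
  by apply: is_cvg_nneseries => k _ _; rewrite lee_fin term_ge0.
by exists 0%N => // N _; rewrite sumEFin lee_fin big_mkord.
Qed.

Definition qnorm c phi : R := fine (fun_norm F r c phi).

Lemma fun_norm_ge0 c phi : 0 <= c -> (0 <= fun_norm F r c phi)%E.
Proof. by move=> c0; rewrite fun_normE; apply: nneseries_ge0 => k _ _; rewrite lee_fin term_ge0. Qed.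

Lemma qnorm_ge0 c phi : 0 <= c -> 0 <= qnorm c phi.
Proof. by move=> c0; rewrite fine_ge0 // fun_norm_ge0. Qed.

Lemma qnorm_ge c phi N : 0 <= c -> entire F r phi -> \sum_(k < N) term c phi k <= qnorm c phi.
Proof.
move=> c0 [_ /(_ c c0) fin]; rewrite -lee_fin /qnorm fineK; last first.
  by rewrite ge0_fin_numE // fun_norm_ge0.
rewrite -sumEFin fun_normE -(big_mkord xpredT (fun k => (term c phi k)%:E)).
by apply: nneseries_lim_ge => k _; rewrite lee_fin term_ge0.
Qed.

Lemma qnorm_le c phi M : 0 <= c -> (forall N, \sum_(k < N) term c phi k <= M) ->
  qnorm c phi <= M.
Proof.
move=> c0 H; have fle := fun_norm_le c0 H.
rewrite -lee_fin /qnorm fineK //.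
by rewrite ge0_fin_numE ?fun_norm_ge0 // (le_lt_trans fle) // ltry.
Qed.

(** By monotonicity only c >= 1 has to be treated, the range in which the estimate for derivatives
    holds. *)
Lemma entire_bound phi : analytic_fun phi ->
  (forall c, 1 <= c -> exists M, forall N, \sum_(k < N) term c phi k <= M) -> entire F r phi.
Proof.
move=> p H; split=> // c c0; have [|M HM] := H (Num.max 1 c); first by rewrite le_max lexx.
apply: (@le_lt_trans _ _ M%:E); last exact: ltry.
apply: fun_norm_le => // N; apply: le_trans (HM N); apply: ler_sum => k _.
rewrite ler_wpM2r ?jet_ge0 // ler_wpM2l ?(ltW (fweight_gt0 _ _)) // lerXn2r // ?nnegrE //.
  by rewrite le_max ler01.
by rewrite le_max lexx orbT.
Qed.

Lemma qnorm_mono c c' phi : 0 <= c -> c <= c' -> entire F r phi -> qnorm c phi <= qnorm c' phi.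
Proof.
move=> c0 cc ep; have c'0 : 0 <= c' by apply: le_trans cc.
apply: qnorm_le => // N; apply: le_trans (qnorm_ge N c'0 ep); apply: ler_sum => k _.
by rewrite ler_wpM2r ?jet_ge0 // ler_wpM2l ?(ltW (fweight_gt0 _ _)) // lerXn2r // nnegrE.
Qed.

(** [fweight_split] trades the binomial coefficient of the Leibniz rule for the k-th power of 2^r,
    which is a dilation of [c]; a Cauchy product remains. *)
Lemma termM c phi psi N : 0 <= c -> analytic_fun phi -> analytic_fun psi ->
  \sum_(k < N) term c (fun x => phi x * psi x) k <=
  (\sum_(k < N) term (2 `^ r * c) phi k) * (\sum_(k < N) term (2 `^ r * c) psi k).
Proof.
move=> c0 p q; have d0 : 0 <= 2 `^ r * c by rewrite mulr_ge0 ?powR_ge0.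
apply: le_trans (cauchy_product_le N (fun k => term_ge0 phi k d0) (fun k => term_ge0 psi k d0)).
apply: ler_sum => k _; rewrite /term.
apply: le_trans (ler_wpM2l _ (jetM F k p q)) _.
  by rewrite mulr_ge0 ?exprn_ge0 // ltW // fweight_gt0.
rewrite mulr_sumr; apply: ler_sum => j _.
have jk : (j <= k)%N by rewrite -ltnS.
have := fweight_split r0 jk => H.
have E1 : fweight r k * c ^+ k * (('C(k, j))%:R * (jet F j phi * jet F (k - j) psi)) =
   (('C(k, j))%:R * fweight r k) * (c ^+ k * (jet F j phi * jet F (k - j) psi)) by ring.
have E2 : fweight r j * (2 `^ r * c) ^+ j * jet F j phi *
     (fweight r (k - j) * (2 `^ r * c) ^+ (k - j) * jet F (k - j) psi) =
   (2 `^ r ^+ k * (fweight r j * fweight r (k - j))) * (c ^+ k * (jet F j phi * jet F (k - j) psi)).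
  have ck (x : R) : x ^+ k = x ^+ j * x ^+ (k - j) by rewrite -exprD subnKC.
  by rewrite !exprMn (ck c) (ck (2 `^ r)); ring.
rewrite E1 E2; apply: ler_wpM2r H.
by rewrite !mulr_ge0 ?exprn_ge0 ?jet_ge0.
Qed.

Lemma entireM phi psi : entire F r phi -> entire F r psi -> entire F r (fun x => phi x * psi x).
Proof.
move=> ep eq; apply: entire_bound; first by apply: analytic_funM; [case: ep|case: eq].
move=> c c1; have c0 : 0 <= c by apply: le_trans c1.
have d0 : 0 <= 2 `^ r * c by rewrite mulr_ge0 ?powR_ge0.
exists (qnorm (2 `^ r * c) phi * qnorm (2 `^ r * c) psi) => N.
apply: le_trans (termM N c0 (proj1 ep) (proj1 eq)) _.
by apply: ler_pM; rewrite ?qnorm_ge //; apply: sumr_ge0 => k _; exact: term_ge0.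
Qed.

Lemma qnormM c phi psi : 0 <= c -> entire F r phi -> entire F r psi ->
  qnorm c (fun x => phi x * psi x) <= qnorm (2 `^ r * c) phi * qnorm (2 `^ r * c) psi.
Proof.
move=> c0 ep eq; have d0 : 0 <= 2 `^ r * c by rewrite mulr_ge0 ?powR_ge0.
apply: qnorm_le => // N; apply: le_trans (termM N c0 (proj1 ep) (proj1 eq)) _.
by apply: ler_pM; rewrite ?qnorm_ge //; apply: sumr_ge0 => k _; exact: term_ge0.
Qed.

(** With p = |w|, the power (2 c mu)^(k+p) pays for the factor 2^(k+p) of [fweight_shift] and for
    the gain mu^-p; the surplus c^p mu^k is at least 1. The freedom in [mu] later makes a sum over p
    geometric. *)
Lemma term_lies c mu w psi N : 1 <= c -> 1 <= mu ->
  \sum_(k < N) term c (lies F (map (@basis_vec R n) w) psi) k <=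
  ((size w)`!)%:R * mu ^- size w * \sum_(k < N + size w) term (2 * c * mu) psi k.
Proof.
move=> c1 mu1; have c0 : 0 <= c by apply: le_trans c1.
have mu0 : 0 < mu by apply: lt_le_trans mu1.
have d0 : 0 <= 2 * c * mu by rewrite !mulr_ge0 // ltW.
rewrite addnC big_split_ord /= mulrDr -[leLHS]add0r lerD //.
  rewrite !mulr_ge0 ?invr_ge0 ?exprn_ge0 ?(ltW mu0) //.
  by apply: sumr_ge0 => k _; exact: term_ge0.
rewrite mulr_sumr; apply: ler_sum => k _ /=; set p := size w; rewrite [(p + k)%N]addnC.
have f0 := fweight_gt0 r (k + p).
have jp := jet_ge0 F (k + p) psi.
apply: (@le_trans _ _ ((2 ^+ (k + p) * (p`!)%:R * fweight r (k + p)) * c ^+ k * jet F (k + p) psi)).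
  apply: ler_pM; rewrite ?jet_ge0 ?mulr_ge0 ?exprn_ge0 ?(ltW (fweight_gt0 _ _)) //.
    by apply: ler_wpM2r; rewrite ?exprn_ge0 // fweight_shift.
  exact: jet_lies.
have E : (p`!)%:R * mu ^- p * term (2 * c * mu) psi (k + p) =
   (2 ^+ (k + p) * (p`!)%:R * fweight r (k + p)) * (c ^+ k * c ^+ p * mu ^+ k) * jet F (k + p) psi.
  rewrite /term !exprMn !exprD; have := expf_neq0 p (lt0r_neq0 mu0).
  move: (mu ^+ p) (fweight _ _) (jet _ _ _) => m f j m0; by field.
rewrite E; apply: ler_wpM2r => //; apply: ler_wpM2l.
  by rewrite !mulr_ge0 ?exprn_ge0 // ltW.
by rewrite -mulrA ler_peMr ?exprn_ge0 // mulr_ege1 // exprn_ege1.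
Qed.

Lemma entire_lies w psi : entire F r psi -> entire F r (lies F (map (@basis_vec R n) w) psi).
Proof.
move=> ep; apply: entire_bound; first by apply: analytic_fun_lies; case: ep.
move=> c c1; have c0 : 0 <= c by apply: le_trans c1.
exists (((size w)`!)%:R * 1 ^- size w * qnorm (2 * c * 1) psi) => N.
apply: le_trans (term_lies w psi N c1 (lexx 1)) _.
apply: ler_wpM2l; first by rewrite mulr_ge0 ?invr_ge0 ?exprn_ge0.
by apply: qnorm_ge => //; rewrite !mulr_ge0.
Qed.

Lemma qnorm_lies c mu w psi : 1 <= c -> 1 <= mu -> entire F r psi ->
  qnorm c (lies F (map (@basis_vec R n) w) psi) <=
  ((size w)`!)%:R * mu ^- size w * qnorm (2 * c * mu) psi.
Proof.
move=> c1 mu1 ep; have c0 : 0 <= c by apply: le_trans c1.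
have mu0 : 0 <= mu by apply: le_trans mu1.
apply: qnorm_le => // N; apply: le_trans (term_lies w psi N c1 mu1) _.
apply: ler_wpM2l; first by rewrite mulr_ge0 ?invr_ge0 ?exprn_ge0.
by apply: qnorm_ge => //; rewrite !mulr_ge0.
Qed.

Lemma termD c phi psi N : 0 <= c -> analytic_fun phi -> analytic_fun psi ->
  \sum_(k < N) term c (fun x => phi x + psi x) k <=
  \sum_(k < N) term c phi k + \sum_(k < N) term c psi k.
Proof.
move=> c0 p q; rewrite -big_split; apply: ler_sum => k _ /=.
by rewrite /term -mulrDr ler_wpM2l ?jetD // mulr_ge0 ?exprn_ge0 // ltW // fweight_gt0.
Qed.

Lemma entireD phi psi : entire F r phi -> entire F r psi -> entire F r (fun x => phi x + psi x).
Proof.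
move=> ep eq; apply: entire_bound; first by apply: analytic_funD; [case: ep|case: eq].
move=> c c1; have c0 : 0 <= c by apply: le_trans c1.
exists (qnorm c phi + qnorm c psi) => N.
by apply: le_trans (termD N c0 (proj1 ep) (proj1 eq)) _; apply: lerD; exact: qnorm_ge.
Qed.

Lemma qnormD c phi psi : 0 <= c -> entire F r phi -> entire F r psi ->
  qnorm c (fun x => phi x + psi x) <= qnorm c phi + qnorm c psi.
Proof.
move=> c0 ep eq; apply: qnorm_le => // N.
by apply: le_trans (termD N c0 (proj1 ep) (proj1 eq)) _; apply: lerD; exact: qnorm_ge.
Qed.

Lemma termZ c (a : C) phi N : analytic_fun phi ->
  \sum_(k < N) term c (fun x => a * phi x) k = cabs a * \sum_(k < N) term c phi k.
Proof.
by move=> p; rewrite mulr_sumr; apply: eq_bigr => k _; rewrite /term jetZ // mulrCA.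
Qed.

Lemma entireZ (a : C) phi : entire F r phi -> entire F r (fun x => a * phi x).
Proof.
move=> ep; apply: entire_bound.
  by apply: analytic_funM; [exact: analytic_fun_cst|case: ep].
move=> c c1; have c0 : 0 <= c by apply: le_trans c1.
exists (cabs a * qnorm c phi) => N; rewrite termZ; last by case: ep.
by rewrite ler_wpM2l ?cabs_ge0 // qnorm_ge.
Qed.

Lemma qnormZ c (a : C) phi : 0 <= c -> entire F r phi ->
  qnorm c (fun x => a * phi x) <= cabs a * qnorm c phi.
Proof.
move=> c0 ep; apply: qnorm_le => // N; rewrite termZ; last by case: ep.
by rewrite ler_wpM2l ?cabs_ge0 // qnorm_ge.
Qed.

Lemma entire0 : entire F r (fun=> 0).
Proof.
apply: entire_bound; first exact: analytic_fun_cst.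
move=> c c1; exists 0 => N; rewrite big1 // => k _; rewrite /term /jet big1 ?mulr0 // => w _.
by rewrite lies0 cabs0.
Qed.

End FunNorm.

(** * Projective tensor seminorms *)

Section TensorNorm.
Context {R : realType} {n : nat} {G : lieGroup R n} (F : frame G) (r r' : R).
Hypothesis r0 : 0 <= r.
Let C := cplx R.
Implicit Types (phi psi : G -> C) (c : R) (P Q : @polFun R n G) (v : symAlg R n).

Lemma mcoeff_tens m phi v : mcoeff m (tens phi v) = mcoeff m v *: phi.
Proof.
rewrite /tens raddf_sum.
rewrite (eq_bigr (fun k => (mcoeff k v *: phi) *+ (k == m))) => [|k _]; last exact: mcoeffU.
apply: (sum_msupp_delta m (phi := fun c : C => c *: phi) v); exact: scale0r.
Qed.

Lemma tens_smon phi m : tens phi (smon m) = mkmalgU m phi.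
Proof.
apply/malgP => k; rewrite mcoeff_tens /smon !mcoeffU; case: eqP => _.
  by rewrite !mulr1n scale1r.
by rewrite !mulr0n scale0r.
Qed.

Lemma pol_sum P : P = \sum_(m <- finmap.enum_fset (msupp P)) tens (mcoeff m P) (smon m).
Proof. by rewrite {1}[P]monalgE; apply: eq_bigr => m _; rewrite tens_smon. Qed.

Definition pol_entire P : Prop := forall m, entire F r (mcoeff m P).

Lemma pol_entire0 : pol_entire 0.
Proof. by move=> m; rewrite mcoeff0; exact: entire0. Qed.

Lemma pol_entireD P Q : pol_entire P -> pol_entire Q -> pol_entire (P + Q).
Proof. by move=> p q m; rewrite mcoeffD; exact: entireD. Qed.

Lemma pol_entireN P : pol_entire P -> pol_entire (- P).
Proof.
move=> p m; rewrite mcoeffN; have -> : - mcoeff m P = fun x => -1 * mcoeff m P x.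
  by apply/funext => x; rewrite mulN1r.
exact: entireZ.
Qed.

Lemma pol_entireB P Q : pol_entire P -> pol_entire Q -> pol_entire (P - Q).
Proof. by move=> p q; apply: pol_entireD => //; exact: pol_entireN. Qed.

Lemma pol_entire_sum (I : Type) (s : seq I) (B : pred I) (f : I -> @polFun R n G) :
  (forall i, B i -> pol_entire (f i)) -> pol_entire (\sum_(i <- s | B i) f i).
Proof. by move=> H; apply: big_ind H; [exact: pol_entire0|exact: pol_entireD]. Qed.

Lemma pol_entire_tens phi v : entire F r phi -> pol_entire (tens phi v).
Proof. by move=> e m; rewrite mcoeff_tens; exact: entireZ. Qed.

Definition tensor_rep c c' P (y : R) : Prop :=
  exists (N : nat) (phi : 'I_N -> G -> C) (v : 'I_N -> symAlg R n),
    [/\ forall i, entire F r (phi i),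
        P = \sum_(i < N) tens (phi i) (v i) &
        y = \sum_(i < N) fine (fun_norm F r c (phi i)) * sym_norm r' c' (v i)].

Lemma tensor_normE c c' P : tensor_norm F r r' c c' P = inf [set y | tensor_rep c c' P y].
Proof. by []. Qed.

Lemma sym_norm_ge0 c v : 0 <= c -> 0 <= sym_norm r' c v.
Proof.
move=> c0; rewrite sym_normE; apply: wnorm_ge0 => m.
by rewrite mulr_ge0 ?powR_ge0 ?exprn_ge0.
Qed.

Lemma tensor_rep_ge0 c c' P y : 0 <= c -> 0 <= c' -> tensor_rep c c' P y -> 0 <= y.
Proof.
move=> c0 c'0 [N [phi [v [_ _ ->]]]]; apply: sumr_ge0 => i _.
by rewrite mulr_ge0 ?sym_norm_ge0 ?(qnorm_ge0 F r).
Qed.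

Lemma tensor_rep_tens c c' phi v : entire F r phi ->
  tensor_rep c c' (tens phi v) (qnorm F r c phi * sym_norm r' c' v).
Proof. by exists 1%N, (fun=> phi), (fun=> v); rewrite !big_ord1; split. Qed.

Lemma tensor_rep0 c c' : tensor_rep c c' 0 0.
Proof. by exists 0%N, (fun _ _ => 0), (fun=> 0); rewrite !big_ord0; split => // -[]. Qed.

Lemma tensor_repD c c' P Q y y' : tensor_rep c c' P y -> tensor_rep c c' Q y' ->
  tensor_rep c c' (P + Q) (y + y').
Proof.
move=> [N [a [x [ea -> ->]]]] [N' [a' [x' [ea' -> ->]]]].
pose sel T (f : 'I_N -> T) (f' : 'I_N' -> T) (i : 'I_(N + N')) :=
  match fintype.split i with inl j => f j | inr j => f' j end.
exists (N + N')%N, (sel _ a a'), (sel _ x x').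
have sl T f f' i : @sel T f f' (lshift N' i) = f i.
  by rewrite /sel -[lshift _ _]/(unsplit (inl i)) unsplitK.
have sr T f f' i : @sel T f f' (rshift N i) = f' i.
  by rewrite /sel -[rshift _ _]/(unsplit (inr i)) unsplitK.
split.
- by move=> i; rewrite /sel; case: fintype.split.
- rewrite [RHS]big_split_ord; apply: (f_equal2 +%R); apply: eq_bigr => i _.
    by rewrite !sl.
  by rewrite !sr.
rewrite big_split_ord /=; congr (_ + _); apply: eq_bigr => i _.
  by rewrite !sl.
by rewrite !sr.
Qed.

Lemma tensor_rep_sum c c' (I : Type) (s : seq I) (B : pred I) (f : I -> @polFun R n G) (y : I -> R) :
  (forall i, B i -> tensor_rep c c' (f i) (y i)) ->
  tensor_rep c c' (\sum_(i <- s | B i) f i) (\sum_(i <- s | B i) y i).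
Proof.
move=> H; elim/big_rec2: _ => [|i t y' Bi IH]; first exact: tensor_rep0.
by apply: tensor_repD => //; exact: H.
Qed.

Lemma tensor_rep_exists c c' P : pol_entire P -> exists y, tensor_rep c c' P y.
Proof.
move=> p; rewrite (pol_sum P); eexists; apply: tensor_rep_sum => m _.
by apply: tensor_rep_tens; exact: p.
Qed.

Lemma tensor_norm_ge0 c c' P : 0 <= c -> 0 <= c' -> 0 <= tensor_norm F r r' c c' P.
Proof.
move=> c0 c'0; rewrite tensor_normE; case: (pselect ([set y | tensor_rep c c' P y] !=set0)).
  by move=> ne; apply: lb_le_inf => // y /tensor_rep_ge0; exact.
by move=> /set0P/negP/negPn/eqP ->; rewrite inf0.
Qed.

Lemma tensor_norm_le c c' P y : 0 <= c -> 0 <= c' -> tensor_rep c c' P y ->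
  tensor_norm F r r' c c' P <= y.
Proof.
move=> c0 c'0 H; rewrite tensor_normE; apply: ge_inf => //; exists 0 => z.
exact: tensor_rep_ge0.
Qed.

Lemma tensor_norm_approx c c' P e : 0 <= c -> 0 <= c' -> pol_entire P -> 0 < e ->
  exists2 y, tensor_rep c c' P y & y < tensor_norm F r r' c c' P + e.
Proof.
move=> c0 c'0 p e0; rewrite tensor_normE.
have [|y] := @inf_adherent R [set y | tensor_rep c c' P y] e e0; last by exists y.
split; first exact: tensor_rep_exists.
by exists 0 => z; exact: tensor_rep_ge0.
Qed.

Lemma tensor_norm_tens c c' phi v : 0 <= c -> 0 <= c' -> entire F r phi ->
  tensor_norm F r r' c c' (tens phi v) <= qnorm F r c phi * sym_norm r' c' v.
Proof. by move=> c0 c'0 e; apply: tensor_norm_le => //; exact: tensor_rep_tens. Qed.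

Lemma tensor_normD c c' P Q : 0 <= c -> 0 <= c' -> pol_entire P -> pol_entire Q ->
  tensor_norm F r r' c c' (P + Q) <= tensor_norm F r r' c c' P + tensor_norm F r r' c c' Q.
Proof.
move=> c0 c'0 p q; apply/ler_addgt0Pr => e e0; have e2 : 0 < e / 2 by rewrite divr_gt0.
have [y Py yl] := tensor_norm_approx c0 c'0 p e2; have [z Qz zl] := tensor_norm_approx c0 c'0 q e2.
apply: le_trans (tensor_norm_le c0 c'0 (tensor_repD Py Qz)) _.
move: (tensor_norm _ _ _ _ _ _) (tensor_norm _ _ _ _ _ _) yl zl => a b yl zl; lra.
Qed.

Lemma tensor_norm0 c c' : 0 <= c -> 0 <= c' -> tensor_norm F r r' c c' 0 = 0.
Proof.
move=> c0 c'0; apply/eqP; rewrite eq_le tensor_norm_ge0 // andbT.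
by apply: tensor_norm_le => //; exact: tensor_rep0.
Qed.

Lemma tensor_norm_sum c c' (I : Type) (s : seq I) (f : I -> @polFun R n G) :
  0 <= c -> 0 <= c' -> (forall i, pol_entire (f i)) ->
  tensor_norm F r r' c c' (\sum_(i <- s) f i) <= \sum_(i <- s) tensor_norm F r r' c c' (f i).
Proof.
move=> c0 c'0 p; elim: s => [|i s IH]; first by rewrite !big_nil tensor_norm0.
rewrite !big_cons; apply: le_trans (tensor_normD _ _ _ _) _ => //.
  exact: pol_entire_sum.
by rewrite lerD2l.
Qed.

(** The multiple is described by its coefficients, in line with [lincomb]; any decomposition of [P]
    is scaled in its function factors. *)
Lemma tensor_norm_scale c c' P Q (a : C) : 0 <= c -> 0 <= c' -> pol_entire P ->
  (forall m, mcoeff m Q = a *: mcoeff m P) ->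
  tensor_norm F r r' c c' Q <= cabs a * tensor_norm F r r' c c' P.
Proof.
move=> c0 c'0 p E.
have H y : tensor_rep c c' P y -> tensor_norm F r r' c c' Q <= cabs a * y.
  move=> [N [phi [v [ep EP ->]]]]; apply: (@le_trans _ _
     (\sum_(i < N) qnorm F r c (fun x => a * phi i x) * sym_norm r' c' (v i))).
    apply: (tensor_norm_le c0 c'0); exists N, (fun i x => a * phi i x), v; split; last by [].
      by move=> i; exact: entireZ.
    apply/malgP => m; rewrite E EP [X in _ *: X]raddf_sum [RHS]raddf_sum scaler_sumr; apply: eq_bigr => i _.
    by rewrite [RHS]mcoeff_tens [X in _ *: X]mcoeff_tens; apply/funext => x; exact: mulrCA.
  rewrite mulr_sumr; apply: ler_sum => i _; rewrite mulrA.
  by apply: ler_wpM2r; [exact: sym_norm_ge0|exact: qnormZ].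
apply/ler_addgt0Pr => e e0; have a0 := cabs_ge0 a.
(* The summand 1 keeps the denominator positive when a = 0. *)
have e1 : 0 < e / (1 + cabs a) by rewrite divr_gt0 // ltr_wpDr.
have [y Py yl] := tensor_norm_approx c0 c'0 p e1; apply: le_trans (H y Py) _.
apply: le_trans (ler_wpM2l a0 (ltW yl)) _.
rewrite mulrDr lerD2l mulrA ler_pdivrMr ?ltr_wpDr // mulrC.
by apply: ler_wpM2l; [exact: ltW|rewrite lerDr].
Qed.

Lemma sym_norm_mono c1 c2 v : 0 <= c1 -> c1 <= c2 -> sym_norm r' c1 v <= sym_norm r' c2 v.
Proof.
move=> c0 c12; rewrite !sym_normE; apply: le_wnorm => m.
by rewrite ler_wpM2l ?powR_ge0 // lerXn2r // nnegrE // (le_trans c0).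
Qed.

Lemma tensor_norm_mono c1 c1' c2 c2' P : 0 <= c1 -> 0 <= c1' -> c1 <= c2 -> c1' <= c2' ->
  pol_entire P -> tensor_norm F r r' c1 c1' P <= tensor_norm F r r' c2 c2' P.
Proof.
move=> c0 c'0 c12 c12' p; apply/ler_addgt0Pr => e e0.
have d0 : 0 <= c2 by apply: le_trans c12.
have d'0 : 0 <= c2' by apply: le_trans c12'.
have [y [N [phi [v [ep -> ->]]]] yl] := tensor_norm_approx d0 d'0 p e0.
apply: le_trans (ltW yl); apply: (@le_trans _ _
     (\sum_(i < N) qnorm F r c1 (phi i) * sym_norm r' c1' (v i))).
  by apply: tensor_norm_le => //; exists N, phi, v.
apply: ler_sum => i _; apply: ler_pM; rewrite ?sym_norm_ge0 ?qnorm_ge0 //.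
  exact: (@qnorm_mono _ _ _ F r c1 c2).
exact: sym_norm_mono.
Qed.

End TensorNorm.

(** * The standard-ordered star product *)

Section Multilinear.
Context {R : realType} {n k : nat}.
Let C := cplx R.
Implicit Types (xi : 'I_k -> 'rV[R]_n).

Definition upd xi (j : 'I_k) (v : 'rV[R]_n) : 'I_k -> 'rV[R]_n :=
  fun i => if i == j then v else xi i.

Definition multilin (f : ('I_k -> 'rV[R]_n) -> C) : Prop := forall xi j,
  f xi = \sum_i creal (xi j 0 i) * f (upd xi j (basis_vec i)).

(** Slots are replaced by basis vectors one at a time; [t] counts the leading slots that may still
    be arbitrary. *)
Lemma multilin_ext f g : multilin f -> multilin g ->
  (forall u : 'I_k -> 'I_n, f (fun j => basis_vec (u j)) = g (fun j => basis_vec (u j))) ->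
  forall xi, f xi = g xi.
Proof.
move=> mf mg H xi.
have E (t : nat) : (t <= k)%N -> forall xi,
    (forall j : 'I_k, (t <= j)%N -> exists i, xi j = basis_vec i) -> f xi = g xi.
  elim: t => [|t IH] tk {}xi Hxi.
    have /choice[u Hu] : forall j, exists i, xi j = basis_vec i by move=> j; exact: Hxi.
    by have -> : xi = (fun j => basis_vec (u j)) by apply/funext.
  rewrite (mf xi (Ordinal tk)) (mg xi (Ordinal tk)); apply: eq_bigr => i _; congr (_ * _).
  apply: (IH (ltnW tk)) => j tj; rewrite /upd; case: eqP => [_|jt]; first by exists i.
  apply: Hxi; rewrite ltn_neqAle tj andbT; apply/eqP => tj'; apply: jt.
  exact/val_inj.
by apply: (E k) => // j; rewrite leqNgt ltn_ord.
Qed.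

Definition seq_multilin (f : seq 'rV[R]_n -> C) : Prop := forall s1 v s2,
  f (s1 ++ v :: s2) = \sum_i creal (v 0 i) * f (s1 ++ basis_vec i :: s2).

(** Each slot occurs at exactly one position of the permuted sequence, so expanding there expands
    that slot alone. *)
Lemma seq_multilin_perm (f : seq 'rV[R]_n -> C) (s : 'S_k) : seq_multilin f ->
  multilin (fun xi => f [seq xi (s j) | j <- enum 'I_k]).
Proof.
move=> mf xi j; set j' := (s^-1)%g j.
have sj : s j' = j by rewrite /j' permKV.
have off v : forall i, i != j' -> upd xi j v (s i) = xi (s i).
  by move=> i ij; rewrite /upd -sj (inj_eq perm_inj) (negPf ij).
have : j' \in enum 'I_k by rewrite mem_enum.
move: (enum 'I_k) (enum_uniq 'I_k) => e ue ej; case/splitPr: ej ue => e1 e2.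
rewrite cat_uniq /= => /and3P[_ /norP[n1 _] /andP[n2 _]].
rewrite map_cat /= sj mf; apply: eq_bigr => i _; congr (_ * _).
rewrite map_cat /= {2}/upd sj eqxx; congr (f (_ ++ _ :: _)); apply/eq_in_map => l le; rewrite off //.
  by apply: contraNneq n1 => <-.
by apply: contraNneq n2 => <-.
Qed.

Lemma multilin_sum (I : Type) (s : seq I) (f : I -> ('I_k -> 'rV[R]_n) -> C) :
  (forall i, multilin (f i)) -> multilin (fun xi => \sum_(i <- s) f i xi).
Proof.
move=> H xi j; under [RHS]eq_bigr do rewrite mulr_sumr; rewrite exchange_big.
by apply: eq_bigr => i _; exact: H.
Qed.

Lemma multilinZ (a : C) (f : ('I_k -> 'rV[R]_n) -> C) :
  multilin f -> multilin (fun xi => a * f xi).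
Proof. by move=> H xi j; rewrite (H xi j) mulr_sumr; apply: eq_bigr => i _; exact: mulrCA. Qed.

Lemma symVec_lin (v : 'rV[R]_n) :
  symVec (cvec v) = \sum_i creal (v 0 i) *: symVec (cvec (basis_vec i)) :> symAlg R n.
Proof.
rewrite {1}/symVec; apply: eq_bigr => i _; rewrite symVecE /smon mxE; exact: mkmalgU_scale.
Qed.

Lemma prod_upd (A : comPzRingType) (f : 'rV[R]_n -> A) xi j v :
  \prod_(l < k) f (upd xi j v l) = f v * \prod_(l < k | l != j) f (xi l).
Proof.
rewrite (bigD1 j) //= {1}/upd eqxx; congr (_ * _).
by apply: eq_bigr => l lj; rewrite /upd (negPf lj).
Qed.

Lemma multilin_symVec (phi : cmonom 'I_n -> C) :
  multilin (fun xi => lext (phi : cmonom 'I_n -> C^o) (\prod_(j < k) symVec (cvec (xi j)))).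
Proof.
move=> xi j; pose B : symAlg R n := \prod_(l < k | l != j) symVec (cvec (xi l)).
have E v : \prod_(l < k) symVec (cvec (upd xi j v l)) = symVec (cvec v) * B :> symAlg R n.
  exact: (@prod_upd (symAlg R n) (fun v => symVec (cvec v)) xi j v).
have xiE : upd xi j (xi j) = xi by apply/funext => l; rewrite /upd; case: eqP => // ->.
transitivity (lext (phi : cmonom 'I_n -> C^o) (symVec (cvec (xi j)) * B)).
  apply: f_equal; apply: etrans (E (xi j)); by rewrite xiE.
rewrite (f_equal (fun t => lext _ (t * B)) (symVec_lin (xi j))).
rewrite [X in lext _ X]mulr_suml lext_sum; apply: eq_bigr => i _.
rewrite -[X in lext _ X]fgscaleAl lextZ; apply: (f_equal2 *%R); first by [].
exact: (f_equal (lext _) (esym (E _))).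
Qed.

End Multilinear.

Section StarKernel.
Context {R : realType} {n : nat} {G : lieGroup R n} (F : frame G) (hbar : cplx R).
Let C := cplx R.
Let z := zpar hbar.
Implicit Types (phi psi : G -> C) (eta : symAlg R n) (mu : cmonom 'I_n) (x : G).

Definition star_term p psi eta mu x (l : seq 'rV[R]_n) : C :=
  mcoeff mu (gutt F z (\prod_(v <- drop p l) symVec (cvec v)) eta) * lies F (take p l) psi x.

(** The left function enters the star product only as a pointwise factor; what remains is this
    scalar kernel, for one coefficient [mu] at one point [x]. *)
Definition star_coef k psi eta mu x (xi : 'I_k -> 'rV[R]_n) : C :=
  \sum_(p < k.+1) \sum_(s : 'S_k)
    z ^+ p / (p`!%:R * (k - p)`!%:R) *
    star_term p psi eta mu x [seq xi (s j) | j <- enum 'I_k].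

Lemma mcoeff_std phi psi k (xi : 'I_k -> 'rV[R]_n) eta mu x :
  mcoeff mu (std_formula F hbar phi psi xi eta) x = phi x * star_coef psi eta mu x xi.
Proof.
have fsum (I : Type) (s : seq I) (f : I -> G -> C) : (\sum_(i <- s) f i) x = \sum_(i <- s) f i x.
  by elim: s => [|i s IH]; rewrite ?big_nil // !big_cons -IH.
rewrite /std_formula raddf_sum fsum mulr_sumr; apply: eq_bigr => p _.
rewrite raddf_sum fsum mulr_sumr; apply: eq_bigr => s _ /=.
rewrite [mcoeff _ _]mcoeff_tens /star_term -/z.
set a := mcoeff _ _; rewrite -[LHS]/(a * (z ^+ p / (p`!%:R * (k - p)`!%:R) * (phi x * lies F _ psi x))).
move: (z ^+ p / _) (lies F _ psi x) (phi x) a => c l f a; ring.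
Qed.

Lemma sym_scale (a : C) (s t u : symAlg R n) : s * ((a *: t) * u) = a *: (s * (t * u)).
Proof.
have E : (a *: t) * u = a *: (t * u) by exact/esym/fgscaleAl.
apply: etrans (f_equal ( *%R s) E) _; apply: etrans (mulrC s _) _.
apply: etrans (esym (fgscaleAl _ _ _)) _; apply: (f_equal ( *:%R a)); exact: mulrC.
Qed.

Lemma seq_multilin_term p psi eta mu x : analytic_fun psi -> seq_multilin (star_term p psi eta mu x).
Proof.
move=> ap s1 v s2; rewrite /star_term.
case: (leqP p (size s1)) => ps.
  have tE u : take p (s1 ++ u :: s2) = take p s1 by rewrite takel_cat.
  have dE u : drop p (s1 ++ u :: s2) = drop p s1 ++ u :: s2.
    move: ps; rewrite drop_cat leq_eqVlt; case: ltnP => // h; rewrite orbF => /eqP ->.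
    by rewrite subnn drop_size.
  under [RHS]eq_bigr do rewrite tE dE mulrA -mcoeffZ.
  rewrite -mulr_suml tE dE; congr (_ * _); rewrite -raddf_sum; congr (mcoeff mu _).
  rewrite big_cat big_cons /= symVec_lin mulr_suml mulr_sumr gutt_suml; apply: eq_bigr => i _.
  rewrite sym_scale guttZl; apply: (f_equal (fun t => creal _ *: gutt F z t eta)).
  by rewrite big_cat big_cons /=.
have tE u : take p (s1 ++ u :: s2) = s1 ++ u :: take (p - size s1).-1 s2.
  rewrite take_cat ltnNge (ltnW ps) /=; case E : (p - size s1)%N => [|q] //=.
  by move: E ps => /eqP; rewrite subn_eq0 leqNgt => /negPf ->.
have dE u : drop p (s1 ++ u :: s2) = drop (p - size s1).-1 s2.
  rewrite drop_cat ltnNge (ltnW ps) /=; case E : (p - size s1)%N => [|q] //=.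
  by move: E ps => /eqP; rewrite subn_eq0 leqNgt => /negPf ->.
rewrite tE dE lies_multilin; last exact: ap.
under [RHS]eq_bigr do rewrite tE dE; move: (mcoeff _ _) => a.
rewrite -[LHS]/(a * \sum_i creal (v 0 i) * lies F (s1 ++ basis_vec i :: take (p - size s1).-1 s2) psi x).
by rewrite mulr_sumr; apply: eq_bigr => i _; exact: mulrCA.
Qed.

Lemma multilin_star_coef k psi eta mu x : analytic_fun psi ->
  multilin (@star_coef k psi eta mu x).
Proof.
move=> ap; apply: multilin_sum => p; apply: multilin_sum => s; apply: multilinZ.
by apply: (@seq_multilin_perm _ _ _ (star_term p psi eta mu x)); exact: seq_multilin_term.
Qed.

Lemma star_coef_perm k psi eta mu x (xi : 'I_k -> 'rV[R]_n) (t : 'S_k) :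
  star_coef psi eta mu x (xi \o t) = star_coef psi eta mu x xi.
Proof.
apply: eq_bigr => p _; rewrite [RHS](reindex_inj (mulIg t)); apply: eq_bigr => s _.
congr (_ * star_term _ _ _ _ _ _); apply: eq_map => j; by rewrite permM.
Qed.

Definition star_word psi eta mu x (w : seq 'I_n) : C :=
  star_coef psi eta mu x (fun j : 'I_(size w) => basis_vec (tnth (in_tuple w) j)).

Lemma star_word_tuple psi eta mu x k (t : k.-tuple 'I_n) :
  star_word psi eta mu x t = star_coef psi eta mu x (fun j => basis_vec (tnth t j)).
Proof.
rewrite /star_word; case: t => w wk; have wk' := eqP wk; subst k => /=.
by congr star_coef; apply/funext => j; congr (basis_vec (tnth _ _)); apply: val_inj.
Qed.

Lemma star_word_perm psi eta mu x w w' : perm_eq w w' ->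
  star_word psi eta mu x w = star_word psi eta mu x w'.
Proof.
move=> /(@tuple_permP _ _ _ (in_tuple w')) [p ->]; rewrite star_word_tuple.
rewrite /star_word -[RHS](star_coef_perm _ _ _ _ _ p).
by congr star_coef; apply/funext => j; rewrite tnth_mktuple.
Qed.

(** Well-definedness on Sym(g): both sides are multilinear in [xi], and on basis vectors the kernel
    depends only on the monomial because it is invariant under permutations. *)
Lemma star_coefE k psi eta mu x (xi : 'I_k -> 'rV[R]_n) : analytic_fun psi ->
  lext (fun m => star_word psi eta mu x (cmonom_word m) : C^o)
    (\prod_(j < k) symVec (cvec (xi j))) = star_coef psi eta mu x xi.
Proof.
move=> ap; move: xi; apply: multilin_ext; first exact: multilin_symVec.
  exact: multilin_star_coef.
move=> u; pose t := [tuple u j | j < k].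
have -> : \prod_(j < k) symVec (cvec (basis_vec (u j))) = smon (cword t) :> symAlg R n.
  rewrite smon_cword big_tuple; apply: eq_bigr => j _; rewrite tnth_mktuple; exact: symVecE.
rewrite lextU scale1r (star_word_perm _ _ _ _ (cmonom_wordK _)) star_word_tuple.
by congr star_coef; apply/funext => j; rewrite tnth_mktuple.
Qed.

Lemma star_term_psi p l (a : C) psi psi' eta mu x : analytic_fun psi -> analytic_fun psi' ->
  star_term p (fun y => a * psi y + psi' y) eta mu x l =
  a * star_term p psi eta mu x l + star_term p psi' eta mu x l.
Proof. by move=> p1 p2; rewrite /star_term lies_lin // mulrDr mulrCA. Qed.

Lemma star_term_eta p l (a : C) psi eta eta' mu x :
  star_term p psi (a *: eta + eta') mu x l =
  a * star_term p psi eta mu x l + star_term p psi eta' mu x l.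
Proof. by rewrite /star_term gutt_linr mcoeffD mcoeffZ mulrDl mulrA. Qed.

Let sum_lin k (f g h : 'I_k.+1 -> 'S_k -> C) (b : 'I_k.+1 -> C) a :
  (forall p s, f p s = a * g p s + h p s) ->
  \sum_p \sum_s b p * f p s = a * (\sum_p \sum_s b p * g p s) + \sum_p \sum_s b p * h p s.
Proof.
move=> H; rewrite mulr_sumr -big_split; apply: eq_bigr => p _ /=.
rewrite mulr_sumr -big_split; apply: eq_bigr => s _ /=.
by rewrite H mulrDr mulrCA.
Qed.

Lemma star_coef_psi k (xi : 'I_k -> 'rV[R]_n) (a : C) psi psi' eta mu x :
  analytic_fun psi -> analytic_fun psi' ->
  star_coef (fun y => a * psi y + psi' y) eta mu x xi =
  a * star_coef psi eta mu x xi + star_coef psi' eta mu x xi.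
Proof. by move=> p1 p2; apply: sum_lin => p s; exact: star_term_psi. Qed.

Lemma star_coef_eta k (xi : 'I_k -> 'rV[R]_n) (a : C) psi eta eta' mu x :
  star_coef psi (a *: eta + eta') mu x xi =
  a * star_coef psi eta mu x xi + star_coef psi eta' mu x xi.
Proof. by apply: sum_lin => p s; exact: star_term_eta. Qed.

End StarKernel.

Lemma mcoeff_eq_fun (R : realType) n (G : lieGroup R n) (P Q : @polFun R n G) :
  (forall m x, mcoeff m P x = mcoeff m Q x) -> P = Q.
Proof. by move=> H; apply/malgP => m; apply/funext => x; exact: H. Qed.

Section Star.
Context {R : realType} {n : nat} {G : lieGroup R n} (F : frame G) (r : R) (hbar : cplx R).
Hypothesis r0 : 0 <= r.
Let C := cplx R.
Let z := zpar hbar.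
Implicit Types (phi psi : G -> C) (P Q S : @polFun R n G) (eta v : symAlg R n)
  (mu m : cmonom 'I_n) (x : G) (a : C).

Definition std_word phi psi (w : seq 'I_n) eta : @polFun R n G :=
  std_formula F hbar phi psi (fun j : 'I_(size w) => basis_vec (tnth (in_tuple w) j)) eta.

(** Defined on monomial expansions, so that no decomposition into tensors has to be chosen;
    [pstar_formula] recovers the prescribed formula for arbitrary factors. *)
Definition pstar P Q : @polFun R n G :=
  \sum_(m <- finmap.enum_fset (msupp P)) \sum_(m' <- finmap.enum_fset (msupp Q))
    std_word (mcoeff m P) (mcoeff m' Q) (cmonom_word m) (smon m').

Definition star_right Q mu x m : C :=
  \sum_(m' <- finmap.enum_fset (msupp Q))
    star_word F hbar (mcoeff m' Q) (smon m') mu x (cmonom_word m).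

Let fsum (I : Type) (s : seq I) (f : I -> G -> C) x : (\sum_(i <- s) f i) x = \sum_(i <- s) f i x.
Proof. by elim: s => [|i s IH]; rewrite ?big_nil // !big_cons -IH. Qed.

Lemma mcoeff_pstar P Q mu x : mcoeff mu (pstar P Q) x =
  \sum_(m <- finmap.enum_fset (msupp P)) mcoeff m P x * star_right Q mu x m.
Proof.
rewrite /pstar raddf_sum fsum; apply: eq_bigr => m _.
rewrite raddf_sum fsum mulr_sumr; apply: eq_bigr => m' _; exact: mcoeff_std.
Qed.

Lemma pol_entire_std phi psi w eta : entire F r phi -> entire F r psi ->
  pol_entire F r (std_word phi psi w eta).
Proof.
move=> ep eq; rewrite /std_word /std_formula; apply: pol_entire_sum => p _; apply: pol_entire_sum => s _.
apply: pol_entire_tens; apply: entireZ; apply: (entireM r0) => //.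
rewrite (map_comp (@basis_vec R n) (fun j => tnth (in_tuple w) (s j))) -map_take.
exact: entire_lies.
Qed.

Lemma pol_entire_star P Q : pol_entire F r P -> pol_entire F r Q -> pol_entire F r (pstar P Q).
Proof.
move=> p q; rewrite /pstar; apply: pol_entire_sum => m _; apply: pol_entire_sum => m' _.
exact: pol_entire_std.
Qed.

Lemma star_word0 eta mu x w : star_word F hbar (0 : G -> C) eta mu x w = 0.
Proof.
rewrite /star_word /star_coef big1 // => p _; rewrite big1 // => s _.
by rewrite /star_term -[0 : G -> C]/(fun=> 0) lies0 mulr0 mulr0.
Qed.

Definition pol_analytic P : Prop := forall m, analytic_fun (mcoeff m P).

Lemma star_right_lin a Q Q' S mu x m : pol_analytic Q -> pol_analytic Q' ->
  (forall m, mcoeff m S = a *: mcoeff m Q + mcoeff m Q') ->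
  star_right S mu x m = a * star_right Q mu x m + star_right Q' mu x m.
Proof.
move=> q q' E; pose D := fsetU (msupp S) (fsetU (msupp Q) (msupp Q')).
pose f (b : G -> C) m' := star_word F hbar b (smon m') mu x (cmonom_word m).
have W T : fsubset (msupp T) D -> star_right T mu x m = \sum_(m' <- finmap.enum_fset D) f (mcoeff m' T) m'.
  by move=> TD; rewrite (@sum_msupp _ _ _ T D f) // => m'; exact: star_word0.
rewrite !W; last 3 first.
- by rewrite /D fsetUA fsubsetUr.
- by rewrite /D fsetUCA fsubsetUl.
- by rewrite /D fsubsetUl.
rewrite mulr_sumr -big_split; apply: eq_bigr => m' _; rewrite E.
exact: star_coef_psi.
Qed.

Lemma pstar_linr a P Q Q' S mu : pol_analytic Q -> pol_analytic Q' ->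
  (forall m, mcoeff m S = a *: mcoeff m Q + mcoeff m Q') ->
  mcoeff mu (pstar P S) = a *: mcoeff mu (pstar P Q) + mcoeff mu (pstar P Q').
Proof.
move=> q q' E; apply/funext => x.
rewrite -[RHS]/(a * mcoeff mu (pstar P Q) x + mcoeff mu (pstar P Q') x).
apply: etrans (mcoeff_pstar P S mu x) _.
refine (etrans _ (f_equal2 (fun s t => a * s + t) (esym (mcoeff_pstar P Q mu x))
  (esym (mcoeff_pstar P Q' mu x)))).
rewrite mulr_sumr -big_split; apply: eq_bigr => m _.
by rewrite (star_right_lin mu x m q q' E) mulrDr mulrCA.
Qed.

Lemma pstar_linl a P P' S Q mu :
  (forall m, mcoeff m S = a *: mcoeff m P + mcoeff m P') ->
  mcoeff mu (pstar S Q) = a *: mcoeff mu (pstar P Q) + mcoeff mu (pstar P' Q).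
Proof.
move=> E; apply/funext => x.
rewrite -[RHS]/(a * mcoeff mu (pstar P Q) x + mcoeff mu (pstar P' Q) x).
apply: etrans (mcoeff_pstar S Q mu x) _.
refine (etrans _ (f_equal2 (fun s t => a * s + t) (esym (mcoeff_pstar P Q mu x))
  (esym (mcoeff_pstar P' Q mu x)))).
pose D := fsetU (msupp S) (fsetU (msupp P) (msupp P')).
have W T : fsubset (msupp T) D -> \sum_(m <- finmap.enum_fset (msupp T)) mcoeff m T x * star_right Q mu x m
    = \sum_(m <- finmap.enum_fset D) mcoeff m T x * star_right Q mu x m.
  move=> TD; rewrite (@sum_msupp _ _ _ T D (fun b m => b x * star_right Q mu x m)) // => m.
  exact: mul0r.
rewrite !W; last 3 first.
- by rewrite /D fsetUA fsubsetUr.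
- by rewrite /D fsetUCA fsubsetUl.
- by rewrite /D fsubsetUl.
rewrite mulr_sumr -big_split; apply: eq_bigr => m _; rewrite E.
exact: etrans (mulrDl _ _ _) (f_equal (+%R^~ _) (esym (mulrA _ _ _))).
Qed.

Lemma star_word_lext psi eta mu x w :
  star_word F hbar psi eta mu x w =
  lext (fun m' => star_word F hbar psi (smon m') mu x w : C^o) eta.
Proof.
have f0 : star_word F hbar psi 0 mu x w = 0.
  (* Linearity with scalar -1 at zero arguments gives the value 0 at 0. *)
  have := star_coef_eta F hbar (fun j => basis_vec (tnth (in_tuple w) j)) (-1) psi 0 0 mu x.
  by rewrite scaler0 addr0 mulN1r addNr.
rewrite {1}(malg_lext eta) /lext.
elim: (finmap.enum_fset _) => [|m' s IH]; first by rewrite !big_nil.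
rewrite [X in star_word _ _ _ X](big_cons) [RHS]big_cons -IH.
exact: star_coef_eta.
Qed.

Lemma star_right_tens psi eta mu x m : analytic_fun psi ->
  star_right (tens psi eta) mu x m = star_word F hbar psi eta mu x (cmonom_word m).
Proof.
move=> ap; pose D := fsetU (msupp (tens psi eta)) (msupp eta).
pose f (b : G -> C) m' := star_word F hbar b (smon m') mu x (cmonom_word m).
rewrite star_word_lext (@lextw _ _ _ _ _ D) ?fsubsetUr //.
rewrite /star_right -(@sum_msupp _ _ _ (tens psi eta) D f) ?fsubsetUl //; last first.
  by move=> m'; exact: star_word0.
apply: eq_bigr => m' _; rewrite mcoeff_tens /f.
have c0 : analytic_fun ((fun=> 0) : G -> C) by exact: analytic_fun_cst.
have := star_coef_psi F hbar (fun j => basis_vec (tnth (in_tuple (cmonom_word m)) j))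
  (mcoeff m' eta) (smon m') mu x ap (analytic_fun_cst (0 : C)).
rewrite -![star_coef _ _ _ _ _ _ _]/(star_word _ _ _ _ _ _ _).
rewrite -[X in _ + X]/(star_word F hbar (0 : G -> C) (smon m') mu x (cmonom_word m)) star_word0 addr0.
move=> E; refine (etrans _ E); rewrite /star_word; congr star_coef; apply/funext => y; exact/esym/addr0.
Qed.

(** The monomial expansions are resummed: on the right by linearity in [eta], on the left by
    [star_coefE]. *)
Lemma pstar_formula phi psi k (xi : 'I_k -> 'rV[R]_n) eta : analytic_fun psi ->
  pstar (tens phi (\prod_(j < k) symVec (cvec (xi j)))) (tens psi eta) =
  std_formula F hbar phi psi xi eta.
Proof.
move=> ap; apply: mcoeff_eq_fun => mu x; rewrite [RHS]mcoeff_std -star_coefE //.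
move: (\prod_(j < k) _) => v.
rewrite mcoeff_pstar; under eq_bigr do rewrite star_right_tens //.
pose D := fsetU (msupp (tens phi v)) (msupp v).
rewrite (@lextw _ _ _ _ _ D) ?fsubsetUr // mulr_sumr.
pose f (b : G -> C) m := b x * star_word F hbar psi eta mu x (cmonom_word m).
rewrite -(@sum_msupp _ _ _ (tens phi v) D f) ?fsubsetUl //; last first.
  by move=> m; exact: mul0r.
apply: eq_bigr => m _; rewrite mcoeff_tens /f mulrCA; exact/esym/mulrA.
Qed.

End Star.

(** * Weights on degrees and the estimate of the star product *)

Section Weights.
Context {R : realType}.

Definition sweight (r' c : R) (k : nat) : R := (k`!)%:R `^ r' * c ^+ k.

Lemma sweight_ge0 r' c k : 0 <= c -> 0 <= sweight r' c k.
Proof. by move=> c0; rewrite mulr_ge0 ?powR_ge0 ?exprn_ge0. Qed.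

(** The step from k to k+1 multiplies the weight by lam (k+1)^r', which is at least lam k because r'
    >= 1. *)
Lemma sweight_adm n (G : lieGroup R n) (F : frame G) (z : cplx R) (r' c lam : R) :
  1 <= r' -> 0 <= lam -> 2 * (cabs z * struct_bound F) <= lam -> adm_weight F z (sweight r' lam).
Proof.
move=> r1 l0 zl; split=> k; first exact: sweight_ge0.
rewrite /sweight factS natrM powRM // exprS.
have E : k.+1%:R `^ r' * (k`!)%:R `^ r' * (lam * lam ^+ k) =
   (lam * (k.+1%:R `^ r')) * ((k`!)%:R `^ r' * lam ^+ k) by ring.
rewrite E; apply: ler_wpM2r; first exact: sweight_ge0.
apply: ler_pM => //; first by rewrite !mulr_ge0 ?cabs_ge0 ?struct_bound_ge0.
apply: (@le_trans _ _ k.+1%:R); first by rewrite ler_nat.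
by apply: le_trans (ler_powR _ r1); rewrite ?powRr1 ?ler1n.
Qed.

Lemma fact_add_le (r' : R) k l : 0 <= r' ->
  ((k + l)`!)%:R `^ r' <= (2 `^ r') ^+ (k + l) * ((k`!)%:R `^ r' * (l`!)%:R `^ r').
Proof.
move=> r0; have kE : ((k + l)`!)%:R = ('C(k + l, k))%:R * ((k`!)%:R * (l`!)%:R) :> R.
  rewrite -!natrM; have := @bin_fact (k + l) k (leq_addr _ _).
  by rewrite addKn => <-.
rewrite kE !powRM ?mulr_ge0 //; apply: ler_wpM2r; first by rewrite mulr_ge0 ?powR_ge0.
rewrite -powR_mulrn ?powR_ge0 // -powRrM [r' * _]mulrC powRrM powR_mulrn //.
by apply: ge0_ler_powR; rewrite ?nnegrE ?exprn_ge0 // -natrX ler_nat bin_le_exp2.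
Qed.

(** The binomial bound separates the factorials. The factor 2^j stems from the Gutt estimate;
    enlarging it to 2^(l+j) lets both degrees carry the same dilation. *)
Lemma sweight_add (r' lam : R) j l : 1 <= r' -> 0 <= lam ->
  2 ^+ j * sweight r' lam (l + j) <=
  sweight r' (2 * 2 `^ r' * lam) l * sweight r' (2 * 2 `^ r' * lam) j.
Proof.
move=> r1 l0; have r0 : 0 <= r' by apply: le_trans r1.
have := fact_add_le l j r0 => H; rewrite /sweight.
apply: (@le_trans _ _ (2 ^+ j * ((2 `^ r') ^+ (l + j) * ((l`!)%:R `^ r' * (j`!)%:R `^ r') * lam ^+ (l + j)))).
  by rewrite ler_wpM2l ?exprn_ge0 // ler_wpM2r ?exprn_ge0.
have -> : (l`!)%:R `^ r' * (2 * 2 `^ r' * lam) ^+ l * ((j`!)%:R `^ r' * (2 * 2 `^ r' * lam) ^+ j) =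
   2 ^+ l * (2 ^+ j * ((2 `^ r') ^+ (l + j) * ((l`!)%:R `^ r' * (j`!)%:R `^ r') * lam ^+ (l + j))).
  rewrite !exprMn !exprD; ring.
rewrite ler_peMl ?exprn_ege1 ?ler1n //.
by rewrite !mulr_ge0 ?exprn_ge0 ?powR_ge0.
Qed.

(* the factor k!/(k-p)! is absorbed because r' >= 1 *)
Lemma sweight_drop (r' L : R) k p : 1 <= r' -> 1 <= L -> (p <= k)%N ->
  (k`!)%:R / ((k - p)`!)%:R * sweight r' L (k - p) <= sweight r' L k.
Proof.
move=> r1 L1 pk; have q0 := fact_gt0R (R := R) (k - p); have k0 := fact_gt0R (R := R) k.
have H : fweight r' (k - p) <= fweight r' k.
  apply: ge0_ler_powR; rewrite ?nnegrE ?ler0n ?subr_ge0 // ler_nat.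
  exact/leq_fact/leq_subr.
move: H; rewrite !fweightE => H; rewrite /sweight mulrA.
apply: ler_pM; rewrite ?mulr_ge0 ?invr_ge0 ?powR_ge0 ?exprn_ge0 //.
- exact: le_trans L1.
- by rewrite mulrAC -mulrA mulrC -ler_pdivlMr.
by rewrite ler_weXn2l // leq_subr.
Qed.

(** The sharper bound 2 - 2 x^k is inductive, because 2 x^(k+1) <= x^k. *)
Lemma geom_half (x : R) k : 0 <= x -> 2 * x <= 1 -> \sum_(p < k) x ^+ p <= 2.
Proof.
move=> x0 x1; have E : \sum_(p < k) x ^+ p <= 2 - 2 * x ^+ k.
  elim: k => [|k IH]; first by rewrite big_ord0 expr0 mulr1 subrr.
  rewrite big_ord_recr /= exprS; apply: le_trans (lerD IH (lexx _)) _.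
  have := ler_wpM2r (exprn_ge0 k x0) x1; rewrite mul1r; move: (x ^+ k) => y; lra.
by apply: le_trans E _; rewrite gerBl mulr_ge0 ?exprn_ge0.
Qed.

End Weights.

Section StarBound.
Context {R : realType} {n : nat} {G : lieGroup R n} (F : frame G) (r r' c c' : R) (hbar : cplx R).
Hypotheses (r0 : 0 <= r) (r1 : 1 <= r') (c1 : 1 <= c) (c'1 : 1 <= c').
Let C := cplx R.
Let z := zpar hbar.
Implicit Types (phi psi : G -> C) (P Q : @polFun R n G).

(** The first summand serves Sym(g): an admissible parameter at least c', dilated by [sweight_add].
    The second serves the functions: 2^r c from the product, then 2 mu from the derivatives with mu
    = 2 |z| + 1. Their sum dominates both and is affine in |hbar|, hence continuous. *)
Definition star_radius : R := 2 * 2 `^ r' * (c' + 2 * (cabs z * struct_bound F)) +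
  2 * (2 `^ r * c) * (2 * cabs z + 1).
Let d := star_radius.
Let L : R := 2 * 2 `^ r' * (c' + 2 * (cabs z * struct_bound F)).
Let M : R := 2 * (2 `^ r * c) * (2 * cabs z + 1).

Let az0 : 0 <= cabs z := cabs_ge0 z.
Let sb0 : 0 <= struct_bound F := struct_bound_ge0 F.

Let pow1 (s : R) : 0 <= s -> 1 <= 2 `^ s.
Proof. by move=> s0; rewrite -[leLHS](powRr0 2) ler_powR ?ler1n. Qed.

Let L1 : 1 <= L.
Proof.
rewrite /L !mulr_ege1 ?pow1 ?ler1n ?(le_trans _ r1) //.
by apply: le_trans c'1 _; rewrite lerDl !mulr_ge0.
Qed.

Let rc1 : 1 <= 2 `^ r * c.
Proof. by rewrite mulr_ege1 ?pow1. Qed.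

Let mu1 : 1 <= 2 * cabs z + 1.
Proof. by rewrite lerDr mulr_ge0. Qed.

Let M1 : 1 <= M. Proof. by rewrite /M mulr_ege1 // mulr_ege1 // ler1n. Qed.

Lemma star_radius_ge1 : 1 <= star_radius.
Proof. by rewrite -[leLHS]addr0; apply: lerD L1 _; apply: le_trans M1. Qed.

Let d0 : 0 <= d. Proof. exact: le_trans star_radius_ge1. Qed.
Let Ld : L <= d. Proof. by rewrite /d /star_radius -/L lerDl; apply: le_trans M1. Qed.
Let Md : M <= d. Proof. by rewrite /d /star_radius -/M lerDr; apply: le_trans L1. Qed.
Let rcd : 2 `^ r * c <= d.
Proof.
apply: le_trans Md; have -> : M = 2 `^ r * c * (2 * (2 * cabs z + 1)) by rewrite /M; ring.
by rewrite ler_peMr ?mulr_ege1 ?ler1n // (le_trans _ rc1).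
Qed.

Let c'0 : 0 <= c'. Proof. exact: le_trans c'1. Qed.
Let c0 : 0 <= c. Proof. exact: le_trans c1. Qed.

Lemma sym_norm_gutt (w : seq 'I_n) m :
  sym_norm r' c' (gutt F z (smon (cword w)) (smon m)) <=
  sweight r' L (mdeg m) * sweight r' L (size w).
Proof.
set lam := c' + 2 * (cabs z * struct_bound F).
have l0 : 0 <= lam by rewrite addr_ge0 // !mulr_ge0.
have cl : c' <= lam by rewrite lerDl !mulr_ge0.
apply: le_trans (sweight_add (size w) (mdeg m) r1 l0).
apply: (@le_trans _ _ (sym_norm r' lam (gutt F z (smon (cword w)) (smon m)))).
  exact: sym_norm_mono.
rewrite sym_normE.
have aW : adm_weight F z (sweight r' lam).
  by apply: sweight_adm => //; rewrite lerDr.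
have := gutt_bound w (smon m) aW.
by rewrite {2}/symW wnormU cabs1 mul1r.
Qed.

(** The p! paid for p derivatives cancels the 1/p! of the formula, leaving x^p/(k-p)! for each
    permutation. The k! permutations produce k!/(k-p)!, which [sweight_drop] absorbs, and the sum
    over p is geometric. *)
Lemma std_word_bound phi psi (w : seq 'I_n) m : entire F r phi -> entire F r psi ->
  tensor_norm F r r' c c' (std_word F hbar phi psi w (smon m)) <=
  2 * (qnorm F r d phi * sweight r' d (size w)) * (qnorm F r d psi * sweight r' d (mdeg m)).
Proof.
move=> ep eq; set k := size w; set qp := qnorm F r d phi; set qq := qnorm F r d psi.
have qp0 : 0 <= qp by exact: qnorm_ge0.
have qq0 : 0 <= qq by exact: qnorm_ge0.
have mu0 : 0 < 2 * cabs z + 1 by apply: lt_le_trans mu1.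
(* The choice mu = 2 |z| + 1 makes this ratio at most 1/2 and also covers z = 0. *)
set x := cabs z / (2 * cabs z + 1).
have x0 : 0 <= x by rewrite divr_ge0 // ltW.
have x1 : 2 * x <= 1 by rewrite mulrA ler_pdivrMr // mul1r lerDl.
pose B p : R := x ^+ p / ((k - p)`!)%:R * (qp * qq) *
   (sweight r' L (mdeg m) * sweight r' L (k - p)).
have term p (s : 'S_k) : (p <= k)%N ->
   let xis := [seq basis_vec (tnth (in_tuple w) (s j)) | j <- enum 'I_k] in
   let chi := fun g => z ^+ p / (p`!%:R * (k - p)`!%:R) * (phi g * lies F (take p xis) psi g) in
   let eta := gutt F z (\prod_(v <- drop p xis) symVec (cvec v)) (smon m) in
   entire F r chi /\ tensor_norm F r r' c c' (tens chi eta) <= B p.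
  move=> pk xis chi eta.
  pose u := [seq tnth (in_tuple w) (s j) | j <- enum 'I_k].
  have xisE : xis = map (@basis_vec R n) u by rewrite /xis map_comp.
  have su : size u = k by rewrite size_map size_enum_ord.
  have tE : take p xis = map (@basis_vec R n) (take p u) by rewrite xisE map_take.
  have dE : drop p xis = map (@basis_vec R n) (drop p u) by rewrite xisE map_drop.
  have st : size (take p u) = p by rewrite size_takel // su.
  have sd : size (drop p u) = (k - p)%N by rewrite size_drop su.
  have el : entire F r (lies F (take p xis) psi) by rewrite tE; exact: entire_lies.
  have em := entireM r0 ep el.
  split; first exact: entireZ.
  apply: le_trans (tensor_norm_tens r' eta c0 c'0 (entireZ _ em)) _.
  apply: ler_pM; [exact: qnorm_ge0|exact: sym_norm_ge0| |].
    apply: le_trans (qnormZ _ c0 em) _.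
    have -> : x ^+ p / ((k - p)`!)%:R * (qp * qq) =
      cabs (z ^+ p / (p`!%:R * (k - p)`!%:R)) * (qp * (p`!%:R * (2 * cabs z + 1) ^- p * qq)).
      rewrite cabsM cabsV cabsM !cabs_nat cabsX /x expr_div_n.
      have := expf_neq0 p (lt0r_neq0 mu0); have := lt0r_neq0 (fact_gt0R (R := R) p).
      have := lt0r_neq0 (fact_gt0R (R := R) (k - p)).
      move: (_ ^+ p) (cabs z ^+ p) (p`!%:R) ((k - p)`!%:R) => a b e f f1 e1 a1.
      by field; rewrite f1 e1 a1.
    apply: ler_wpM2l; first exact: cabs_ge0.
    apply: le_trans (qnormM r0 c0 ep el) _.
    apply: ler_pM; [exact/qnorm_ge0/(le_trans _ rc1)|exact/qnorm_ge0/(le_trans _ rc1)| |].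
      by apply: qnorm_mono => //; apply: le_trans rc1.
    have := qnorm_lies r0 (take p u) rc1 mu1 eq; rewrite -tE st => H.
    apply: le_trans H _; apply: ler_wpM2l.
      by rewrite mulr_ge0 ?invr_ge0 ?exprn_ge0 // ltW.
    by apply: qnorm_mono => //; rewrite -/M; apply: le_trans M1.
  have -> : eta = gutt F z (smon (cword (drop p u))) (smon m).
    rewrite /eta dE big_map smon_cword; apply: (f_equal (fun t => gutt F z t _)).
    by apply: eq_bigr => i _; exact: symVecE.
  by rewrite -sd; exact: sym_norm_gutt.
apply: (@le_trans _ _ (\sum_(p < k.+1) \sum_(s : 'S_k) B p)).
  apply: le_trans (tensor_norm_sum _ _ c0 c'0 _) _.
    by move=> p; apply: pol_entire_sum => s _; apply: pol_entire_tens; case: (@term p s (leq_ord p)).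
  apply: ler_sum => p _; apply: le_trans (tensor_norm_sum _ _ c0 c'0 _) _.
    by move=> s; apply: pol_entire_tens; case: (@term p s (leq_ord p)).
  by apply: ler_sum => s _; case: (@term p s (leq_ord p)).
have Lk j : 0 <= sweight r' L j by apply: sweight_ge0; apply: le_trans L1.
have LD j : sweight r' L j <= sweight r' d j.
  rewrite ler_wpM2l ?powR_ge0 // lerXn2r // nnegrE //.
  exact: le_trans L1.
apply: (@le_trans _ _ (\sum_(p < k.+1) x ^+ p * (qp * qq * sweight r' L (mdeg m) * sweight r' L k))).
  apply: ler_sum => p _; rewrite sum_perm_const -[_ *+ _]mulr_natl /B.
  have H := sweight_drop r1 L1 (leq_ord p).
  have -> : k`!%:R * (x ^+ p / ((k - p)`!)%:R * (qp * qq) * (sweight r' L (mdeg m) * sweight r' L (k - p))) =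
    x ^+ p * (qp * qq * sweight r' L (mdeg m) * (k`!%:R / ((k - p)`!)%:R * sweight r' L (k - p))).
    move: (sweight _ _ _) (sweight _ _ _) (x ^+ p) => s1 s2 y; ring.
  by rewrite ler_wpM2l ?exprn_ge0 // ler_wpM2l // mulr_ge0 // mulr_ge0.
rewrite -mulr_suml.
apply: (@le_trans _ _ (2 * (qp * qq * sweight r' L (mdeg m) * sweight r' L k))).
  rewrite ler_wpM2r ?geom_half //; apply: mulr_ge0 => //; apply: mulr_ge0 => //.
  exact: mulr_ge0.
have -> : 2 * (qp * sweight r' d k) * (qq * sweight r' d (mdeg m)) =
  2 * (qp * qq * sweight r' d (mdeg m) * sweight r' d k).
  move: (sweight _ _ _) (sweight _ _ _) => s1 s2; ring.
apply: ler_wpM2l => //; have qpq0 : 0 <= qp * qq by exact: mulr_ge0.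
by apply: ler_pM => //; [exact: mulr_ge0|exact: ler_wpM2l].
Qed.

Definition wpol P : R :=
  \sum_(m <- finmap.enum_fset (msupp P)) qnorm F r d (mcoeff m P) * sweight r' d (mdeg m).

Let q00 : qnorm F r d (0 : G -> C) = 0.
Proof.
apply/eqP; rewrite eq_le qnorm_ge0 // andbT.
have E : (fun x : G => (0 : C) * 0) = (0 : G -> C) by apply/funext => x; exact: mul0r.
by have := qnormZ (0 : C) d0 (entire0 F r); rewrite E cabs0 mul0r.
Qed.

Lemma wpolw P (D : {fset cmonom 'I_n}) : fsubset (msupp P) D ->
  wpol P = \sum_(m <- finmap.enum_fset D) qnorm F r d (mcoeff m P) * sweight r' d (mdeg m).
Proof.
move=> PD; rewrite (@sum_msupp _ _ _ P D (fun b m => qnorm F r d b * sweight r' d (mdeg m))) //.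
by move=> m; rewrite q00 mul0r.
Qed.

Lemma wpolD P Q : pol_entire F r P -> pol_entire F r Q -> wpol (P + Q) <= wpol P + wpol Q.
Proof.
move=> p q; pose D := fsetU (msupp (P + Q)) (fsetU (msupp P) (msupp Q)).
rewrite !(@wpolw _ D); last 3 first.
- by rewrite /D fsetUA fsubsetUr.
- by rewrite /D fsetUCA fsubsetUl.
- by rewrite /D fsubsetUl.
rewrite -big_split; apply: ler_sum => m _ /=; rewrite -mulrDl.
by apply: ler_wpM2r; [exact: sweight_ge0|rewrite mcoeffD; exact: qnormD].
Qed.

Lemma wpol_tens phi (v : symAlg R n) : entire F r phi ->
  wpol (tens phi v) <= qnorm F r d phi * sym_norm r' d v.
Proof.
move=> ep; pose D := fsetU (msupp (tens phi v)) (msupp v).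
rewrite (@wpolw _ D) ?fsubsetUl // sym_normE /symW (@wnormw _ _ _ _ D) ?fsubsetUr //.
rewrite mulr_sumr; apply: ler_sum => m _; rewrite mcoeff_tens [leRHS]mulrCA [leRHS]mulrA.
by apply: ler_wpM2r; [exact: sweight_ge0|exact: qnormZ].
Qed.

(** As the seminorm on Sym(g) is a weighted l^1-norm, a single tensor costs at least its sum over
    monomials, and [wpol] is subadditive. A bilinear estimate on monomials thus passes to the
    projective seminorms with the same constant. *)
Lemma wpol_le P : pol_entire F r P -> wpol P <= tensor_norm F r r' d d P.
Proof.
move=> p; apply/ler_addgt0Pr => e e0.
have [y [N [phi [v [ep -> ->]]]] yl] := tensor_norm_approx r' d0 d0 p e0.
apply: le_trans (ltW yl); move: p yl => _ _.
suff [_ //] : pol_entire F r (\sum_(i < N) tens (phi i) (v i)) /\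
  wpol (\sum_(i < N) tens (phi i) (v i)) <= \sum_(i < N) qnorm F r d (phi i) * sym_norm r' d (v i).
elim/big_rec2: _ => [|i y' t _ [IHe IH]].
  by split; [exact: pol_entire0|rewrite /wpol msupp0 big_nil].
have et := pol_entire_tens (v i) (ep i).
split; first exact: pol_entireD.
by apply: le_trans (wpolD et IHe) _; apply: lerD => //; exact: wpol_tens.
Qed.

Lemma wpol_ge0 P : 0 <= wpol P.
Proof. by apply: sumr_ge0 => m _; rewrite mulr_ge0 ?qnorm_ge0 ?sweight_ge0. Qed.

Lemma tensor_norm_pstar P Q : pol_entire F r P -> pol_entire F r Q ->
  tensor_norm F r r' c c' (pstar F hbar P Q) <=
  2 * tensor_norm F r r' d d P * tensor_norm F r r' d d Q.
Proof.
move=> p q; apply: (@le_trans _ _ (2 * wpol P * wpol Q)); last first.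
  by rewrite ler_pM ?mulr_ge0 ?wpol_ge0 ?wpol_le // ler_wpM2l // wpol_le.
apply: le_trans (tensor_norm_sum _ _ c0 c'0 _) _.
  by move=> m; apply: pol_entire_sum => m' _; exact: pol_entire_std.
rewrite [wpol P]/wpol [2 * _]mulr_sumr mulr_suml; apply: ler_sum => m _.
apply: le_trans (tensor_norm_sum _ _ c0 c'0 _) _.
  by move=> m'; exact: pol_entire_std.
rewrite /wpol mulr_sumr; apply: ler_sum => m' _.
by rewrite -size_cmonom_word; exact: std_word_bound.
Qed.

End StarBound.

Lemma cabs_dist (R : realType) (z w : cplx R) : `|cabs z - cabs w| <= cabs (z - w).
Proof.
rewrite ler_norml; apply/andP; split.
  have := cabsD (- (z - w)) z; rewrite cabsN opprB addrNK; lra.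
have := cabsD (z - w) w; rewrite subrK; lra.
Qed.

Lemma continuous_cabs (R : realType) : continuous (@cabs R).
Proof.
(* The modulus on [cplx] takes values in [cplx] itself, so the radius of a ball there is the complex
   number [creal e]. *)
move=> z; apply/(@cvgrPdist_lt _ _ _ (nbhs z) (nbhs_filter z)) => e e0; exists (creal e).
  by rewrite /= -[0](_ : creal 0 = 0) // /creal ltcR.
move=> w /= zw; apply: le_lt_trans (cabs_dist _ _) _.
move: zw; rewrite -ltcR cabsE; exact.
Qed.

Lemma continuous_star_radius (R : realType) n (G : lieGroup R n) (F : frame G) (r r' c c' : R) :
  continuous (star_radius F r r' c c').
Proof.
have -> : star_radius F r r' c c' = fun h => (2 * 2 `^ r' * c' + 2 * (2 `^ r * c)) +
    ((4 * 2 `^ r' * struct_bound F + 4 * (2 `^ r * c)) * cabs (cmk 0 1 : cplx R)^-1) * cabs h.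
  by apply/funext => h; rewrite /star_radius /zpar cabsM; ring.
move=> h; have Fh := nbhs_filter h; apply: (@cvgD _ _ _ (nbhs h) Fh); first exact: (@cvg_cst _ _ _ (nbhs h)).
apply: (@cvgM _ _ (nbhs h) Fh); [exact: (@cvg_cst _ _ _ (nbhs h))|exact: continuous_cabs].
Qed.

Lemma product_modulus (R : realType) (p q e : R) : 0 <= p -> 0 <= q -> 0 < e ->
  exists dl, 0 < dl /\ forall x y t, 0 <= x -> 0 <= t -> x < dl -> y < dl -> t <= q + dl ->
    2 * x * t + 2 * p * y < e.
Proof.
move=> p0 q0 e0; have k0 : 0 < 2 * p + 2 * q + 3 by lra.
have [dl [dl0 dl1 dle]] : exists dl, [/\ 0 < dl, dl <= 1 & dl * (2 * p + 2 * q + 3) <= e].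
  exists (Num.min 1 (e / (2 * p + 2 * q + 3))); split.
  - by rewrite lt_min ltr01 divr_gt0.
  - by rewrite ge_min lexx.
  - by rewrite -ler_pdivlMr // ge_min lexx orbT.
exists dl; split=> // x y t x0 t0 hx hy ht; apply: lt_le_trans dle.
have h1 : x * t <= dl * (q + 1) by apply: ler_pM => //; [exact: ltW|lra].
have h2 : p * y <= p * dl by apply: ler_wpM2l => //; exact: ltW.
move: h1 h2; rewrite -!mulrA; move: (x * t) (p * y) => a b; rewrite !mulrDr mulr1.
have -> : dl * (2 * p) = 2 * (p * dl) by ring.
have -> : dl * (2 * q) = 2 * (dl * q) by ring.
move: (p * dl) (dl * q) => c d; lra.
Qed.

(** * The topology of Pol and continuity of the star product *)

Section PolTopology.
Context {R : realType} {n : nat} {G : lieGroup R n} (F : frame G) (r r' : R).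
Let C := cplx R.
Let X := Pol F r r'.
Implicit Types (P Q S : X) (a : C) (c e : R).

Lemma pol_valP P : pol_entire F r (val P).
Proof. by case: P => p /= /asboolP. Qed.

Definition pol_mk (p : @polFun R n G) (H : pol_entire F r p) : X :=
  exist _ p (asboolT H).

Definition pol_sub P Q : X := pol_mk (pol_entireB (pol_valP P) (pol_valP Q)).

Definition pol0 : X := pol_mk (@pol_entire0 _ _ _ F r).

Local Notation T c P := (tensor_norm F r r' c c P).

Lemma tensor_normN c c' p : 0 <= c -> 0 <= c' -> pol_entire F r p ->
  tensor_norm F r r' c c' (- p) <= tensor_norm F r r' c c' p.
Proof.
move=> c0 c'0 ep; have H := @tensor_norm_scale _ _ _ F r r' c c' p (- p) (-1) c0 c'0 ep.
rewrite -[leRHS]mul1r -(cabs1 (R := R)) -cabsN; apply: H => m.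
by rewrite mcoeffN scaleN1r.
Qed.

Lemma tensor_normB_trans c c' p q s : 0 <= c -> 0 <= c' ->
  pol_entire F r p -> pol_entire F r q -> pol_entire F r s ->
  tensor_norm F r r' c c' (p - s) <=
  tensor_norm F r r' c c' (p - q) + tensor_norm F r r' c c' (q - s).
Proof.
move=> c0 c'0 ep eq es; have -> : p - s = (p - q) + (q - s) by rewrite addrA subrK.
by apply: tensor_normD => //; exact: pol_entireB.
Qed.

Lemma nbhs_ball_pol P c c' e : 0 <= c -> 0 <= c' -> 0 < e ->
  nbhs P [set Q | tensor_norm F r r' c c' (val Q - val P) < e].
Proof.
move=> c0 c'0 e0; set B := [set Q | _]; rewrite nbhsE.
exists B => //; split; last by rewrite /B /= subrr tensor_norm0.
exists [set B]; last by rewrite bigcup_set1.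
move=> _ ->; exists [fset B]%fset.
  by move=> U; rewrite in_fset1 => /eqP ->; apply: mem_set; exists P, c, c', e.
rewrite predeqE => Q; split=> [H|BQ U /=]; last by rewrite in_fset1 => /eqP ->.
by have := H B; apply; rewrite /= in_fset1 eqxx.
Qed.

(** A basic neighbourhood is a finite intersection of balls with various centres and parameters. The
    triangle inequality recentres them at [P], and monotonicity lets the maximum of all parameters
    serve for both seminorms. *)
Lemma nbhs_polP P (A : set X) : nbhs P A ->
  exists c e, [/\ 1 <= c, 0 < e & [set Q : X | T c (val Q - val P) < e] `<=` A].
Proof.
rewrite nbhsE => -[U0 [[B sB <-] [W BW WP]] sA].
have /sB [D sD IDW] := BW.
have H (s : seq (set X)) : (forall U, U \in s -> U P) -> (forall U, U \in s -> @Pol_subbase R n G F r r' U) ->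
   exists c e, [/\ 1 <= c, 0 < e & forall U, U \in s -> [set Q : X | T c (val Q - val P) < e] `<=` U].
  elim: s => [|U s IH] sP ss; first by exists 1, 1.
  have [||c [e [c1 e0 H]]] := IH.
  - by move=> V Vs; apply: sP; rewrite inE Vs orbT.
  - by move=> V Vs; apply: ss; rewrite inE Vs orbT.
  have UP : U P by apply: sP; rewrite mem_head.
  have [P0 [c0 [c0' [e1 [c00 c00' e10 UE]]]]] : @Pol_subbase R n G F r r' U by apply: ss; rewrite mem_head.
  rewrite UE /= in UP.
  have cm0 : 0 <= Num.max c (Num.max c0 c0') by rewrite le_max (le_trans _ c1).
  (* The radius left in the ball around [P0] after moving its centre to [P]. *)
  exists (Num.max c (Num.max c0 c0')), (Num.min e (e1 - tensor_norm F r r' c0 c0' (val P - val P0))).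
  split; [by rewrite le_max c1|by rewrite lt_min e0 subr_gt0|].
  have eB Q : pol_entire F r (val Q - val P) by apply: pol_entireB; exact: pol_valP.
  move=> V; rewrite inE => /orP[/eqP -> Q /=|Vs Q /=]; rewrite lt_min => /andP[h1 h2].
    rewrite UE /=; apply: le_lt_trans (@tensor_normB_trans _ _ _ (val P) _ _ _ _ _ _) _ => //;
      try exact: pol_valP.
    rewrite -ltrBrDr; apply: le_lt_trans h2; apply: tensor_norm_mono => //.
      by rewrite !le_max lexx orbT.
    by rewrite !le_max lexx !orbT.
    exact: eB.
  apply: (H V Vs); apply: le_lt_trans h1; apply: tensor_norm_mono => //.
  - exact: le_trans c1.
  - exact: le_trans c1.
  - by rewrite le_max lexx.
  - by rewrite le_max lexx.
have [||c [e [c1 e0 H']]] := H (finmap.enum_fset D).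
- by move=> U UD; move: WP; rewrite -IDW => /(_ U); apply.
- by move=> U UD; exact: set_mem (sD U UD).
exists c, e; split=> // Q TQ; apply: sA.
have WQ : W Q by rewrite -IDW => U UD; exact: (H' U UD Q TQ).
by exists W.
Qed.

Section PolStar.
Hypotheses (r0 : 0 <= r) (r1 : 1 <= r').
Variable hbar : C.

Definition star_pol P Q : X := pol_mk (pol_entire_star hbar r0 (pol_valP P) (pol_valP Q)).

Lemma pol_val_analytic P : pol_analytic (val P).
Proof. by move=> m; have [] := pol_valP P m. Qed.

Lemma star_pol_std : @is_star_std R n G F hbar r r' star_pol.
Proof.
split.
- by move=> a P P' S Q H m; exact: pstar_linl.
- move=> a P Q Q' S H m; apply: pstar_linr => //; exact: pol_val_analytic.
move=> phi psi k xi eta P Q ep eq PE QE; rewrite /star_pol /= PE QE.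
by apply: pstar_formula; case: eq.
Qed.

Let sub_lin (p q : @polFun R n G) m : mcoeff m (q - p) = (-1 : C) *: mcoeff m p + mcoeff m q.
Proof. by rewrite mcoeffB scaleN1r addrC. Qed.

Let telescope_lin (V : lmodType C) (u v w : V) : (-1 *: u + v) + (-1 *: w + u) = v - w.
Proof. by rewrite !scaleN1r addrC addrA addrK addrC. Qed.

(** Telescoping by bilinearity: the difference is (P' - P) star Q' plus P star (Q' - Q). *)
Lemma star_pol_diff c c' P Q P' Q' : 1 <= c -> 1 <= c' ->
  tensor_norm F r r' c c' (val (star_pol P' Q') - val (star_pol P Q)) <=
  2 * T (star_radius F r r' c c' hbar) (val P' - val P) * T (star_radius F r r' c c' hbar) (val Q')
  + 2 * T (star_radius F r r' c c' hbar) (val P) * T (star_radius F r r' c c' hbar) (val Q' - val Q).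
Proof.
move=> c1 c'1; have c0 : 0 <= c by apply: le_trans c1.
have c'0 : 0 <= c' by apply: le_trans c'1.
have E1 : val (star_pol P' Q') - val (star_pol P Q) =
    pstar F hbar (val P' - val P) (val Q') + pstar F hbar (val P) (val Q' - val Q).
  apply/malgP => m; rewrite mcoeffB mcoeffD.
  have E2 := @pstar_linl _ _ _ F hbar (-1) (val P) (val P') (val P' - val P) (val Q') m
    (sub_lin _ _).
  have E3 := @pstar_linr _ _ _ F hbar (-1) (val P) (val Q) (val Q') (val Q' - val Q) m
    (pol_val_analytic Q) (pol_val_analytic Q') (sub_lin _ _).
  apply: esym; apply: etrans (f_equal2 +%R E2 E3) _; exact: telescope_lin.
rewrite E1.
have eP := pol_valP P; have eP' := pol_valP P'; have eQ := pol_valP Q; have eQ' := pol_valP Q'.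
apply: le_trans (tensor_normD _ c0 c'0 _ _) _.
- by apply: pol_entire_star => //; exact: pol_entireB.
- by apply: pol_entire_star => //; exact: pol_entireB.
by apply: lerD; apply: tensor_norm_pstar => //; exact: pol_entireB.
Qed.

Lemma star_pol_continuous : continuous (fun PQ : X * X => star_pol PQ.1 PQ.2).
Proof.
move=> [P Q] A /= /nbhs_polP [c [e [c1 e0 sA]]].
set d := star_radius F r r' c c hbar.
have d0 : 0 <= d by apply: le_trans (star_radius_ge1 F hbar r0 r1 c1 c1).
set p := T d (val P); set q := T d (val Q).
have p0 : 0 <= p by exact: tensor_norm_ge0.
have q0 : 0 <= q by exact: tensor_norm_ge0.
have [dl [dl0 dlP]] := product_modulus p0 q0 e0.
exists ([set P' : X | T d (val P' - val P) < dl], [set Q' : X | T d (val Q' - val Q) < dl]).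
  by split; exact: nbhs_ball_pol.
move=> [P' Q'] /= [hP hQ]; apply: sA; rewrite /=.
apply: le_lt_trans (star_pol_diff _ _ _ _ c1 c1) _; rewrite -/d -/p.
have hQ' : T d (val Q') <= q + dl.
  have := @tensor_normD _ _ _ F r r' d d (val Q) (val Q' - val Q) d0 d0 (pol_valP Q)
    (pol_entireB (pol_valP Q') (pol_valP Q)).
  by rewrite addrC subrK => H; apply: le_trans H _; rewrite lerD2l ltW.
by apply: dlP => //; exact: tensor_norm_ge0.
Qed.

End PolStar.

End PolTopology.

(** * The completion *)

Lemma small_delta (R : realType) (k e : R) : 0 < k -> 0 < e ->
  exists dl, [/\ 0 < dl, dl <= 1 & dl * k <= e].
Proof.
move=> k0 e0; exists (Num.min 1 (e / k)); split.
- by rewrite lt_min ltr01 divr_gt0.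
- by rewrite ge_min lexx.
- by rewrite -ler_pdivlMr // ge_min lexx orbT.
Qed.

Section PolScale.
Context {R : realType} {n : nat} {G : lieGroup R n} (F : frame G) (r r' : R).

Lemma lincomb_exists (a : cplx R) (P Q : Pol F r r') : exists S : Pol F r r', lincomb a P Q S.
Proof.
pose S1 := \sum_(m <- finmap.enum_fset (msupp (val P))) mkmalgU m (a *: mcoeff m (val P)).
have E m : mcoeff m S1 = a *: mcoeff m (val P).
  rewrite /S1 raddf_sum.
  rewrite (eq_bigr (fun k => (a *: mcoeff k (val P)) *+ (k == m))) => [|k _]; last exact: mcoeffU.
  apply: (sum_msupp_delta m (phi := fun f : G -> cplx R => a *: f)); exact: scaler0.
have e1 : pol_entire F r S1 by move=> m; rewrite E; apply: entireZ; exact: pol_valP.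
exists (pol_mk r' (pol_entireD e1 (pol_valP Q))) => m.
by rewrite /= mcoeffD E.
Qed.

End PolScale.

Section CompletionStar.
Context {R : realType} {n : nat} {G : lieGroup R n} {F : frame G} {r r' : R}.
Context {H : topologicalLmodType (cplx R)} {iota : Pol F r r' -> H} {s : R -> R -> H -> R}.
Let C := cplx R.
Let X := Pol F r r'.
Hypotheses (r0 : 0 <= r) (r1 : 1 <= r') (iotaP : is_completion iota)
  (sP : forall c c' : R, 0 <= c -> 0 <= c' ->
     continuous_extension iota (fun P => tensor_norm F r r' c c' (val P)) (s c c')).
Implicit Types (P Q S : X) (x y : H) (c e : R).

Let pv P : pol_entire F r (val P). Proof. exact: pol_valP. Qed.

Lemma iotaB P Q : iota (pol_sub P Q) = iota P - iota Q.
Proof.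
have [_ _ lin _ _] := iotaP; rewrite (lin (-1) Q P (pol_sub P Q)) ?scaleN1r 1?addrC // => m.
by rewrite /= mcoeffB scaleN1r addrC.
Qed.

Lemma iota0 : iota (pol0 F r r') = 0.
Proof.
have -> : pol0 F r r' = pol_sub (pol0 F r r') (pol0 F r r').
  by apply/val_inj; rewrite /= subrr.
by rewrite iotaB subrr.
Qed.

Lemma s_iota c c' P : 0 <= c -> 0 <= c' -> s c c' (iota P) = tensor_norm F r r' c c' (val P).
Proof. by move=> c0 c'0; have [_] := sP c0 c'0; apply. Qed.

Lemma s_iotaB c c' P Q : 0 <= c -> 0 <= c' ->
  s c c' (iota P - iota Q) = tensor_norm F r r' c c' (val P - val Q).
Proof. by move=> c0 c'0; rewrite -iotaB s_iota. Qed.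

Lemma s_continuous c c' : 0 <= c -> 0 <= c' -> continuous (s c c').
Proof. by move=> c0 c'0; have [] := sP c0 c'0. Qed.

Lemma dense_nbhs x (A : set H) : nbhs x A -> exists P, A (iota P).
Proof.
rewrite nbhsE => -[B [oB Bx] BA]; have [_ _ _ de _] := iotaP.
have [h [Bh [P _ Ph]]] := de B (ex_intro _ x Bx) oB.
by exists P; apply: BA; rewrite Ph.
Qed.

Lemma nbhs_lt (f : H -> R) e x : continuous f -> f x < e -> nbhs x [set y | f y < e].
Proof. by move=> cf fx; apply: (cf x [set t | t < e]); apply: open_nbhs_nbhs; split=> //; exact: open_lt. Qed.

(** The route by which inequalities between the seminorms on Pol reach the completion. *)
Lemma dense_ge0 (f : H -> R) : continuous f -> (forall P, 0 <= f (iota P)) -> forall x, 0 <= f x.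
Proof.
move=> cf H0 x; rewrite leNgt; apply/negP => fx.
by have [P] := dense_nbhs (nbhs_lt cf fx); rewrite /= ltNge H0.
Qed.

Lemma cont_lin (a : C) (u v : H -> H) : continuous u -> continuous v ->
  continuous (fun t => a *: u t + v t).
Proof.
move=> cu cv t; apply: (@continuous_comp _ _ _ (fun t => (a *: u t, v t))
  (fun xy : H * H => xy.1 + xy.2)); last exact: add_continuous.
apply: cvg_pair; last exact: cv.
apply: (@continuous_comp _ _ _ u ( *:%R a)); first exact: cu.
move=> A /(@scale_continuous _ H (a, u t)) [[B1 B2] /= [a1 a2] sub].
by apply: filterS a2 => y By; apply: (sub (a, y)); split=> //; exact: nbhs_singleton.
Qed.

Lemma cont_sub (u v : H -> H) : continuous u -> continuous v -> continuous (fun t => u t - v t).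
Proof.
move=> cu cv t; apply: (@continuous_comp _ _ _ (fun t => (u t, v t))
  (fun xy : H * H => xy.1 - xy.2)); last exact: sub_continuous.
by apply: cvg_pair; [exact: cu|exact: cv].
Qed.

Lemma cont_s (u : H -> H) c c' : 0 <= c -> 0 <= c' -> continuous u ->
  continuous (fun t => s c c' (u t)).
Proof.
move=> c0 c'0 cu t; apply: (@continuous_comp _ _ _ u (s c c')); first exact: cu.
exact: s_continuous.
Qed.

Lemma cont_id : continuous (fun t : H => t).
Proof. by move=> t; exact: cvg_id. Qed.

Lemma cont_cst x : continuous (fun _ : H => x).
Proof. by move=> t; exact: cvg_cst. Qed.

Lemma s_ge0 c c' x : 0 <= c -> 0 <= c' -> 0 <= s c c' x.
Proof.
move=> c0 c'0; move: x; apply: dense_ge0; first exact: s_continuous.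
by move=> P; rewrite s_iota //; exact: tensor_norm_ge0.
Qed.

(** Density is used in one variable at a time. The form with a difference also yields evenness, by
    taking x = 0. *)
Lemma s_sub c c' x y : 0 <= c -> 0 <= c' -> s c c' (x - y) <= s c c' x + s c c' y.
Proof.
move=> c0 c'0; rewrite -subr_ge0.
have cB (b : R) (u v : H -> R) : continuous u -> continuous v -> continuous (fun t => u t + b - v t).
  move=> cu cv t; apply: cvgB; last exact: cv.
  by apply: cvgD; [exact: cu|exact: cvg_cst].
have E Q : forall x, 0 <= s c c' x + s c c' (iota Q) - s c c' (x - iota Q).
  apply: dense_ge0 => [|P].
    apply: cB; first exact: s_continuous.
    by apply: cont_s => //; apply: cont_sub; [exact: cont_id|exact: cont_cst].
  rewrite s_iotaB // !s_iota // subr_ge0.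
  apply: le_trans (tensor_normD _ c0 c'0 (pv P) (pol_entireN (pv Q))) _.
  by rewrite lerD2l; apply: tensor_normN => //; exact: pv.
rewrite [s c c' x + _]addrC; move: y; apply: dense_ge0 => [|Q]; last first.
  by rewrite [_ + s c c' x]addrC; exact: E.
apply: cB; first exact: s_continuous.
by apply: cont_s => //; apply: cont_sub; [exact: cont_cst|exact: cont_id].
Qed.

Lemma s_0 c c' : 0 <= c -> 0 <= c' -> s c c' 0 = 0.
Proof. by move=> c0 c'0; rewrite -iota0 s_iota //; exact: tensor_norm0. Qed.

Lemma s_N c c' x : 0 <= c -> 0 <= c' -> s c c' (- x) = s c c' x.
Proof.
move=> c0 c'0; have E y : s c c' (- y) <= s c c' y.
  by have := s_sub 0 y c0 c'0; rewrite s_0 // sub0r add0r.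
by apply/eqP; rewrite eq_le E -{1}[x]opprK E.
Qed.

Lemma s_dist c c' x y : 0 <= c -> 0 <= c' -> s c c' (x - y) = s c c' (y - x).
Proof. by move=> c0 c'0; rewrite -s_N // opprB. Qed.

Lemma s_tri c c' x y z : 0 <= c -> 0 <= c' -> s c c' (x - z) <= s c c' (x - y) + s c c' (y - z).
Proof.
move=> c0 c'0; rewrite [s c c' (y - z)]s_dist //.
have := s_sub (x - y) (z - y) c0 c'0; congr (s c c' _ <= _).
by rewrite opprB addrA subrK.
Qed.

Lemma s_le_dist c c' x y : 0 <= c -> 0 <= c' -> s c c' x <= s c c' y + s c c' (y - x).
Proof.
move=> c0 c'0; have := s_sub y (y - x) c0 c'0.
by rewrite opprB addrC subrK.
Qed.

Lemma s_mono c1 c1' c2 c2' x : 0 <= c1 -> 0 <= c1' -> c1 <= c2 -> c1' <= c2' ->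
  s c1 c1' x <= s c2 c2' x.
Proof.
move=> c0 c'0 c12 c12'; have d0 : 0 <= c2 by apply: le_trans c12.
have d'0 : 0 <= c2' by apply: le_trans c12'.
rewrite -subr_ge0; move: x; apply: dense_ge0 => [t|P].
  by apply: cvgB; apply: s_continuous.
by rewrite !s_iota // subr_ge0; apply: tensor_norm_mono => //; exact: pv.
Qed.

Lemma nbhs_s x c c' e : 0 <= c -> 0 <= c' -> 0 < e -> nbhs x [set y | s c c' (y - x) < e].
Proof.
move=> c0 c'0 e0; have cf : continuous (fun y => s c c' (y - x)).
  by apply: cont_s => //; apply: cont_sub; [exact: cont_id|exact: cont_cst].
by apply: nbhs_lt => //; rewrite subrr s_0.
Qed.

Lemma approx x c e : 0 <= c -> 0 < e -> exists P, s c c (x - iota P) < e.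
Proof.
move=> c0 e0; apply: (@dense_nbhs x [set y | s c c (x - y) < e]); apply: nbhs_lt; last by rewrite subrr s_0.
by apply: cont_s => //; apply: cont_sub; [exact: cont_cst|exact: cont_id].
Qed.

(* The seminorms s c c generate the topology: V - V <= U, V contains the image
   of a seminorm ball of Pol, and the image of Pol is dense. *)
Lemma nbhs_sP x (U : set H) : nbhs x U ->
  exists c e, [/\ 1 <= c, 0 < e & forall y, s c c (y - x) < e -> U y].
Proof.
move=> xU; have : nbhs ((x, 0) : H * H) [set ab | U (ab.1 - ab.2)].
  by apply: (@sub_continuous H (x, 0)); rewrite /= subr0.
case=> -[V W] /= [xV W0] VW; have [_ _ _ _ top] := iotaP.
have W1 : nbhs (0 : H) [set w | W (- w)].
  by apply: (@opp_continuous H 0 W); rewrite oppr0.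
have [c [e [c1 e0 HW]]] : exists c e, [/\ 1 <= c, 0 < e &
    [set Q : X | tensor_norm F r r' c c (val Q - val (pol0 F r r')) < e] `<=`
    iota @^-1` [set w | W (- w)]].
  by apply: nbhs_polP; apply/top; exists [set w | W (- w)] => //; rewrite iota0.
have c0 : 0 <= c by apply: le_trans c1.
exists c, e; split=> // y sy.
(* An element of Pol close to y - x: then y - iota P lies in V, - iota P lies in W, and y is the
   difference of the two. *)
have [P [VP sP']] : exists P, V (y - iota P) /\ s c c (iota P) < e.
  apply: (@dense_nbhs (y - x) [set t | V (y - t) /\ s c c t < e]); apply: filterI.
    have cy := cont_sub (@cont_cst y) cont_id.
    by apply: (cy (y - x) V); rewrite opprB addrC subrK.
  by apply: nbhs_lt => //; exact: s_continuous.
have := VW (y - iota P, - iota P); rewrite /= opprK subrK; apply; split=> //.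
apply: (HW P); have := s_iotaB P (pol0 F r r') c0 c0; rewrite iota0 subr0 => E.
by move: sP'; rewrite E.
Qed.

Lemma s_separates x y : (forall c, 1 <= c -> s c c (x - y) <= 0) -> x = y.
Proof.
move=> E; have [haus _ _ _ _] := iotaP; apply: haus => A B xA yB.
have [c [e [c1 e0 HA]]] := nbhs_sP xA; exists y; split; last exact: nbhs_singleton.
have c0 : 0 <= c by apply: le_trans c1.
by apply: HA; rewrite s_dist //; apply: le_lt_trans e0; exact: E.
Qed.

Lemma dense_eq (f g : H -> H) : continuous f -> continuous g ->
  (forall P, f (iota P) = g (iota P)) -> forall x, f x = g x.
Proof.
move=> cf cg E x; apply: s_separates => c c1; have c0 : 0 <= c by apply: le_trans c1.
rewrite -oppr_ge0; move: x; apply: dense_ge0 => [t|P]; last by rewrite E subrr s_0 // oppr0.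
by apply: cvgN; exact: (cont_s c0 c0 (cont_sub cf cg)).
Qed.

(** * The product on the completion *)

Section Product.
Variable hbar : C.
Let d c c' : R := star_radius F r r' c c' hbar.
Local Notation star := (star_pol r0 hbar).

Let d1 c c' : 1 <= c -> 1 <= c' -> 1 <= d c c'.
Proof. exact: star_radius_ge1. Qed.

Let d0 c c' : 1 <= c -> 1 <= c' -> 0 <= d c c'.
Proof. by move=> c1 c'1; apply: le_trans (d1 c1 c'1). Qed.

Lemma s_star_diff c c' P Q P' Q' : 1 <= c -> 1 <= c' ->
  s c c' (iota (star P' Q') - iota (star P Q)) <=
  2 * s (d c c') (d c c') (iota P' - iota P) * s (d c c') (d c c') (iota Q') +
  2 * s (d c c') (d c c') (iota P) * s (d c c') (d c c') (iota Q' - iota Q).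
Proof.
move=> c1 c'1; have c0 : 0 <= c by apply: le_trans c1.
have c'0 : 0 <= c' by apply: le_trans c'1.
have d0' := d0 c1 c'1; rewrite !s_iotaB // !s_iota //.
exact: star_pol_diff.
Qed.

(* h is the product of x and y: this bound, which forces h to be the limit of
   the products P * Q for P -> x and Q -> y, also yields the continuity. *)
Definition is_hstar x y (h : H) : Prop := forall c c' P Q, 1 <= c -> 1 <= c' ->
  s c c' (h - iota (star P Q)) <=
  2 * s (d c c') (d c c') (x - iota P) * s (d c c') (d c c') y +
  2 * s (d c c') (d c c') (iota P) * s (d c c') (d c c') (y - iota Q).

Definition prod_approx x y c e : set H :=
  [set h | exists P Q, [/\ s c c (x - iota P) < e, s c c (y - iota Q) < e & h = iota (star P Q)]].

(** Generated by the products of approximations from Pol; completeness is applied to this filter,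
    and its limit is the product of [x] and [y]. *)
Definition prod_filter x y : set_system H :=
  filter_from [set ce : R * R | 1 <= ce.1 /\ 0 < ce.2] (fun ce => prod_approx x y ce.1 ce.2).

Lemma prod_approx_ne x y c e : 1 <= c -> 0 < e -> prod_approx x y c e !=set0.
Proof.
move=> c1 e0; have c0 : 0 <= c by apply: le_trans c1.
have [P hP] := approx x c0 e0; have [Q hQ] := approx y c0 e0.
by exists (iota (star P Q)), P, Q.
Qed.

Lemma prod_approx_le x y c1 c2 e1 e2 : 0 <= c1 -> c1 <= c2 -> e2 <= e1 ->
  prod_approx x y c2 e2 `<=` prod_approx x y c1 e1.
Proof.
move=> c0 c12 e12 h [P [Q [hP hQ ->]]]; exists P, Q.
by split=> //; apply: le_lt_trans (s_mono _ c0 c0 c12 c12) _; apply: lt_le_trans e12.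
Qed.

Lemma prod_filter_proper x y : ProperFilter (prod_filter x y).
Proof.
apply: filter_from_proper => [|[c e] [/= c1 e0]]; last exact: prod_approx_ne.
apply: filter_from_filter; first by exists (1, 1).
move=> [c e] [c2 e2] [/= c1 e0] [/= c21 e20].
exists (Num.max c c2, Num.min e e2); first by split; rewrite /= ?le_max ?c1 // lt_min e0.
have c0 : 0 <= c by apply: le_trans c1.
have c20 : 0 <= c2 by apply: le_trans c21.
move=> h /= Hh; split; apply: (@prod_approx_le _ _ _ (Num.max c c2) _ (Num.min e e2)) => //.
- by rewrite le_max lexx.
- by rewrite ge_min lexx.
- by rewrite le_max lexx orbT.
- by rewrite ge_min lexx orbT.
Qed.

Lemma prod_filter_cauchy x y : tvs_cauchy (prod_filter x y).
Proof.
move=> U /nbhs_sP [c [e [c1 e0 HU]]]; have c0 : 0 <= c by apply: le_trans c1.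
have dd0 := d0 c1 c1; set dd := d c c in dd0.
set a := s dd dd x; set b := s dd dd y.
have a0 : 0 <= a by exact: s_ge0.
have b0 : 0 <= b by exact: s_ge0.
(* Two approximations of the same point differ by at most 2 dl, so the telescoped error is at most 4
   dl (a + b) + 8 dl^2; the 9 makes the inequality strict. *)
have [|dl [dl0 dl1 dle]] := @small_delta R (4 * a + 4 * b + 9) e _ e0; first by lra.
exists (prod_approx x y dd dl); first by exists (dd, dl) => //=; split=> //; exact: d1.
move=> _ _ [P' [Q' [hP' hQ' ->]]] [P [Q [hP hQ ->]]]; apply: HU; rewrite subr0.
apply: le_lt_trans (s_star_diff _ _ _ _ c1 c1) _; rewrite -/dd.
have p1 : s dd dd (iota P' - iota P) <= 2 * dl.
  by have := s_tri (iota P') x (iota P) dd0 dd0; rewrite [s _ _ (_ - x)]s_dist //; lra.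
have p2 : s dd dd (iota Q') <= b + dl.
  by have := s_le_dist (iota Q') y dd0 dd0; rewrite -/b; lra.
have p3 : s dd dd (iota P) <= a + dl.
  by have := s_le_dist (iota P) x dd0 dd0; rewrite -/a; lra.
have p4 : s dd dd (iota Q' - iota Q) <= 2 * dl.
  by have := s_tri (iota Q') y (iota Q) dd0 dd0; rewrite [s _ _ (_ - y)]s_dist //; lra.
have h1 := ler_pM (s_ge0 _ dd0 dd0) (s_ge0 _ dd0 dd0) p1 p2.
have h2 := ler_pM (s_ge0 _ dd0 dd0) (s_ge0 _ dd0 dd0) p3 p4.
rewrite -!mulrA; move: (_ * s _ _ _) (s _ _ (iota P) * _) h1 h2 => u v h1 h2.
apply: lt_le_trans dle; have : dl * dl <= dl by rewrite ger_pMr.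
move: (dl * dl) h1 h2 => t; nra.
Qed.

Lemma hstar_exists x y : exists h, is_hstar x y h.
Proof.
have [_ comp _ _ _] := iotaP.
have [h Hh] := comp _ (prod_filter_proper x y) (@prod_filter_cauchy x y).
exists h => c c' P Q c1 c'1; apply/ler_addgt0Pr => e e0.
have c0 : 0 <= c by apply: le_trans c1.
have c'0 : 0 <= c' by apply: le_trans c'1.
have dd0 := d0 c1 c'1; set dd := d c c' in dd0 *.
have e2 : 0 < e / 2 by rewrite divr_gt0.
have [[c2 e3] [/= c21 e30] sub] := Hh _ (nbhs_s h c0 c'0 e2).
set a := s dd dd (x - iota P); set b := s dd dd y; set p := s dd dd (iota P).
set q := s dd dd (y - iota Q).
have a0 : 0 <= a by exact: s_ge0.
have b0 : 0 <= b by exact: s_ge0.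
have p0 : 0 <= p by exact: s_ge0.
(* Replacing a, b, q by a + dl, b + dl, q + dl changes the bound by at most this multiple of dl; the
   other e/2 is the distance to the limit. *)
have [|dl [dl0 dl1 dle]] := @small_delta R (2 * (a + b + p + 1)) (e / 2) _ e2; first by lra.
have m1 : 1 <= Num.max c2 dd by rewrite le_max c21.
have m0 : 0 < Num.min e3 dl by rewrite lt_min e30.
(* A single product of approximations is used twice: it is close to [h], and its factors are close
   to [x] and [y]. *)
have [h' Nh'] := prod_approx_ne x y m1 m0.
have sh : s c c' (h' - h) < e / 2.
  by apply/sub/(prod_approx_le _ _ _ Nh'); rewrite ?le_max ?ge_min ?lexx // (le_trans _ c21).
have [P' [Q' [hP hQ h'E]]] : prod_approx x y dd dl h'.
  by apply: (prod_approx_le _ _ _ Nh'); rewrite ?le_max ?ge_min ?lexx ?orbT.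
have st := s_star_diff P Q P' Q' c1 c'1; rewrite -/dd -/p -h'E in st.
have p1 : s dd dd (iota P' - iota P) <= a + dl.
  by have := s_tri (iota P') x (iota P) dd0 dd0; rewrite [s _ _ (_ - x)]s_dist // -/a; lra.
have p2 : s dd dd (iota Q') <= b + dl.
  by have := s_le_dist (iota Q') y dd0 dd0; rewrite -/b; lra.
have p4 : s dd dd (iota Q' - iota Q) <= q + dl.
  by have := s_tri (iota Q') y (iota Q) dd0 dd0; rewrite [s _ _ (_ - y)]s_dist // -/q; lra.
have h1 := ler_pM (s_ge0 _ dd0 dd0) (s_ge0 _ dd0 dd0) p1 p2.
have h2 := ler_wpM2l p0 p4.
have tri := s_tri h h' (iota (star P Q)) c0 c'0; rewrite [s _ _ (h - h')]s_dist // in tri.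
apply: le_trans tri _; rewrite -!mulrA; rewrite -!mulrA in st.
move: (s c c' (h' - h)) (s c c' (h' - _)) (_ * s dd dd (iota Q')) (p * s _ _ _) sh st h1 h2.
move=> u v w t sh st h1 h2; have dd2 : dl * dl <= dl by rewrite ger_pMr.
have -> : 2 * (a * b) + 2 * (p * q) + e = 2 * (a * b) + 2 * (p * q) + e / 2 + e / 2 by lra.
have E1 : (a + dl) * (b + dl) = a * b + dl * a + dl * b + dl * dl by ring.
have E2 : p * (q + dl) = p * q + dl * p by ring.
have E3 : dl * (2 * (a + b + p + 1)) = 2 * (dl * a) + 2 * (dl * b) + 2 * (dl * p) + 2 * dl by ring.
rewrite E1 in h1; rewrite E2 in h2; rewrite E3 in dle.
move: (a * b) (p * q) (dl * dl) dd2 (dl * a) (dl * b) (dl * p) h1 h2 dle.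
move=> ab pq d2 dd2 da db dp h1 h2 dle; lra.
Qed.

Definition hstar x y : H := xget 0 [set h | is_hstar x y h].

Lemma hstarP x y : is_hstar x y (hstar x y).
Proof.
have [h Hh] := hstar_exists x y.
exact: (@xgetPex _ 0 [set h | is_hstar x y h] (ex_intro _ h Hh)).
Qed.

(** Take P = Q = 0 in the characterizing bound: no further limit is needed, and both the constant 2
    and the radius are kept. *)
Lemma hstar_bound c c' x y : 1 <= c -> 1 <= c' ->
  s c c' (hstar x y) <= 2 * s (d c c') (d c c') x * s (d c c') (d c c') y.
Proof.
move=> c1 c'1; have dd0 := d0 c1 c'1.
have := hstarP x y (pol0 F r r') (pol0 F r r') c1 c'1.
rewrite iota0 subr0 s_0 // mulr0 mul0r addr0.
have -> : star (pol0 F r r') (pol0 F r r') = pol0 F r r'.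
  apply/val_inj/malgP => m.
  rewrite -[val (star _ _)]/(pstar F hbar 0 0) (@pstar_linl _ _ _ F hbar (-1) 0 0 0) => [|k].
    by rewrite scaleN1r addNr mcoeff0.
  by rewrite !mcoeff0 scaler0 addr0.
by rewrite iota0 subr0.
Qed.

(** The arguments are their own approximations, which makes the characterizing bound zero for every
    seminorm. *)
Lemma hstar_iota P Q : hstar (iota P) (iota Q) = iota (star P Q).
Proof.
apply: s_separates => c c1; have dd0 := d0 c1 c1.
have := hstarP (iota P) (iota Q) P Q c1 c1.
by rewrite !subrr s_0 // !mulr0 mul0r addr0.
Qed.

Lemma hstar_continuous : continuous (fun xy : H * H => hstar xy.1 xy.2).
Proof.
move=> [x y] A /= /nbhs_sP [c [e [c1 e0 HA]]].
have c0 : 0 <= c by apply: le_trans c1.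
have dd0 := d0 c1 c1; set dd := d c c in dd0 *.
set a := s dd dd x; set b := s dd dd y.
have a0 : 0 <= a by exact: s_ge0.
have b0 : 0 <= b by exact: s_ge0.
(* Both products are compared with one product P star Q from Pol. The errors add up to at most dl (6
   a + 6 b + 10), and 13 leaves a strict margin. *)
have [|dl [dl0 dl1 dle]] := @small_delta R (6 * a + 6 * b + 13) e _ e0; first by lra.
have [P hP] := approx x dd0 dl0; have [Q hQ] := approx y dd0 dl0.
exists ([set x' | s dd dd (x' - x) < dl], [set y' | s dd dd (y' - y) < dl]).
  by split; exact: nbhs_s.
move=> [x' y'] /= [hx hy]; apply: HA.
apply: le_lt_trans (s_tri _ (iota (star P Q)) _ c0 c0) _.
have K1 := hstarP x' y' P Q c1 c1; have := hstarP x y P Q c1 c1.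
rewrite s_dist // => K2; rewrite -/dd -/b in K1 K2.
have p1 : s dd dd (x' - iota P) <= 2 * dl by have := s_tri x' x (iota P) dd0 dd0; lra.
have p2 : s dd dd y' <= b + dl.
  by have := s_le_dist y' y dd0 dd0; rewrite [s _ _ (y - y')]s_dist // -/b; lra.
have p3 : s dd dd (iota P) <= a + dl.
  by have := s_le_dist (iota P) x dd0 dd0; rewrite -/a; lra.
have p4 : s dd dd (y' - iota Q) <= 2 * dl by have := s_tri y' y (iota Q) dd0 dd0; lra.
have q0 z : 0 <= s dd dd z by exact: s_ge0.
have h1 := ler_pM (q0 _) (q0 _) p1 p2; have h2 := ler_pM (q0 _) (q0 _) p3 p4.
have h3 := ler_pM (q0 _) b0 (ltW hP) (lexx b); have h4 := ler_pM (q0 _) (q0 _) p3 (ltW hQ).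
rewrite -!mulrA in K1 K2.
move: (s c c _) (s c c _) K1 K2 => u v K1 K2.
have dd2 : dl * dl <= dl by rewrite ger_pMr.
have E1 : 2 * dl * (b + dl) = 2 * (dl * b) + 2 * (dl * dl) by ring.
have E2 : (a + dl) * (2 * dl) = 2 * (dl * a) + 2 * (dl * dl) by ring.
have E3 : (a + dl) * dl = dl * a + dl * dl by ring.
have E4 : dl * (6 * a + 6 * b + 13) = 6 * (dl * a) + 6 * (dl * b) + 13 * dl by ring.
rewrite E1 in h1; rewrite E2 in h2; rewrite E3 in h4; rewrite E4 in dle.
apply: lt_le_trans dle.
have da0 : 0 <= dl * a by rewrite mulr_ge0 // ltW.
have db0 : 0 <= dl * b by rewrite mulr_ge0 // ltW.
move: (dl * a) (dl * b) (dl * dl) da0 db0 dd2 h1 h2 h3 h4 => da db d2 da0 db0 dd2.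
move: (s dd dd (x' - iota P) * _) (s dd dd (iota P) * _) (s dd dd (x - iota P) * _)
  (s dd dd (iota P) * _) K1 K2 => w1 w2 w3 w4 K1 K2 h1 h2 h3 h4; lra.
Qed.

Lemma cont_hstar (u v : H -> H) : continuous u -> continuous v ->
  continuous (fun t => hstar (u t) (v t)).
Proof.
move=> cu cv t; apply: (@continuous_comp _ _ _ (fun t => (u t, v t))
  (fun xy : H * H => hstar xy.1 xy.2)); last exact: hstar_continuous.
by apply: cvg_pair; [exact: cu|exact: cv].
Qed.

Let iota_lin a P Q S : @lincomb R n G F r r' a P Q S -> iota S = a *: iota P + iota Q.
Proof. by have [_ _ lin _ _] := iotaP; exact: lin. Qed.

(** Each identity holds on the image of Pol and is freed of this restriction one variable at a time,
    because [dense_eq] concerns functions of a single variable. *)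
Lemma hstar_bilinear : is_bilinear hstar.
Proof.
have [lin1 lin2 _] := star_pol_std F r' r0 hbar; have cid := cont_id; have cst := cont_cst.
split=> a x y z.
  have E1 P P' Q : hstar (a *: iota P + iota P') (iota Q) =
      a *: hstar (iota P) (iota Q) + hstar (iota P') (iota Q).
    have [S HS] := @lincomb_exists R n G F r r' a P P'.
    by rewrite -(iota_lin HS) !hstar_iota; apply: iota_lin; exact: lin1.
  have E2 P' Q t : hstar (a *: t + iota P') (iota Q) = a *: hstar t (iota Q) + hstar (iota P') (iota Q).
    move: t; apply: dense_eq => [||P]; last exact: E1.
      by apply: cont_hstar => //; exact: cont_lin.
    by apply: cont_lin => //; exact: cont_hstar.
  have E3 Q t : hstar (a *: x + t) (iota Q) = a *: hstar x (iota Q) + hstar t (iota Q).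
    move: t; apply: dense_eq => [||P]; last exact: E2.
      by apply: cont_hstar => //; exact: cont_lin.
    by apply: cont_lin => //; exact: cont_hstar.
  move: z; apply: dense_eq => [||Q]; last exact: E3.
    exact: cont_hstar.
  by apply: cont_lin; exact: cont_hstar.
have E1 P Q Q' : hstar (iota P) (a *: iota Q + iota Q') =
    a *: hstar (iota P) (iota Q) + hstar (iota P) (iota Q').
  have [S HS] := @lincomb_exists R n G F r r' a Q Q'.
  by rewrite -(iota_lin HS) !hstar_iota; apply: iota_lin; exact: lin2.
have E2 P Q' t : hstar (iota P) (a *: t + iota Q') = a *: hstar (iota P) t + hstar (iota P) (iota Q').
  move: t; apply: dense_eq => [||Q]; last exact: E1.
    by apply: cont_hstar => //; exact: cont_lin.
  by apply: cont_lin => //; exact: cont_hstar.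
have E3 P t : hstar (iota P) (a *: x + t) = a *: hstar (iota P) x + hstar (iota P) t.
  move: t; apply: dense_eq => [||Q]; last exact: E2.
    by apply: cont_hstar => //; exact: cont_lin.
  by apply: cont_lin => //; exact: cont_hstar.
move: z; apply: dense_eq => [||P]; last exact: E3.
  exact: cont_hstar.
by apply: cont_lin; exact: cont_hstar.
Qed.

End Product.

End CompletionStar.

Theorem theorem6p3 (R : realType) (n : nat) (G : lieGroup R n) (F : frame G)
    (r r' : R) (H : topologicalLmodType (cplx R)) (iota : Pol F r r' -> H)
    (seminorm : R -> R -> H -> R) :
  connected [set: G] -> 0 <= r -> 1 <= r' ->
  is_completion iota ->
  (forall c c' : R, 0 <= c -> 0 <= c' ->
     continuous_extension iota (fun P => tensor_norm F r r' c c' (val P))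
       (seminorm c c')) ->
  exists (star : cplx R -> Pol F r r' -> Pol F r r' -> Pol F r r')
         (hstar : cplx R -> H -> H -> H),
  [/\ forall hbar : cplx R,
        is_star_std hbar (star hbar) /\
        continuous (fun PQ : Pol F r r' * Pol F r r' => star hbar PQ.1 PQ.2),
      forall hbar : cplx R,
        [/\ is_bilinear (hstar hbar),
            continuous (fun xy : H * H => hstar hbar xy.1 xy.2) &
            forall P Q : Pol F r r',
              hstar hbar (iota P) (iota Q) = iota (star hbar P Q)] &
      forall c c' : R, 1 <= c -> 1 <= c' ->
        exists d : cplx R -> R,
        [/\ continuous d, forall hbar : cplx R, 1 <= d hbar &
            forall (hbar : cplx R) (x y : H),
              seminorm c c' (hstar hbar x y) <=
                2 * seminorm (d hbar) (d hbar) x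
                  * seminorm (d hbar) (d hbar) y]].
Proof.
move=> _ r0 r1 iotaP sP.
exists (fun hbar => star_pol r0 hbar), (hstar (iota := iota) (s := seminorm) r0).
split=> [hbar|hbar|c c' c1 c'1].
- by split; [exact: star_pol_std|exact: star_pol_continuous].
- split; [exact: hstar_bilinear|exact: hstar_continuous|].
  by move=> P Q; exact: hstar_iota.
exists (star_radius F r r' c c'); split=> [|hbar|hbar x y].
- exact: continuous_star_radius.
- exact: star_radius_ge1.
- exact: (hstar_bound r0 r1 iotaP sP).
Qed.
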